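(* For $x\in H$ and $T>0$ let $X(\cdot,x)$ be the mild solution of $dX=(AX+D_\xi F(X))dt+dW$, $X(0)=x$, and for $n\in\mathbb N$ let $X_n(\cdot,x)$ be the mild solution of the approximated problem $dX_n=(AX_n+D_{\xi,n}F(X_n))dt+dW$, $X_n(0)=x$. Then $$\lim_{n\to\infty}X_n(\cdot,x)=X(\cdot,x)\quad\text{in } C_W([0,T];H),$$ that is, $\lim_{n\to\infty}\sup_{t\in[0,T]}\mathbb E|X_n(t,x)-X(t,x)|_2^2=0$.
   Context: $H$ is the real Hilbert space of (classes of) $2\pi$-periodic square-integrable real functions with inner product $\langle x,y\rangle=\int_0^{2\pi}x(\xi)y(\xi)\,d\xi$ and norm $|\cdot|_2$. $D_\xi$ is differentiation in $\xi$, and $A:D(A)\subset H\to H$ is $Ax=D_\xi^2x-x$ with $D(A)=H^2_\#(0,2\pi)$ (periodic Sobolev space). For $t>0$, $K(t):=D_\xi e^{tA}$, a bounded linear operator on $H$. Standing assumption: $F\in C^1(H;H)$ with $DF\in C_b(H;\mathcal L(H))$. $W$ is a cylindrical Wiener process on $H$ defined on a probability space $(\Omega,\mathcal F,\mathbb P)$, and $W_A(t)=\int_0^te^{(t-s)A}\,dW(s)$. $C_W([0,T];H)$ is the space of all stochastic processes in $C([0,T];L^2(\Omega;H))$ adapted to $W(t)$. The mild solution $X(\cdot,x)\in C_W([0,T];H)$ is the unique process with $X(t,x)=e^{tA}x+\int_0^tK(t-s)F(X(s,x))\,ds+W_A(t)$. Let $e_k$ be the normalized trigonometric functions, $e_k$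 proportional to $\cos(k\xi)$ for $k\ge0$ and to $\sin(k\xi)$ for $k<0$; $P_n$ is the orthogonal projection of $H$ onto the linear span of $\{e_{-n},\dots,e_n\}$, $D_{\xi,n}=D_\xi\circ P_n\in\mathcal L(H)$, and $K_n(t)=D_{\xi,n}e^{tA}$. The mild solution $X_n(\cdot,x)\in C_W([0,T];H)$ is the unique process with $X_n(t,x)=e^{tA}x+\int_0^tK_n(t-s)F(X_n(s,x))\,ds+W_A(t)$. *)

(* Defs.v *)
From HB Require Import structures.
From mathcomp Require Import all_boot all_order all_algebra.
From mathcomp Require Import all_classical all_reals all_analysis.
From mathcomp Require Import ess_sup_inf measurable_realfun.

Set Implicit Arguments.
Unset Strict Implicit.
Unset Printing Implicit Defensive.

Import Order.TTheory GRing.Theory Num.Theory.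
Import numFieldNormedType.Exports.

Local Open Scope classical_set_scope.
Local Open Scope ring_scope.

(* The library provides [LspaceType mu p1] (a.e. classes of functions with
   finite p-norm) without any algebraic structure; we make it a normed module,
   the operations and the norm being computed on representatives. *)
Section Lspace_normed_module.
Context d (T : measurableType d) (R : realType).
Context (mu : {measure set T -> \bar R}) (p : \bar R) (p1 : (1 <= p)%E).

Local Notation LF := (LfunType mu p1).
Local Notation LS := (LspaceType mu p1).

Lemma Lnorm_ae_eq (f g : T -> R) : measurable_fun setT f ->
  measurable_fun setT g -> f = g %[ae mu] ->
  ('N[mu]_p[EFin \o f] = 'N[mu]_p[EFin \o g])%E.
Proof.
move=> mf mg fg; rewrite unlock /Lnorm; case: p p1 => [r r1|_|//].
- congr (_ `^ _)%E; apply: ge0_ae_eq_integral => //.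
  + apply: (measurableT_comp (measurable_poweR r)).
    by apply: measurableT_comp => //; exact/measurable_EFinP.
  + apply: (measurableT_comp (measurable_poweR r)).
    by apply: measurableT_comp => //; exact/measurable_EFinP.
  + by move=> x _; exact: poweR_ge0.
  + by move=> x _; exact: poweR_ge0.
  + by move: fg; apply: filterS => x /= fg ?; rewrite fg.
- case: ifPn => // _; apply: eq_ess_sup.
  by move: fg; apply: filterS => x /= ->.
Qed.

Let Lfun_mfun (f : LF) : {mfun T >-> measurableTypeR R} :=
  MeasurableFun.Pack (MeasurableFun.Class
    (isMeasurableFun.Build _ _ T (measurableTypeR R) f
      (@measurable_funPT _ _ _ _ f))).

Let mpi (f : {mfun T >-> measurableTypeR R}) :
    {mfun_ mu, T >-> measurableTypeR R} :=
  (\pi_{mfun_ mu, T >-> measurableTypeR R} f)%qT.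

Let piE (f : {mfun T >-> measurableTypeR R}) :
  (mpi f : T -> R) = (f : T -> R) %[ae mu].
Proof.
have /eqP : repr (mpi f) = f
  %[mod {mfun_ mu, T >-> measurableTypeR R}]%qT by rewrite reprK.
by rewrite eqmodE => /asboolP.
Qed.

Let measurable_repr (x : {mfun_ mu, T >-> measurableTypeR R}) :
  measurable_fun setT (x : T -> R).
Proof. exact: (@measurable_funPT _ _ _ _ (repr x)). Qed.

Let Lclass_finite (f : LF) : finite_norm mu p (mpi (Lfun_mfun f)).
Proof.
rewrite /finite_norm (Lnorm_ae_eq (measurable_repr _) _ (piE (Lfun_mfun f))) //.
exact: Lfunction_finite.
Qed.

Definition Lclass (f : LF) : LS :=
  LebesgueSpace.Pack (LebesgueSpace.Class
    (isFinLebesgue.Build _ _ _ _ _ p1 _ (Lclass_finite f))).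

Lemma LspaceP (x y : LS) : (x : T -> R) = (y : T -> R) %[ae mu] -> x = y.
Proof.
case: x y => [x [[xf]]] [y [[yf]]] /= xy.
suff e : x = y by move: xf yf; rewrite e => xf yf; rewrite (Prop_irrelevance xf yf).
by rewrite -[x]reprK -[y]reprK; apply/eqmodP/asboolP.
Qed.

Lemma LclassE (f : LF) : (Lclass f : T -> R) = (f : T -> R) %[ae mu].
Proof. exact: piE. Qed.

Lemma Lspace_Lfun (x : LS) : (x : T -> R) \in Lfun mu p.
Proof.
by apply/andP; split; rewrite inE /=; [exact: measurable_repr|
  exact: Lebesgue_finite].
Qed.

Definition Lrep (x : LS) : LF := Lfun_Sub p1 (Lspace_Lfun x).

Lemma LrepK : cancel Lrep Lclass.
Proof. by move=> x; apply: LspaceP; exact: LclassE. Qed.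

Lemma Lclass_eq (f g : LF) : (f : T -> R) = g %[ae mu] -> Lclass f = Lclass g.
Proof.
move=> fg; apply: LspaceP; apply: ae_eq_trans (LclassE f) _.
by apply: ae_eq_trans fg _; apply/ae_eq_sym/LclassE.
Qed.

Lemma LclassK (f : LF) : (Lrep (Lclass f) : T -> R) = f %[ae mu].
Proof. exact: LclassE. Qed.

HB.instance Definition _ := gen_eqMixin LS.
HB.instance Definition _ := gen_choiceMixin LS.

Let add (x y : LS) := Lclass (Lrep x + Lrep y).
Let opp (x : LS) := Lclass (- Lrep x).
Let scale (a : R) (x : LS) := Lclass (a *: Lrep x).

Let addE (f g : LF) : add (Lclass f) (Lclass g) = Lclass (f + g).
Proof.
apply: Lclass_eq; apply: filterS2 (LclassK f) (LclassK g) => x fE gE _.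
exact: (congr2 +%R (fE I) (gE I)).
Qed.

Let oppE (f : LF) : opp (Lclass f) = Lclass (- f).
Proof.
apply: Lclass_eq; apply: filterS (LclassK f) => x fE _.
exact: (congr1 -%R (fE I)).
Qed.

Let scaleE a (f : LF) : scale a (Lclass f) = Lclass (a *: f).
Proof.
apply: Lclass_eq; apply: filterS (LclassK f) => x fE _.
exact: (congr1 (fun u => a * u) (fE I)).
Qed.

Let addA : associative add.
Proof.
by move=> x y z; rewrite -[x]LrepK -[y]LrepK -[z]LrepK !addE addrA.
Qed.

Let addC : commutative add.
Proof. by move=> x y; rewrite /add addrC. Qed.

Let add0 : left_id (Lclass 0) add.
Proof. by move=> x; rewrite -[x]LrepK addE add0r. Qed.

Let addN : left_inverse (Lclass 0) opp add.
Proof. by move=> x; rewrite -[x]LrepK oppE addE addNr. Qed.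

HB.instance Definition _ := GRing.isZmodule.Build LS addA addC add0 addN.

Let scaleA a b (x : LS) : scale a (scale b x) = scale (a * b) x.
Proof. by rewrite -[x]LrepK !scaleE scalerA. Qed.

Let scale1 : left_id 1 scale.
Proof. by move=> x; rewrite -[x]LrepK scaleE scale1r. Qed.

Let scaleDr : right_distributive scale +%R.
Proof.
by move=> a x y; rewrite -[x]LrepK -[y]LrepK [_ + _]addE !scaleE scalerDr -addE.
Qed.

Let scaleDl x : {morph scale^~ x : a b / a + b}.
Proof. by move=> a b; rewrite -[x]LrepK !scaleE scalerDl -addE. Qed.

HB.instance Definition _ :=
  GRing.Zmodule_isLmodule.Build R LS scaleA scale1 scaleDr scaleDl.

Lemma Lclass0 : Lclass 0 = 0. Proof. by []. Qed.

Lemma LclassD (f g : LF) : Lclass (f + g) = Lclass f + Lclass g.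
Proof. by rewrite -addE. Qed.

Lemma LclassZ a (f : LF) : Lclass (a *: f) = a *: Lclass f.
Proof. by rewrite -scaleE. Qed.

Let norm (x : LS) : R := fine ('N[mu]_p[EFin \o x])%E.

Let normE (f : LF) : norm (Lclass f) = fine ('N[mu]_p[EFin \o f])%E.
Proof. by rewrite /norm (Lnorm_ae_eq (measurable_repr _) _ (LclassE f)). Qed.

Let normD x y : norm (x + y) <= norm x + norm y.
Proof.
by rewrite -[x]LrepK -[y]LrepK -LclassD !normE; exact: ler_LnormD.
Qed.

Let normZ a x : norm (a *: x) = `|a| * norm x.
Proof.
rewrite -[x]LrepK -LclassZ !normE; apply: EFin_inj.
by rewrite EFinM !finite_norm_fine LnormZ.
Qed.

Let norm0_eq0 x : norm x = 0 -> x = 0.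
Proof.
rewrite -[x]LrepK normE => /fine_Lnormr_eq0 x0.
by rewrite -Lclass0; apply: Lclass_eq.
Qed.

HB.instance Definition _ := Lmodule_isNormed.Build R LS normD normZ norm0_eq0.

Lemma Lspace_normE (x : LS) : `|x| = fine ('N[mu]_p[EFin \o x])%E.
Proof. by []. Qed.

End Lspace_normed_module.

Section L2_circle.
Context (R : realType).

Definition circle_measure : {measure set (measurableTypeR R) -> \bar R} :=
  mrestr (@lebesgue_measure R) (measurable_itv `]0, (pi *+ 2 : R)[).

(* A 2pi-periodic function is identified with its restriction to ]0, 2pi[;
   periodicity enters through the test functions of [weak_deriv]. *)
Definition H : normedModType R := LspaceType2 circle_measure.

Definition dot (x y : H) : R := \int[circle_measure]_xi (x xi * y xi).

Definition trig (k : int) (xi : R) : R :=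
  if k == 0 then (Num.sqrt (pi *+ 2))^-1
  else (Num.sqrt pi)^-1 *
       (if 0 < k then cos (k%:~R * xi) else sin (k%:~R * xi)).

Lemma trig_Lfun k : trig k \in Lfun circle_measure 2%:E.
Proof.
have mtrig : measurable_fun setT (trig k : measurableTypeR R -> R).
  apply: continuous_measurable_fun; rewrite /trig => xi.
  have [_|k0] := eqVneq k 0; first exact: cvg_cst.
  have ck : (fun t : R => k%:~R * t) @ xi --> (k%:~R * xi : R).
    by apply: cvgMr; exact: cvg_id.
  case: (0 < k); apply: cvgMr.
    exact: (continuous_comp ck (@continuous_cos _ _)).
  exact: (continuous_comp ck (@continuous_sin _ _)).
have [M trigM] : exists M : R, forall xi, `|trig k xi| <= M.
  exists (`|(Num.sqrt (pi *+ 2))^-1| + `|(Num.sqrt pi)^-1|) => xi.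
  rewrite /trig; have [_|_] := eqVneq k 0; first by rewrite lerDl.
  rewrite normrM ler_wpDl// ler_piMr//.
  by case: ifPn => _; rewrite ler_norml ?cos_geN1 ?cos_le1 ?sin_geN1 ?sin_le1.
apply/andP; split; rewrite inE//= /finite_norm unlock poweR_lty//.
apply: (@le_lt_trans _ _ (\int[circle_measure]_xi (cst (M `^ 2)%:E xi))%E).
  apply: ge0_le_integral => //.
  - by move=> xi _; exact: poweR_ge0.
  - by apply: (measurableT_comp (measurable_poweR 2));
      apply: measurableT_comp => //; exact/measurable_EFinP.
  - move=> xi _; rewrite poweR_EFin lee_fin.
    by apply: ge0_ler_powR; rewrite ?nnegrE ?(le_trans _ (trigM xi)).
rewrite integral_cst// [circle_measure _]/= /mrestr setTI.
rewrite lebesgue_measure_itv/=; case: ifPn => _; rewrite ?mule0 ?ltry//.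
Qed.

Definition e_ (k : int) : H := Lclass (Lfun_Sub (lee1n 2) (trig_Lfun k)).

Definition smooth_periodic (phi : R -> R) :=
  (forall xi, phi (xi + pi *+ 2) = phi xi) /\
  (forall n xi, derivable (derive1n n phi) xi 1).

Definition weak_deriv (x y : H) := forall phi, smooth_periodic phi ->
  \int[circle_measure]_xi (x xi * derive1 phi xi) =
  - \int[circle_measure]_xi (y xi * phi xi).

(* Total operator: D_xi x = 0 when x has no weak derivative in H. *)
Definition D_xi (x : H) : H := xget 0 [set y | weak_deriv x y].

Definition H1_per : set H := [set x | exists y, weak_deriv x y].
Definition H2_per : set H := [set x | H1_per x /\ H1_per (D_xi x)].

Definition opA (x : H) : H := D_xi (D_xi x) - x.

Definition span_e (n : nat) : set H :=
  [set \sum_(i < n.*2.+1) c i *: e_ (i%:Z - n%:Z)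
    | c in [set: 'I_n.*2.+1 -> R]].

(* y \in E with x - y orthogonal to E; unique when it exists. *)
Definition orth_proj (E : set H) (x : H) : H :=
  xget 0 [set y | E y /\ forall z, E z -> dot (x - y) z = 0].

Definition P_ (n : nat) : H -> H := orth_proj (span_e n).
Definition D_xi_n (n : nat) (x : H) : H := D_xi (P_ n x).

(* [S t] is e^{tB}, i.e. S is the strongly continuous semigroup whose
   infinitesimal generator is the unbounded operator B with domain D. *)
Definition is_semigroup_of (D : set H) (B : H -> H) (S : R -> H -> H) :=
  [/\ forall t, 0 <= t -> linear (S t) /\ continuous (S t),
      forall x, S 0 x = x,
      forall t s x, 0 <= t -> 0 <= s -> S (t + s) x = S t (S s x),
      forall x, S t x @[t --> 0^'+] --> x &
      forall x y, (D x /\ y = B x) <->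
        (t^-1 *: (S t x - x)) @[t --> 0^'+] --> y].

(* K(t) = D_xi e^{tA} and K_n(t) = D_{xi,n} e^{tA}, where S t = e^{tA}. *)
Definition K_ (S : R -> H -> H) (t : R) (x : H) : H := D_xi (S t x).
Definition K_n (S : R -> H -> H) (n : nat) (t : R) (x : H) : H :=
  D_xi_n n (S t x).

Definition C1_bounded_diff (F : H -> H) :=
  [/\ forall x, differentiable F x,
      forall x eps, 0 < eps ->
        \forall y \near x, forall h, `|'d F y h - 'd F x h| <= eps * `|h| &
      exists M, forall x h, `|'d F x h| <= M * `|h|].

(* Squared Hilbert-Schmidt norm, in the orthonormal basis (e_k). *)
Definition hs_norm2 (B : H -> H) : \bar R :=
  \esum_(k in [set: int]) (`|B (e_ k)| ^+ 2)%:E.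

Section Processes.
Context d (Omega : measurableType d) (P : probability Omega R).

(* (E |Y|^2)^(1/2) *)
Definition L2n (Y : Omega -> H) : \bar R :=
  ('N[P]_2%:E[EFin \o (fun w => `|Y w|%R)])%E.

Definition L2rv (Y : Omega -> H) :=
  (forall U, open U -> measurable (Y @^-1` U)) /\ (L2n Y < +oo)%E.

Definition past (W : R -> H -> Omega -> R) (t : R) : set (set Omega) :=
  [set C | exists s h B, [/\ 0 <= s <= t, measurable B & C = W s h @^-1` B]].

(* Natural filtration of W, augmented by the P-null sets: the processes below
   are only determined almost surely at each time. *)
Definition filtration (W : R -> H -> Omega -> R) (t : R) : set (set Omega) :=
  <<s past W t `|` [set N | measurable N /\ P N = 0%E] >>.

(* [W t h] stands for <W(t), h>.  The second argument of [normal_prob] is the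
   standard deviation; the degenerate value 0 (for which the library does not
   give a Dirac mass) is avoided by h != 0, the case h = 0 being covered by
   linearity. *)
Definition cylindrical_wiener (W : R -> H -> Omega -> R) :=
  [/\ (forall t h, 0 <= t -> measurable_fun setT (W t h)) /\
      (forall h, {ae P, forall w, W 0 h w = 0}),
      forall t a h k, 0 <= t ->
        {ae P, forall w, W t (a *: h + k) w = a * W t h w + W t k w},
      forall h, {ae P, forall w,
        {within `[0, +oo[, continuous (fun t => W t h w)}},
      forall s t h B, 0 <= s < t -> h != 0 -> measurable B ->
        P ((fun w => W t h w - W s h w) @^-1` B) =
        normal_prob 0 (Num.sqrt (t - s) * `|h|) B &
      forall s t h B C, 0 <= s < t -> measurable B -> <<s past W s >> C ->
        let incr w := W t h w - W s h w in
        P (incr @^-1` B `&` C) = (P (incr @^-1` B) * P C)%E].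

(* Y = int_0^t Phi(s) dW(s) for a deterministic integrand: L^2-limit of the
   integrals of step functions with finite-rank values
   Phi_n(s) = sum_i 1_]a_i, b_i](s) <v_i, .> u_i
   converging to Phi in L^2(0, t; Hilbert-Schmidt operators). *)
Definition is_wiener_integral (W : R -> H -> Omega -> R) (t : R)
    (Phi : R -> H -> H) (Y : Omega -> H) :=
  [/\ L2rv Y,
      forall h k, measurable_fun `]0, t] (fun s => dot (Phi s h) k) &
      exists (m : nat -> nat) (a b : nat -> nat -> R) (u v : nat -> nat -> H),
      let step n s h :=
        \sum_(i < m n) \1_`]a n i, b n i] s *: (dot (v n i) h *: u n i) in
      let int_step n w :=
        \sum_(i < m n) (W (b n i) (v n i) w - W (a n i) (v n i) w) *: u n i in
      [/\ forall n i, 0 <= a n i <= b n i /\ b n i <= t,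
          (\int[lebesgue_measure]_(s in `]0%R, t])
             hs_norm2 (fun h => Phi s h - step n s h)%R)%E @[n --> \oo] --> 0%E &
          L2n (fun w => Y w - int_step n w) @[n --> \oo] --> 0%E]].

(* Y = int_D f(s) ds, Bochner integral of an L^2(Omega; H)-valued function;
   the a.e. clause is strong measurability of f. *)
Definition is_bochner_integral (D : set R) (f : R -> Omega -> H)
    (Y : Omega -> H) :=
  L2rv Y /\
  exists (m : nat -> nat) (A : nat -> nat -> set R)
    (Z : nat -> nat -> Omega -> H),
  let step n s w := \sum_(i < m n) \1_(A n i) s *: Z n i w in
  let int_step n w :=
    \sum_(i < m n) fine (lebesgue_measure (D `&` A n i)) *: Z n i w in
  [/\ forall n i, measurable (A n i) /\ L2rv (Z n i),
      {ae lebesgue_measure, forall s, D s ->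
        L2n (fun w => f s w - step n s w) @[n --> \oo] --> 0%E},
      (\int[lebesgue_measure]_(s in D) L2n (fun w => f s w - step n s w)%R)%E
        @[n --> \oo] --> 0%E &
      L2n (fun w => Y w - int_step n w) @[n --> \oo] --> 0%E].

Definition C_W (W : R -> H -> Omega -> R) (T : R) : set (R -> Omega -> H) :=
  [set X |
    (forall t, 0 <= t <= T -> L2rv (X t) /\
       forall U, open U -> filtration W t (X t @^-1` U)) /\
    (forall t, 0 <= t <= T ->
       L2n (fun w => X s w - X t w) @[s --> within `[0, T] (nbhs t)] --> 0%E)].

Definition is_mild_solution (W : R -> H -> Omega -> R) (S : R -> H -> H)
    (WA : R -> Omega -> H) (F : H -> H) (T : R) (K : R -> H -> H) (x : H)
    (X : R -> Omega -> H) :=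
  C_W W T X /\
  forall t, 0 <= t <= T -> exists2 Y : Omega -> H,
    is_bochner_integral `]0, t[ (fun s w => K (t - s) (F (X s w))) Y &
    {ae P, forall w, X t w = S t x + Y w + WA t w}.

End Processes.
End L2_circle.

(* Main.v *)
(* In the basis [e_k] the heat semigroup and [D_xi] are explicit:
   [<S(t) x, e_k> = exp(-(k^2+1) t) <x, e_k>] and [<D_xi y, e_k> = -k <y, e_{-k}>].
   Hence [|K_n(t)| <= t^{-1/2}] and [|K_n(t) - K(t)| <= n^{-1/2} t^{-3/4}], both integrable
   at 0. For [Z_n = X_n - X] and [r(t) = (E|Z_n(t)|^2)^{1/2}], Minkowski's inequality for the
   Bochner integral gives
     [r(t) <= int_0^t (L (t-s)^{-1/2} r(s) + n^{-1/2} B (t-s)^{-3/4}) ds],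
   [L] being a Lipschitz constant of [F] and [B] a bound of [F(X(s))] in L^2. In the norm
   [sup_t e^{-bt} r(t)] with [b] large the first term is a contraction, so that
   [sup_t r(t) = O(n^{-1/2})].
   The spectral description of [S] has to be extracted from its generator: [S(t) e_k] stays
   in the span of [e_k] and [e_{-k}], because [S(t)] commutes with [A], and there it solves
   [u' = -(k^2+1) u]. *)
Require Import Defs.
From HB Require Import structures.
From mathcomp Require Import all_boot all_order all_algebra.
From mathcomp Require Import all_classical all_reals all_analysis.
From mathcomp Require Import measurable_realfun ring lra zify.

Set Implicit Arguments.
Unset Strict Implicit.
Unset Printing Implicit Defensive.

Import Order.TTheory GRing.Theory Num.Theory.
Import numFieldNormedType.Exports.

Local Open Scope classical_set_scope.
Local Open Scope ring_scope.

(** * The Hilbert space H *)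

(** [D_xi] and [P_] are choice operators with a default value, so no coefficient formula holds
    before existence and uniqueness are known. Existence of K(t)x comes from Riesz-Fischer, hence
    from completeness of H; uniqueness comes from the totality of the [e_ k]. The exponent 3/4 is a
    compromise. On the frequencies |k| > n, |k| exp(-k^2 t) is still of order t^{-1/2} when t is
    near n^{-2}, so a bound in t^{-1/2} alone shows no decay in n. Writing |k| = |k|^{-1/2}
    |k|^{3/2} gains n^{-1/2} at the price of t^{-3/4}, which remains integrable, and every power
    involved is an integer power of t^{1/4}. The same kernel serves for the contraction, since
    t^{-1/2} exp(-b^4 t) <= b^{-1} t^{-3/4}: a single integral has to be computed, and the factor
    b^{-1} is what a large weight gains. In X_n - X the terms S(t)x and W_A cancel. The fixed point
    argument acts on explicit majorants rho exp(b^4 t) of r, so that the function integrated against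
    the kernel is always explicit. *)

Section circle_integral.
Context (R : realType).
Local Notation mu := (@circle_measure R).

Lemma circle_integral (f : R -> \bar R) : measurable_fun setT f ->
  (forall x, 0 <= f x)%E ->
  (\int[mu]_x f x = \int[lebesgue_measure]_(x in `]0%R, (pi *+ 2)%R[) f x)%E.
Proof.
move=> mf f0; have mD : measurable (`]0%R, (pi *+ 2 : R)[%classic : set (measurableTypeR R)) by [].
rewrite (@ge0_negligible_integral _ _ _ mu setT (~` `]0%R, (pi *+ 2 : R)[%classic))//; last 2 first.
- exact: measurableC.
- by rewrite [LHS]/= /mrestr setICl measure0.
rewrite setTD setCK; apply: eq_measure_integral => A mA AD.
by rewrite [LHS]/= /mrestr setIidl.
Qed.

Lemma circle_Rintegral (f : R -> R) : measurable_fun setT f ->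
  \int[mu]_x f x = \int[lebesgue_measure]_(x in `]0%R, (pi *+ 2)[) f x.
Proof.
move=> mf; rewrite /Rintegral; congr fine.
rewrite integralE [RHS]integralE; congr (_ - _)%E.
- by rewrite circle_integral//; exact/measurable_funepos/measurable_EFinP.
- by rewrite circle_integral//; exact/measurable_funeneg/measurable_EFinP.
Qed.

Lemma circle_measure_setT : mu setT = (pi *+ 2)%:E.
Proof.
rewrite [LHS]/= /mrestr setTI lebesgue_measure_itv/= lte_fin.
by rewrite mulrn_wgt0 ?pi_gt0// oppr0 adde0.
Qed.

Lemma circle_FTC (F f : R -> R) : (forall x : R, is_derive x 1 F (f x)) ->
  continuous f -> \int[mu]_x f x = F (pi *+ 2) - F 0.
Proof.
move=> dF cf; have pi20 : 0 < pi *+ 2 :> R by rewrite mulrn_wgt0 ?pi_gt0.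
have mf : measurable_fun setT (f : measurableTypeR R -> R) by exact: continuous_measurable_fun.
have cF : continuous F.
  by move=> x; apply: differentiable_continuous; apply/derivable1_diffP; case: (dF x).
rewrite circle_Rintegral// /Rintegral.
(* The end points are null, and the fundamental theorem is applied on the closed interval. *)
rewrite -(@integral_itv_bndoo _ 0 (pi *+ 2) _ true false); last by apply/measurable_EFinP; exact: measurable_funTS.
rewrite (@continuous_FTC2 _ f F)//.
- exact: continuous_subspaceT.
- split.
  + by move=> x _; case: (dF x).
  + apply: cvg_at_right_filter; exact: cF.
  + apply: cvg_at_left_filter; exact: cF.
- by move=> x _; rewrite derive1E; apply: derive_val.
Qed.

End circle_integral.

Section ae_lemmas.
Context d (T : measurableType d) (R : realType) (m : {measure set T -> \bar R}).

Lemma ae_mp (P Q : T -> Prop) : (forall t, P t -> Q t) ->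
  {ae m, forall t, P t} -> {ae m, forall t, Q t}.
Proof. by move=> PQ; apply: filterS. Qed.

Lemma ae_mp2 (P Q S : T -> Prop) : (forall t, P t -> Q t -> S t) ->
  {ae m, forall t, P t} -> {ae m, forall t, Q t} -> {ae m, forall t, S t}.
Proof. by move=> PQ; apply: filterS2. Qed.

End ae_lemmas.

Section fatou_bound.
Context d (T : measurableType d) (R : realType) (m : {measure set T -> \bar R}).
Local Open Scope ereal_scope.

Lemma limn_einf_le (u : (\bar R)^nat) (c : \bar R) N :
  (forall n, (N <= n)%N -> u n <= c) -> limn_einf u <= c.
Proof.
move=> uc; rewrite limn_einf_lim; apply: lime_le; first exact: is_cvg_einfs.
apply: nearW => n; apply: (@le_trans _ _ (u (maxn n N))); last by apply: uc; exact: leq_maxr.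
by apply: ereal_inf_lbound; exists (maxn n N) => //=; exact: leq_maxl.
Qed.

(** Fatou's lemma for a convergent sequence whose integrals are bounded from some rank on. It serves
    for the completeness of H and for the singular kernel, where no dominating function is at
    hand. *)
Lemma integral_lim_le (D : set T) (f : (T -> \bar R)^nat) (g : T -> \bar R) (c : \bar R) N :
  measurable D -> (forall n, measurable_fun D (f n)) ->
  (forall n x, D x -> 0 <= f n x) -> (forall x, D x -> f ^~ x @ \oo --> g x) ->
  (forall n, (N <= n)%N -> \int[m]_(x in D) f n x <= c) ->
  \int[m]_(x in D) g x <= c.
Proof.
move=> mD mf f0 fg fc; rewrite (_ : \int[m]_(x in D) g x = \int[m]_(x in D) limn_einf (f ^~ x)).
  by apply: le_trans (fatou _ _ _ _) _ => //; exact: limn_einf_le fc.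
apply: eq_integral => x /[!inE] Dx; have fx := fg _ Dx.
by rewrite is_cvg_limn_einfE ?(cvg_lim _ fx)//; apply: cvgP fx.
Qed.

End fatou_bound.

Section nonmeasurable_integral.
Context d (T : measurableType d) (R : realType) (m : {measure set T -> \bar R}).
Local Open Scope ereal_scope.

(** The integral of a nonnegative function is a supremum over the simple functions below it, which
    is monotone whatever the measurability. *)
Lemma ge0_le_integral_nonmeas (D : set T) (f g : T -> \bar R) :
  (forall x, D x -> 0 <= f x) -> (forall x, D x -> f x <= g x) ->
  \int[m]_(x in D) f x <= \int[m]_(x in D) g x.
Proof.
move=> f0 fg; have g0 x : D x -> 0 <= g x by move=> Dx; exact: le_trans (f0 _ Dx) (fg _ Dx).
rewrite !ge0_integralE//; apply: ub_ereal_sup => _ [h hf <-].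
apply: ereal_sup_ubound; exists h => // x; apply: le_trans (hf x) _.
exact: lee_restrict.
Qed.

End nonmeasurable_integral.

Section dot_theory.
Context (R : realType).
Local Notation mu := (@circle_measure R).
Implicit Types (x y z : H R) (a : R).

Lemma measurable_H x : measurable_fun setT (x : R -> R).
Proof. by case/andP: (Lspace_Lfun x) => /[1!inE]. Qed.

Lemma H_Lfun x : (x : R -> R) \in Lfun mu 2%:E.
Proof. exact: Lspace_Lfun. Qed.

Lemma H_add_ae x y : ((x + y : H R) : R -> R) = (fun t => x t + y t) %[ae mu].
Proof.
by have := LclassE (Lrep x + Lrep y); rewrite LclassD !LrepK.
Qed.

Lemma H_scale_ae a x : ((a *: x : H R) : R -> R) = (fun t => a * x t) %[ae mu].
Proof. by have := LclassE (a *: Lrep x); rewrite LclassZ LrepK. Qed.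

Lemma H_sub_ae x y : ((x - y : H R) : R -> R) = (fun t => x t - y t) %[ae mu].
Proof.
have h1 := H_add_ae x (- y).
have h2 := H_scale_ae (- 1) y; rewrite scaleN1r in h2.
by apply: ae_mp2 h1 h2 => t h1 h2 _; rewrite h1// h2// mulN1r.
Qed.

Lemma H_sub_aeW x y (f g : R -> R) : (x : R -> R) = f %[ae mu] -> (y : R -> R) = g %[ae mu] ->
  ((x - y : H R) : R -> R) = (fun t => f t - g t) %[ae mu].
Proof.
move=> xf yg; have h : {ae mu, forall t, (x : R -> R) t = f t /\ (y : R -> R) t = g t}.
  by apply: ae_mp2 xf yg => t h1 h2; rewrite h1// h2.
by apply: ae_mp2 (H_sub_ae x y) h => t h1 [h2 h3] _; rewrite h1// h2 h3.
Qed.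

Lemma H_add_aeW x y (f g : R -> R) : (x : R -> R) = f %[ae mu] -> (y : R -> R) = g %[ae mu] ->
  ((x + y : H R) : R -> R) = (fun t => f t + g t) %[ae mu].
Proof.
move=> xf yg; have h : {ae mu, forall t, (x : R -> R) t = f t /\ (y : R -> R) t = g t}.
  by apply: ae_mp2 xf yg => t h1 h2; rewrite h1// h2.
by apply: ae_mp2 (H_add_ae x y) h => t h1 [h2 h3] _; rewrite h1// h2 h3.
Qed.

Lemma H_zero_ae : ((0 : H R) : R -> R) = (fun t => 0) %[ae mu].
Proof. rewrite -Lclass0; exact: LclassE. Qed.

Lemma dot_integrable x y : mu.-integrable setT (EFin \o (fun t => x t * y t)).
Proof. by apply/Lfun1_integrable; apply: Lfun2_mul_Lfun1; exact: H_Lfun. Qed.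

(** The representative of a class such as [x + y] or [e_ k] is a chosen one, known only up to a null
    set; computations go through explicit measurable functions. *)
Lemma dot_ae x y (f g : R -> R) : measurable_fun setT f -> measurable_fun setT g ->
  (x : R -> R) = f %[ae mu] -> (y : R -> R) = g %[ae mu] ->
  dot x y = \int[mu]_t (f t * g t).
Proof.
move=> mf mg xf yg; rewrite /dot /Rintegral; congr fine.
apply: ae_eq_integral => //.
- by apply/measurable_EFinP; apply: measurable_funM; exact: measurable_H.
- by apply/measurable_EFinP; exact: measurable_funM.
- by apply: ae_mp2 xf yg => t xt yt _; rewrite xt// yt.
Qed.

Lemma dotC x y : dot x y = dot y x.
Proof. by rewrite /dot; apply: eq_Rintegral => t _; rewrite mulrC. Qed.

Lemma dotDl x y z : dot (x + y) z = dot x z + dot y z.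
Proof.
have mx := @measurable_H.
rewrite (@dot_ae (x + y) z (fun t => x t + y t) z)//; last 3 first.
- by apply: measurable_funD.
- exact: H_add_ae.
- by apply: aeW.
rewrite -RintegralD//; [|exact: dot_integrable|exact: dot_integrable].
by apply: eq_Rintegral => t _; rewrite mulrDl.
Qed.

Lemma dotZl a x y : dot (a *: x) y = a * dot x y.
Proof.
have mx := @measurable_H.
rewrite (@dot_ae (a *: x) y (fun t => a * x t) y)//; last 3 first.
- by apply: measurable_funM.
- exact: H_scale_ae.
- by apply: aeW.
rewrite -RintegralZl//; last exact: dot_integrable.
by apply: eq_Rintegral => t _; rewrite mulrA.
Qed.

Lemma dotNl x y : dot (- x) y = - dot x y.
Proof. by rewrite -scaleN1r dotZl mulN1r. Qed.

Lemma dotBl x y z : dot (x - y) z = dot x z - dot y z.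
Proof. by rewrite dotDl dotNl. Qed.

Lemma dotDr x y z : dot z (x + y) = dot z x + dot z y.
Proof. by rewrite dotC dotDl !(dotC z). Qed.

Lemma dotZr a x y : dot y (a *: x) = a * dot y x.
Proof. by rewrite dotC dotZl dotC. Qed.

Lemma dotNr x y : dot x (- y) = - dot x y.
Proof. by rewrite dotC dotNl dotC. Qed.

Lemma dotBr x y z : dot z (x - y) = dot z x - dot z y.
Proof. by rewrite dotDr dotNr. Qed.

Lemma dot0l x : dot 0 x = 0.
Proof. by rewrite -(scale0r x) dotZl mul0r. Qed.

Lemma dot0r x : dot x 0 = 0.
Proof. by rewrite dotC dot0l. Qed.

Lemma dot_suml (I : Type) (r : seq I) (P : pred I) (f : I -> H R) x :
  dot (\sum_(i <- r | P i) f i) x = \sum_(i <- r | P i) dot (f i) x.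
Proof.
elim: r => [|i r IH]; first by rewrite !big_nil dot0l.
by rewrite !big_cons; case: ifP => // _; rewrite dotDl IH.
Qed.

Lemma dotxx x : dot x x = `|x| ^+ 2.
Proof.
rewrite Lspace_normE /dot /Rintegral.
have <- : ('N[mu]_2%:E[EFin \o (x : R -> R)]%E `^ 2)%E = (\int[mu]_t (x t * x t)%:E)%E.
  rewrite powR_Lnorm//; apply: eq_integral => t _ /=.
  by rewrite powR_mulrn// real_normK ?num_real.
rewrite fine_poweR powR_mulrn// fine_ge0//; exact: Lnorm_ge0.
Qed.

Lemma CS_dot x y : `|dot x y| <= `|x| * `|y|.
Proof.
have [->|y0] := eqVneq y 0; first by rewrite dot0r !normr0 mulr0.
have yp : 0 < `|y| by rewrite normr_gt0.
(* Squared distance from [x] to its projection on the line of [y]. *)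
have := sqr_ge0 `|x - (dot x y / `|y| ^+ 2) *: y|.
rewrite -[X in 0 <= X]dotxx !dotBl !dotBr !dotZl !dotZr !dotxx (dotC y x).
set d := dot x y; set X := `|x|; set Y := `|y|.
rewrite [X in 0 <= X](_ : _ = X ^+ 2 - d ^+ 2 / Y ^+ 2); last first.
  by field; rewrite gt_eqF.
rewrite subr_ge0 ler_pdivrMr ?exprn_gt0// -exprMn => h.
by have := ler_wsqrtr h; rewrite !sqrtr_sqr (ger0_norm (mulr_ge0 _ _)) ?normr_ge0.
Qed.

Lemma dot_cvgl {T : Type} {F : set_system T} {FF : Filter F} (u : T -> H R) x y :
  u @ F --> x -> dot (u t) y @[t --> F] --> dot x y.
Proof.
move=> ux; apply/cvgrPdist_le => e e0.
have y1 : 0 < `|y| + 1 by rewrite ltr_wpDl.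
have e1 : 0 < e / (`|y| + 1) by rewrite divr_gt0.
have := (@cvgrPdist_le _ (H R) _ F FF u x).1 ux _ e1.
apply: filterS => t ht; rewrite -dotBl (le_trans (CS_dot _ _))//.
rewrite (le_trans (ler_pM _ _ ht (_ : `|y| <= `|y| + 1)))// ?lerDl//.
by rewrite divfK// gt_eqF.
Qed.

Lemma dot_continuous y : continuous (fun x : H R => dot x y).
Proof. by move=> x; apply: (@dot_cvgl _ (nbhs x) _ id); exact: cvg_id. Qed.

End dot_theory.

(** * Completeness of H *)

Section H_completeness.
Context (R : realType).
Local Notation mu := (@circle_measure R).

Lemma L2_Lfun (f : R -> R) : measurable_fun setT f ->
  (\int[mu]_t (f t ^+ 2)%:E < +oo)%E -> f \in Lfun mu 2%:E.
Proof.
move=> mf foo; apply/andP; split; rewrite inE//= /finite_norm unlock poweR_lty//.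
rewrite (_ : (fun _ => _) = (fun t => (f t ^+ 2)%:E))//; apply/funext => t.
by rewrite /= powR_mulrn// real_normK ?num_real.
Qed.

Definition L2_class (f : R -> R) (mf : measurable_fun setT f)
  (foo : (\int[mu]_t (f t ^+ 2)%:E < +oo)%E) : H R :=
  Lclass (Lfun_Sub (lee1n 2) (L2_Lfun mf foo)).

Lemma L2_classE (f : R -> R) (mf : measurable_fun setT f)
  (foo : (\int[mu]_t (f t ^+ 2)%:E < +oo)%E) :
  (L2_class mf foo : R -> R) = f %[ae mu].
Proof. exact: LclassE. Qed.

(** Hoelder's inequality against the constant 1 on a set of measure 2 pi: summable L^2 increments
    become summable L^1 increments. *)
Lemma norm_L1_le (f : R -> R) : measurable_fun setT f ->
  (\int[mu]_t (`|f t|)%:E <=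
     'N[mu]_2%:E[EFin \o f] * ((pi *+ 2) `^ 2^-1)%:E)%E.
Proof.
move=> mf; have := @hoelder _ _ _ mu f (cst 1) 2 2 mf (measurable_cst _).
rewrite Lnorm_cst1 circle_measure_setT poweR_EFin => h.
apply: le_trans (h _ _ _) => //; last by rewrite [RHS]splitr !div1r.
rewrite Lnorm1 le_eqVlt; apply/orP; left; apply/eqP.
by apply: eq_integral => t _ /=; rewrite mulr1.
Qed.

Lemma H_NE (x : H R) : ('N[mu]_2%:E[EFin \o (x : R -> R)] = `|x|%:E)%E.
Proof.
rewrite Lspace_normE fineK// ge0_fin_numE ?Lnorm_ge0//.
by case/andP: (Lspace_Lfun x) => _ /[1!inE].
Qed.

(** The sum of the |v_{k+1} - v_k| has a finite integral, hence is finite almost everywhere, and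
    there the telescoping series converges absolutely. *)
Lemma ae_cvg_fast_Cauchy (v : nat -> H R) :
  (forall k, `|v k.+1 - v k| <= 2 ^- k) ->
  {ae mu, forall t, cvgn (fun k => (v k : R -> R) t)}.
Proof.
move=> v_fast; have mH := @measurable_H R.
pose g k t := `|(v k.+1 : R -> R) t - (v k : R -> R) t|.
have mgB k : measurable_fun setT (fun t : R => (v k.+1 : R -> R) t - (v k : R -> R) t) by apply: measurable_funB.
have mg k : measurable_fun setT (g k).
  by apply: measurableT_comp => //; apply: measurable_funB.
pose C : R := (pi *+ 2) `^ 2^-1.
have gk k : (\int[mu]_t (g k t)%:E <= (C / 2 ^+ k)%:E)%E.
  apply: le_trans (norm_L1_le _) _; first by apply: measurable_funB.
  rewrite (_ : 'N[mu]_2%:E[_] = `|v k.+1 - v k|%:E)%E; last first.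
    rewrite -H_NE; apply: (Lnorm_ae_eq (lee1n 2)).
      exact: mgB.
      exact: mH.
    exact/ae_eq_sym/H_sub_ae.
  by rewrite -EFinM lee_fin mulrC ler_wpM2l// powR_ge0.
pose h t := (\sum_(k <oo) (g k t)%:E)%E.
have h0 t : (0 <= h t)%E by apply: nneseries_ge0 => k _ _; rewrite lee_fin normr_ge0.
have mh : measurable_fun setT h.
  by apply: ge0_emeasurable_sum => [k t _ _|k _]; [rewrite lee_fin normr_ge0|exact/measurable_EFinP].
have hfin : mu.-integrable setT h.
  apply/integrableP; split => //.
  under eq_integral do rewrite gee0_abs//.
  rewrite integral_nneseries//; last 2 first.
    - by move=> k; apply/measurable_EFinP; exact: mg.
    - by move=> k t _; rewrite lee_fin normr_ge0.
  apply: (@le_lt_trans _ _ (\sum_(k <oo) (C / 2 ^+ k)%:E)%E).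
    by apply: lee_nneseries => // k _; rewrite integral_ge0// => t _; rewrite lee_fin normr_ge0.
  (* This geometric series starts at r / 2, so r = 2 C yields the terms C / 2^k. *)
  have := @cvg_geometric_eseries_half R (C *+ 2) 0.
  rewrite (_ : eseries _ = (fun n => \sum_(0 <= k < n) (C / 2 ^+ k)%:E)%E).
    by move/cvg_lim => ->//; rewrite ltry.
  apply/funext => n; apply: eq_bigr => k _; congr (_%:E).
  by rewrite natrX addn1 exprS; field; rewrite expf_neq0.
have := integrable_ae measurableT hfin; apply: ae_mp => t /(_ I) ht.
have bnd n : series (g ^~ t) n <= fine (h t).
  rewrite -lee_fin fineK// /series/= -sumEFin.
  by apply: nneseries_lim_ge => k _ _; rewrite lee_fin normr_ge0.
have : cvgn (series (telescope (fun k => (v k : R -> R) t))).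
  apply: normed_cvg; apply: nondecreasing_is_cvgn.
    by apply: nondecreasing_series => k _ _; rewrite normr_ge0.
  by exists (fine (h t)) => _ [n _ <-]; exact: bnd.
rewrite telescopeK => ct.
rewrite (_ : (fun k => _) = (fun k => ((v k : R -> R) t - (v 0%N : R -> R) t) + (v 0%N : R -> R) t)).
  by apply: is_cvgD => //; exact: is_cvg_cst.
by apply/funext => k; rewrite subrK.
Qed.

Lemma fast_Cauchy_cvg (v : nat -> H R) :
  (forall j k, (j <= k)%N -> `|v k - v j| <= 2 ^- j) -> exists l : H R, forall j, `|v j - l| <= 2 ^- j.
Proof.
move=> vC; have mH := @measurable_H R.
have [N [mN N0 hN]] : {ae mu, forall t, cvgn (fun k => (v k : R -> R) t)}.
  apply: ae_cvg_fast_Cauchy => k; exact: vC.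
(* Killing the exceptional set makes the sequence converge everywhere, so that its limit is
   measurable. *)
pose w k t := (v k : R -> R) t * \1_(~` N) t.
pose f t := limn (fun k => w k t).
have wf t : w ^~ t @ \oo --> f t.
  rewrite /f /w /indic; have [tN|tN] := pselect (N t).
    have -> : (t \in ~` N) = false by apply/negbTE; rewrite notin_setE => /(_ tN).
    under eq_fun do rewrite mulr0; exact: is_cvg_cst.
  rewrite mem_set//=; under eq_fun do rewrite mulr1.
  by apply: contrapT => ht; apply: tN; apply: hN.
have mw k : measurable_fun setT (w k).
  by apply: measurable_funM => //; apply: measurable_indic; exact: measurableC.
have mf : measurable_fun setT f by apply: (measurable_fun_cvg mw) => t _; exact: wf.
have wv k : (v k : R -> R) = w k %[ae mu].
  exists N; split => //; apply: subset_trans (_ : [set t | (v k : R -> R) t <> w k t] `<=` N).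
    by move=> t /= ht h; apply: ht => _.
  move=> t /= ht; apply: contrapT => tN; apply: ht.
  by rewrite /w /indic mem_set ?mulr1.
have mwB k j : measurable_fun setT (fun t => w k t - w j t) by exact: measurable_funB.
have mwB2 k j : measurable_fun setT (fun t => (w k t - w j t) ^+ 2) by exact: measurable_funX.
have vwB k j : ((v k - v j : H R) : R -> R) = (fun t => w k t - w j t) %[ae mu].
  exact: H_sub_aeW.
have wL2 j k : (\int[mu]_t ((w k t - w j t) ^+ 2)%:E = (`|v k - v j| ^+ 2)%:E)%E.
  transitivity (\int[mu]_t ((v k - v j : H R) t * (v k - v j : H R) t)%:E)%E.
    apply: ge0_ae_eq_integral => //.
    + by apply/measurable_EFinP; exact: mwB2.
    + by apply/measurable_EFinP; apply: measurable_funM; exact: mH.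
    + by move=> t _; rewrite lee_fin sqr_ge0.
    + by move=> t _; rewrite lee_fin -expr2 sqr_ge0.
    + by apply: ae_mp (vwB k j) => t h _; rewrite h// -expr2.
  by rewrite -dotxx /dot /Rintegral fineK//; apply: integrable_fin_num => //; exact: dot_integrable.
(* Fatou in k at fixed j gives both the square integrability of [f - w j] and the rate of
   convergence. *)
have fatou_le j : (\int[mu]_t ((f t - w j t) ^+ 2)%:E <= ((2 ^- j) ^+ 2)%:E)%E.
  apply: (@integral_lim_le _ _ _ mu setT (fun k t => ((w k t - w j t) ^+ 2)%:E)
    (fun t => ((f t - w j t) ^+ 2)%:E) _ j) => //.
  - by move=> k; apply/measurable_EFinP; exact: mwB2.
  - by move=> k t _; rewrite lee_fin sqr_ge0.
  - move=> t _; apply: cvg_EFin; first by apply: nearW.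
    apply: (@continuous_cvg _ _ _ _ _ _ (fun u : R => (u - w j t) ^+ 2)); last exact: wf.
    apply: (@continuous_comp _ _ _ (fun u : R => u - w j t) (fun u => u ^+ 2)); last exact: exprn_continuous.
    by apply: cvgB; [exact: cvg_id|exact: cvg_cst].
  - move=> k jk; rewrite wL2 lee_fin ler_sqr ?nnegrE ?vC//.
have mf0 : measurable_fun setT (fun t => f t - w 0%N t) by exact: measurable_funB.
have f0fin : (\int[mu]_t ((f t - w 0%N t) ^+ 2)%:E < +oo)%E.
  by apply: le_lt_trans (fatou_le 0%N) _; exact: ltry.
(* What is known to be square integrable is [f - w 0], not [f]; the limit is its class plus
   [v 0]. *)
exists (L2_class mf0 f0fin + v 0%N) => j.
have lv : ((L2_class mf0 f0fin + v 0%N - v j : H R) : R -> R) = (fun t => f t - w j t) %[ae mu].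
  have := H_sub_aeW (H_add_aeW (L2_classE mf0 f0fin) (wv 0%N)) (wv j).
  by apply: ae_mp => t h _; rewrite h// subrK.
have mfj : measurable_fun setT (fun t => f t - w j t) by exact: measurable_funB.
rewrite distrC -ler_sqr ?nnegrE// -dotxx (dot_ae mfj mfj lv lv).
have := fatou_le j; under eq_integral do rewrite expr2.
move=> h; rewrite -lee_fin /Rintegral fineK// ge0_fin_numE; last first.
  by apply: integral_ge0 => t _; rewrite lee_fin -expr2 sqr_ge0.
by apply: le_lt_trans h _; exact: ltry.
Qed.

Lemma H_complete (u : nat -> H R) :
  (forall e : R, 0 < e -> exists N, forall m n, (N <= m)%N -> (N <= n)%N -> `|u m - u n| <= e) ->
  exists l : H R, u @ \oo --> l.
Proof.
move=> uC; have e2 j : 0 < (2 ^- j : R) by rewrite invr_gt0 exprn_gt0.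
have /choice[N hN] : forall j, exists N, forall m n, (N <= m)%N -> (N <= n)%N -> `|u m - u n| <= 2 ^- j.
  by move=> j; exact: uC.
(* The maximum makes [n k] exceed every [N j] with j <= k, so that the subsequence is Cauchy at rate
   2^-j. *)
pose n j := (\max_(i < j.+1) N i)%N.
have nN j k : (j <= k)%N -> (N j <= n k)%N.
  move=> jk; have jk1 : (j < k.+1)%N by [].
  by rewrite /n (bigD1 (Ordinal jk1))//= leq_maxl.
have [|l hl] := @fast_Cauchy_cvg (fun j => u (n j)).
  by move=> j k jk; apply: hN; apply: nN.
exists l; apply/cvgrPdist_le => e e0.
have [j _ hj] := near_infty_natSinv_expn_lt (PosNum (divr_gt0 e0 (ltr0n _ 2))).
exists (N j) => // m /= hm; rewrite -(subrK (u (n j)) l) -addrA.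
apply: le_trans (ler_normD _ _) _; rewrite (splitr e) lerD//.
  rewrite distrC; apply: le_trans (hl j) _.
  by have := hj j (leqnn _); rewrite /= => /ltW; rewrite div1r.
apply: le_trans (hN j _ _ _ hm) _; first exact: nN.
by have := hj j (leqnn _); rewrite /= => /ltW; rewrite div1r.
Qed.

End H_completeness.

(** * Trigonometric functions *)

Section trig_integrals.
Context (R : realType).
Local Notation mu := (@circle_measure R).
Implicit Types (m k : int) (x : R).

Lemma sin_int2pi m : sin (m%:~R * (pi *+ 2)) = 0 :> R.
Proof.
have h n : sin (n%:R * (pi *+ 2)) = 0 :> R.
  by rewrite mulr_natl -[X in sin X]add0r (periodicn (@sinD2pi R)) sin0.
case: m => n; first exact: h.
by rewrite NegzE mulrNz mulNr sinN h oppr0.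
Qed.

Lemma cos_int2pi m : cos (m%:~R * (pi *+ 2)) = 1 :> R.
Proof.
have h n : cos (n%:R * (pi *+ 2)) = 1 :> R.
  by rewrite mulr_natl -[X in cos X]add0r (periodicn (@cosD2pi R)) cos0.
case: m => n; first exact: h.
by rewrite NegzE mulrNz mulNr cosN h.
Qed.

Lemma is_derive_sinM (a x : R) : is_derive x 1 (fun t : R => sin (a * t)) (a * cos (a * x)).
Proof.
have h : is_derive x (1 : R) (fun t : R => a * t) a.
  by have := is_deriveZ a (is_derive_id x (1 : R)); rewrite [_ *: _]mulr1.
by apply: (is_derive_eq (is_derive1_comp (is_derive_sin (a * x)) h)); rewrite mulrC.
Qed.

Lemma is_derive_cosM (a x : R) : is_derive x 1 (fun t : R => cos (a * t)) (- (a * sin (a * x))).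
Proof.
have h : is_derive x (1 : R) (fun t : R => a * t) a.
  by have := is_deriveZ a (is_derive_id x (1 : R)); rewrite [_ *: _]mulr1.
by apply: (is_derive_eq (is_derive1_comp (is_derive_cos (a * x)) h)); rewrite mulrC mulrN.
Qed.

Lemma continuous_sinM (a : R) : continuous (fun t : R => sin (a * t)).
Proof.
move=> x; apply: (@continuous_comp _ _ _ (fun t => a * t)); last exact: continuous_sin.
by apply: cvgMr; exact: cvg_id.
Qed.

Lemma continuous_cosM (a : R) : continuous (fun t : R => cos (a * t)).
Proof.
move=> x; apply: (@continuous_comp _ _ _ (fun t => a * t)); last exact: continuous_cos.
by apply: cvgMr; exact: cvg_id.
Qed.

Lemma circle_eq (f g : R -> R) : (forall t, f t = g t) -> \int[mu]_t f t = \int[mu]_t g t.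
Proof. by move=> fg; apply: eq_Rintegral => t _; exact: fg. Qed.

Lemma circle_int_cos m : \int[mu]_t cos (m%:~R * t) = (m == 0)%:R * (pi *+ 2) :> R.
Proof.
have [->|m0] := eqVneq m 0.
  rewrite (@circle_eq _ (cst 1)); last by move=> t; rewrite mul0r cos0.
  by rewrite Rintegral_cst// mul1r circle_measure_setT mul1r.
have mr : m%:~R != 0 :> R by rewrite intr_eq0.
have dF x : is_derive x 1 (fun t : R => m%:~R^-1 * sin (m%:~R * t)) (cos (m%:~R * x)).
  apply: (is_derive_eq (is_deriveZ (m%:~R^-1) (is_derive_sinM m%:~R x))).
  by rewrite [LHS]mulrA mulVf// mul1r.
rewrite (circle_FTC dF (@continuous_cosM _)).
by rewrite sin_int2pi !mulr0 sin0 mulr0 subrr mul0r.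
Qed.

Lemma circle_int_sin m : \int[mu]_t sin (m%:~R * t) = 0 :> R.
Proof.
have [->|m0] := eqVneq m 0.
  rewrite (@circle_eq _ (cst 0)); last by move=> t; rewrite mul0r sin0.
  by rewrite Rintegral_cst// mul0r.
have mr : m%:~R != 0 :> R by rewrite intr_eq0.
have dF x : is_derive x 1 (fun t : R => (- m%:~R^-1) * cos (m%:~R * t)) (sin (m%:~R * x)).
  apply: (is_derive_eq (is_deriveZ (- m%:~R^-1) (is_derive_cosM m%:~R x))).
  by rewrite [LHS]mulrNN mulrA mulVf// mul1r.
rewrite (circle_FTC dF (@continuous_sinM _)).
by rewrite cos_int2pi mulr0 cos0 subrr.
Qed.

Lemma bounded_circle_integrable (f : R -> R) (M : R) : measurable_fun setT f ->
  (forall t, `|f t| <= M) -> mu.-integrable setT (EFin \o f).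
Proof.
move=> mf fM; apply: (@measurable_bounded_integrable _ _ _ mu) => //.
  by rewrite circle_measure_setT ltry.
exists M; split; first exact: num_real.
by move=> N MN t _; apply: le_trans (fM t) (ltW MN).
Qed.

Lemma cosM_integrable (a : R) : mu.-integrable setT (EFin \o (fun t => cos (a * t))).
Proof.
apply: (@bounded_circle_integrable _ 1); first by apply: continuous_measurable_fun; exact: continuous_cosM.
by move=> t; rewrite ler_norml cos_geN1 cos_le1.
Qed.

Lemma sinM_integrable (a : R) : mu.-integrable setT (EFin \o (fun t => sin (a * t))).
Proof.
apply: (@bounded_circle_integrable _ 1); first by apply: continuous_measurable_fun; exact: continuous_sinM.
by move=> t; rewrite ler_norml sin_geN1 sin_le1.
Qed.

Lemma circle_int_coscos m k :
  \int[mu]_t (cos (m%:~R * t) * cos (k%:~R * t)) =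
  ((m == k)%:R + (m == - k)%:R) * pi :> R.
Proof.
rewrite (@circle_eq _ (fun t => 2^-1 * cos ((m - k)%:~R * t) + 2^-1 * cos ((m + k)%:~R * t))).
  have hi a : mu.-integrable setT (EFin \o (fun t => 2^-1 * cos (a * t))).
    by have := integrableZl measurableT 2^-1 (cosM_integrable a); apply: eq_integrable.
  rewrite RintegralD// !RintegralZl//; [|exact: cosM_integrable..].
  by rewrite !circle_int_cos subr_eq0 addr_eq0; field.
by move=> t; rewrite rmorphB rmorphD/= mulrBl mulrDl cosB cosD; field.
Qed.

Lemma circle_int_sinsin m k :
  \int[mu]_t (sin (m%:~R * t) * sin (k%:~R * t)) =
  ((m == k)%:R - (m == - k)%:R) * pi :> R.
Proof.
rewrite (@circle_eq _ (fun t => 2^-1 * cos ((m - k)%:~R * t) - 2^-1 * cos ((m + k)%:~R * t))).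
  have hi a : mu.-integrable setT (EFin \o (fun t => 2^-1 * cos (a * t))).
    by have := integrableZl measurableT 2^-1 (cosM_integrable a); apply: eq_integrable.
  rewrite RintegralB// !RintegralZl//; [|exact: cosM_integrable..].
  by rewrite !circle_int_cos subr_eq0 addr_eq0; field.
by move=> t; rewrite rmorphB rmorphD/= mulrBl mulrDl cosB cosD; field.
Qed.

Lemma circle_int_sincos m k :
  \int[mu]_t (sin (m%:~R * t) * cos (k%:~R * t)) = 0 :> R.
Proof.
rewrite (@circle_eq _ (fun t => 2^-1 * sin ((m - k)%:~R * t) + 2^-1 * sin ((m + k)%:~R * t))).
  have hi a : mu.-integrable setT (EFin \o (fun t => 2^-1 * sin (a * t))).
    by have := integrableZl measurableT 2^-1 (sinM_integrable a); apply: eq_integrable.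
  rewrite RintegralD// !RintegralZl//; [|exact: sinM_integrable..].
  by rewrite !circle_int_sin mulr0 addr0.
by move=> t; rewrite rmorphB rmorphD/= mulrBl mulrDl sinB sinD; field.
Qed.

End trig_integrals.

Section orthonormality.
Context (R : realType).
Local Notation mu := (@circle_measure R).
Implicit Types (i j k : int).

Definition trig_coef k : R := if k == 0 then (Num.sqrt (pi *+ 2))^-1 else (Num.sqrt pi)^-1.

(** As cos 0 = 1, the constant counts as a cosine, and two cases remain instead of three. *)
Lemma trigE k (t : R) : trig k t = trig_coef k * (if 0 <= k then cos (k%:~R * t) else sin (k%:~R * t)).
Proof.
rewrite /trig /trig_coef; have [->|k0] := eqVneq k 0; first by rewrite lexx mul0r cos0 mulr1.
by rewrite le_eqVlt eq_sym (negbTE k0).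
Qed.

Lemma trig_coef_sqr k : trig_coef k ^+ 2 = (if k == 0 then pi *+ 2 else pi)^-1.
Proof.
rewrite /trig_coef; case: ifP => _; rewrite exprVn sqr_sqrtr ?pi_ge0//.
by rewrite mulrn_wge0// pi_ge0.
Qed.

Lemma continuous_trig k : continuous (@trig R k).
Proof.
rewrite (_ : @trig R k = fun t => trig_coef k * (if 0 <= k then cos (k%:~R * t) else sin (k%:~R * t))); last first.
  by apply/funext => t; rewrite trigE.
move=> t; apply: cvgMr; case: ifP => _; [exact: continuous_cosM|exact: continuous_sinM].
Qed.

Lemma measurable_trig k : measurable_fun setT (@trig R k).
Proof. by apply: continuous_measurable_fun; exact: continuous_trig. Qed.

Lemma e_ae k : (@e_ R k : R -> R) = trig k %[ae mu].
Proof. exact: LclassE. Qed.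

Lemma dot_eE k (x : H R) : dot x (e_ R k) = \int[mu]_t (x t * trig k t).
Proof.
apply: dot_ae; [exact: measurable_H|exact: measurable_trig|exact: aeW|exact: e_ae].
Qed.

Lemma trig_trig_sym i j : \int[mu]_t (@trig R i t * trig j t) = (i == j)%:R.
Proof.
have E (f g : R -> R) : mu.-integrable setT (EFin \o (fun t => f t * g t)) ->
    \int[mu]_t (trig_coef i * f t * (trig_coef j * g t)) = trig_coef i * trig_coef j * \int[mu]_t (f t * g t).
  by move=> h; rewrite -RintegralZl//; apply: circle_eq => t; rewrite mulrACA.
have mc k : measurable_fun setT (fun t : R => cos (k%:~R * t)).
  by apply: continuous_measurable_fun; exact: continuous_cosM.
have ms k : measurable_fun setT (fun t : R => sin (k%:~R * t)).
  by apply: continuous_measurable_fun; exact: continuous_sinM.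
have bnd (a b : R) : `|a| <= 1 -> `|b| <= 1 -> `|a * b| <= 1.
  by move=> a1 b1; rewrite normrM mulr_ile1.
have bc k (t : R) : `|cos (k%:~R * t)| <= 1 by rewrite ler_norml cos_geN1 cos_le1.
have bs k (t : R) : `|sin (k%:~R * t)| <= 1 by rewrite ler_norml sin_geN1 sin_le1.
have pi0 : pi != 0 :> R by rewrite gt_eqF// pi_gt0.
rewrite (@circle_eq _ _ (fun t => trig_coef i * (if 0 <= i then cos (i%:~R * t) else sin (i%:~R * t)) * (trig_coef j * (if 0 <= j then cos (j%:~R * t) else sin (j%:~R * t))))); last first.
  by move=> t; rewrite !trigE.
have [i0|i0] := leP 0 i; have [j0|j0] := leP 0 j.
- rewrite E; last by apply: (@bounded_circle_integrable _ _ 1) => [|t]; [exact: measurable_funM|exact: bnd].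
  rewrite circle_int_coscos; have [<-|ij] := eqVneq i j.
    (* At i = 0 both Kronecker symbols of [circle_int_coscos] equal 1, and their 2 pi matches the
       special normalization of the constant. *)
    rewrite -expr2 trig_coef_sqr; have [->|i1] := eqVneq i 0.
      by rewrite oppr0 eqxx -mulr2n mulrnAl mul1r mulVf// mulrn_eq0 negb_or pi0.
    by rewrite (_ : (i == - i) = false) ?addr0 ?mul1r ?mulVf//; lia.
  by rewrite (_ : (i == - j) = false) ?addr0 ?mul0r ?mulr0//; lia.
- rewrite (@circle_eq _ _ (fun t => trig_coef j * sin (j%:~R * t) * (trig_coef i * cos (i%:~R * t)))); last first.
    by move=> t; rewrite mulrC.
  rewrite (_ : (i == j) = false); last by lia.
  have := @circle_int_sincos R j i; move=> h.
  rewrite (@circle_eq _ _ (fun t => trig_coef j * trig_coef i * (sin (j%:~R * t) * cos (i%:~R * t)))); last first.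
    by move=> t; rewrite mulrACA.
  rewrite RintegralZl ?h ?mulr0//.
  by apply: (@bounded_circle_integrable _ _ 1) => [|t]; [exact: measurable_funM|exact: bnd].
- rewrite (_ : (i == j) = false); last by lia.
  rewrite E ?circle_int_sincos ?mulr0//.
  by apply: (@bounded_circle_integrable _ _ 1) => [|t]; [exact: measurable_funM|exact: bnd].
- rewrite E; last by apply: (@bounded_circle_integrable _ _ 1) => [|t]; [exact: measurable_funM|exact: bnd].
  rewrite circle_int_sinsin (_ : (i == - j) = false) ?subr0; last by lia.
  have [<-|ij] := eqVneq i j; last by rewrite mul0r mulr0.
  rewrite -expr2 trig_coef_sqr (_ : (i == 0) = false); last by lia.
  by rewrite mul1r mulVf.
Qed.

Lemma dot_e_e i j : dot (e_ R i) (e_ R j) = (i == j)%:R.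
Proof.
rewrite -trig_trig_sym; apply: dot_ae; [exact: measurable_trig|exact: measurable_trig|exact: e_ae|exact: e_ae].
Qed.

Lemma norm_e k : `|@e_ R k| = 1.
Proof.
apply/eqP; rewrite -(@eqrXn2 _ 2)// ?expr1n; first by rewrite -dotxx dot_e_e eqxx.
Qed.

End orthonormality.

Section trigonometric_polynomials.
Context (R : realType).
Local Notation mu := (@circle_measure R).

(** A predicate rather than a type with degrees and coefficients: continuity, boundedness and
    orthogonality follow by induction. Frequencies of both signs are allowed for each function, so
    that multiplying by cos or sin merely shifts k by 1. *)
Inductive trigpoly : (R -> R) -> Prop :=
| trigpoly_cos (k : int) : trigpoly (fun t => cos (k%:~R * t))
| trigpoly_sin (k : int) : trigpoly (fun t => sin (k%:~R * t))
| trigpoly_comb (a : R) f g : trigpoly f -> trigpoly g -> trigpoly (fun t => a * f t + g t).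

Lemma trigpoly_ext f g : trigpoly f -> (forall t, f t = g t) -> trigpoly g.
Proof. by move=> tf fg; have <- : f = g by apply/funext. Qed.

Lemma trigpoly0 : trigpoly (fun=> 0).
Proof. by apply: trigpoly_ext (trigpoly_sin 0) _ => t; rewrite mul0r sin0. Qed.

Lemma trigpoly1 : trigpoly (fun=> 1).
Proof. by apply: trigpoly_ext (trigpoly_cos 0) _ => t; rewrite mul0r cos0. Qed.

Lemma trigpolyZ a f : trigpoly f -> trigpoly (fun t => a * f t).
Proof. by move=> tf; apply: trigpoly_ext (trigpoly_comb a tf trigpoly0) _ => t; rewrite addr0. Qed.

Lemma trigpolyD f g : trigpoly f -> trigpoly g -> trigpoly (fun t => f t + g t).
Proof. by move=> tf tg; apply: trigpoly_ext (trigpoly_comb 1 tf tg) _ => t; rewrite mul1r. Qed.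

Lemma trigpolyB f g : trigpoly f -> trigpoly g -> trigpoly (fun t => f t - g t).
Proof.
by move=> tf tg; apply: trigpoly_ext (trigpoly_comb (-1) tg tf) _ => t; rewrite mulN1r addrC.
Qed.

Lemma trigpolyM_cos f : trigpoly f -> trigpoly (fun t => f t * cos t).
Proof.
elim=> [k|k|a g h _ tg _ th].
- apply: trigpoly_ext (trigpolyD (trigpolyZ 2^-1 (trigpoly_cos (k + 1))) (trigpolyZ 2^-1 (trigpoly_cos (k - 1)))) _ => t.
  by rewrite rmorphB rmorphD/= mulrBl mulrDl mul1r cosB cosD; field.
- apply: trigpoly_ext (trigpolyD (trigpolyZ 2^-1 (trigpoly_sin (k + 1))) (trigpolyZ 2^-1 (trigpoly_sin (k - 1)))) _ => t.
  by rewrite rmorphB rmorphD/= mulrBl mulrDl mul1r sinB sinD; field.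
- by apply: trigpoly_ext (trigpoly_comb a tg th) _ => t; rewrite mulrDl mulrA.
Qed.

Lemma trigpolyM_sin f : trigpoly f -> trigpoly (fun t => f t * sin t).
Proof.
elim=> [k|k|a g h _ tg _ th].
- apply: trigpoly_ext (trigpolyB (trigpolyZ 2^-1 (trigpoly_sin (k + 1))) (trigpolyZ 2^-1 (trigpoly_sin (k - 1)))) _ => t.
  by rewrite rmorphB rmorphD/= mulrBl mulrDl mul1r sinB sinD; field.
- apply: trigpoly_ext (trigpolyB (trigpolyZ 2^-1 (trigpoly_cos (k - 1))) (trigpolyZ 2^-1 (trigpoly_cos (k + 1)))) _ => t.
  by rewrite rmorphB rmorphD/= mulrBl mulrDl mul1r cosB cosD; field.
- by apply: trigpoly_ext (trigpoly_comb a tg th) _ => t; rewrite mulrDl mulrA.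
Qed.

Lemma continuous_trigpoly f : trigpoly f -> continuous f.
Proof.
elim=> [k|k|a g h _ cg _ ch]; [exact: continuous_cosM|exact: continuous_sinM|].
by move=> t; apply: cvgD; [apply: cvgMr; exact: cg|exact: ch].
Qed.

Lemma bounded_trigpoly f : trigpoly f -> exists M, forall t, `|f t| <= M.
Proof.
elim=> [k|k|a g h _ [M gM] _ [N hN]].
- by exists 1 => t; rewrite ler_norml cos_geN1 cos_le1.
- by exists 1 => t; rewrite ler_norml sin_geN1 sin_le1.
- exists (`|a| * M + N) => t; apply: le_trans (ler_normD _ _) _.
  by rewrite lerD// normrM ler_wpM2l.
Qed.

Lemma integrable_Mbounded (x : H R) (f : R -> R) (M : R) : measurable_fun setT f ->
  (forall t, `|f t| <= M) -> mu.-integrable setT (EFin \o (fun t => x t * f t)).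
Proof.
move=> mf fM; have M0 : 0 <= M by apply: le_trans (fM 0).
have xi : mu.-integrable setT (EFin \o (x : R -> R)).
  by apply/Lfun1_integrable; apply: Lfun_subset12; [rewrite circle_measure_setT|exact: H_Lfun].
apply: (@le_integrable _ _ _ mu setT measurableT _ (fun t => (M * x t)%:E)) => //.
- apply/measurable_EFinP; apply: measurable_funM => //; exact: measurable_H.
- move=> t _; rewrite lee_fin/= !normrM mulrC ler_wpM2r//.
  by rewrite (le_trans (fM t))// ler_norm.
- by have := integrableZl measurableT M xi; apply: eq_integrable.
Qed.

Lemma trigpoly_orth (x : H R) : (forall k, dot x (e_ R k) = 0) ->
  forall f, trigpoly f -> \int[mu]_t (x t * f t) = 0.
Proof.
move=> x0; have pi0 : 0 < pi :> R := pi_gt0 R.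
have tc0 k : trig_coef R k != 0.
  rewrite -sqrf_eq0 trig_coef_sqr invr_eq0; case: ifP => _; apply: lt0r_neq0 => //.
  by rewrite mulrn_wgt0.
have hM k f : dot x (e_ R k) = trig_coef R k * \int[mu]_t (x t * f t) -> \int[mu]_t (x t * f t) = 0.
  by rewrite x0 => /esym/eqP; rewrite mulf_eq0 (negbTE (tc0 k))/= => /eqP.
have ii f : trigpoly f -> mu.-integrable setT (EFin \o (fun t => x t * f t)).
  move=> tf; have [M fM] := bounded_trigpoly tf.
  by apply: integrable_Mbounded fM; apply: continuous_measurable_fun; exact: continuous_trigpoly.
have hcos (k : int) : 0 <= k -> \int[mu]_t (x t * cos (k%:~R * t)) = 0.
  move=> k0; apply: (@hM k); rewrite dot_eE -RintegralZl//; last exact: (ii _ (trigpoly_cos k)).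
  by apply: circle_eq => t; rewrite trigE k0 mulrCA.
have hsin (k : int) : k < 0 -> \int[mu]_t (x t * sin (k%:~R * t)) = 0.
  move=> k0; apply: (@hM k); rewrite dot_eE -RintegralZl//; last exact: (ii _ (trigpoly_sin k)).
  by apply: circle_eq => t; rewrite trigE leNgt k0/= mulrCA.
move=> f; elim=> [k|k|a g h tg g0 th h0].
(* The [e_ k] provide cosines for k >= 0 and sines for k < 0 only; parity handles the other
   signs. *)
- have [k0|k0] := leP 0 k; first exact: hcos.
  rewrite -(hcos (- k)); last by lia.
  by apply: circle_eq => t; rewrite rmorphN/= mulNr cosN.
- have [k0|k0] := ltP k 0; first exact: hsin.
  move: k0; rewrite le_eqVlt => /predU1P[<-|k0].
    by rewrite (@circle_eq _ _ (fun=> 0)) ?Rintegral_cst ?mul0r// => t; rewrite mul0r sin0 mulr0.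
  have k0' : - k < 0 by lia.
  rewrite (@circle_eq _ _ (fun t => -1 * (x t * sin ((- k)%:~R * t)))); last first.
    move=> t; have -> : (- k)%:~R * t = - (k%:~R * t) :> R by rewrite rmorphN mulNr.
    by rewrite sinN; ring.
  by rewrite RintegralZl ?hsin ?mulr0//; exact: (ii _ (trigpoly_sin (- k))).
- rewrite (@circle_eq _ _ (fun t => a * (x t * g t) + x t * h t)); last by move=> t; rewrite mulrDr mulrCA.
  rewrite RintegralD//; [|by have := integrableZl measurableT a (ii _ tg); apply: eq_integrable|exact: ii].
  by rewrite RintegralZl ?g0 ?h0 ?mulr0 ?addr0//; exact: ii.
Qed.

End trigonometric_polynomials.

(** * Totality of the trigonometric system *)

Section totality.
Context (R : realType).
Local Notation mu := (@circle_measure R).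

Lemma bernoulli_le (a : R) m : 0 <= a <= 1 -> 1 - m%:R * a <= (1 - a) ^+ m.
Proof.
move=> /andP[a0 a1]; elim: m => [|m IH]; first by rewrite mul0r subr0 expr0.
rewrite exprS; have a1' : 0 <= 1 - a by rewrite subr_ge0.
apply: le_trans (ler_wpM2l a1' IH); rewrite -natr1.
have : 0 <= m%:R * a ^+ 2 by rewrite mulr_ge0// sqr_ge0.
lra.
Qed.

Lemma bernoulli_ge (a : R) m : 0 <= a -> 1 + m%:R * a <= (1 + a) ^+ m.
Proof.
move=> a0; elim: m => [|m IH]; first by rewrite mul0r addr0 expr0.
rewrite exprS; have a1' : 0 <= 1 + a by rewrite addr_ge0.
apply: le_trans (ler_wpM2l a1' IH); rewrite -natr1.
have : 0 <= m%:R * a ^+ 2 by rewrite mulr_ge0// sqr_ge0.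
lra.
Qed.

(* [(1 - u^n)^(2^n)] tends to the indicator of [u < 1/2]. Applied to the trigonometric
   polynomial [u = bump b], which on ]0, 2pi[ is below 1/2 exactly at the [t > b], it shows
   that a function orthogonal to all the [e_k] has zero integral over every ]b, 2pi[. *)
Lemma step_approx_bound (u : R) n : 0 <= u <= 1 -> 0 <= (1 - u ^+ n) ^+ (2 ^ n) <= 1.
Proof.
move=> /andP[u0 u1]; have un0 : 0 <= u ^+ n by rewrite exprn_ge0.
have un1 : u ^+ n <= 1 by rewrite exprn_ile1.
by rewrite exprn_ge0 ?subr_ge0//= exprn_ile1 ?subr_ge0// lerBlDr lerDl.
Qed.

Lemma step_approx_cvg (u : R) : 0 <= u <= 1 -> u != 2^-1 ->
  (1 - u ^+ n) ^+ (2 ^ n) @[n --> \oo] --> ((u < 2^-1)%R%:R : R).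
Proof.
move=> /[dup] u01 /andP[u0 u1]; rewrite neq_lt => /orP[uh|uh].
  (* By Bernoulli, 1 - (2u)^n <= (1 - u^n)^(2^n) <= 1, and 2u < 1. *)
  rewrite uh; apply: (@squeeze_cvgr _ _ _ _ (fun n => 1 - (2 * u) ^+ n) (fun=> 1)).
  - apply: nearW => n; have /andP[_ ->] := step_approx_bound n u01; rewrite andbT.
    by rewrite exprMn -natrX bernoulli_le// exprn_ge0//= exprn_ile1.
  - rewrite -[X in _ --> X]subr0; apply: cvgB; first exact: cvg_cst.
    by apply: cvg_expr; rewrite ger0_norm ?mulr_ge0//; lra.
  - exact: cvg_cst.
rewrite ltNge (ltW uh)/=.
have u2 : 1 < 2 * u by lra.
apply: (@squeeze_cvgr _ _ _ _ (fun=> 0) (fun n => ((2 * u)^-1) ^+ n)).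
- apply: nearW => n; have /andP[-> _]/= := step_approx_bound n u01.
  have un0 : 0 <= u ^+ n by rewrite exprn_ge0.
  have un1 : u ^+ n <= 1 by rewrite exprn_ile1.
  have h1 : 1 + (2 ^ n)%:R * u ^+ n <= (1 + u ^+ n) ^+ (2 ^ n) by exact: bernoulli_ge.
  (* With a = u^n and m = 2^n, (1 - a)^m (1 + a)^m = (1 - a^2)^m <= 1; with Bernoulli for (1 + a)^m,
     this gives (1 - a)^m <= 1 / (m a) = (2u)^{-n}. *)
  have h2 : (1 - u ^+ n) ^+ (2 ^ n) * (1 + u ^+ n) ^+ (2 ^ n) <= 1.
    by rewrite -exprMn -subr_sqr expr1n exprn_ile1 ?subr_ge0 ?exprn_ile1 ?sqr_ge0// lerBlDr lerDl sqr_ge0.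
  rewrite exprVn -[leRHS]mul1r ler_pdivlMr ?exprn_gt0//; last by lra.
  apply: le_trans h2; rewrite ler_wpM2l//; first by have /andP[] := step_approx_bound n u01.
  by apply: le_trans h1; rewrite exprMn natrX lerDr.
- exact: cvg_cst.
- apply: cvg_expr; rewrite ger0_norm ?invr_ge0 ?mulr_ge0// invf_lt1//; lra.
Qed.

(** Within one period, cos (t - b/2) exceeds cos (b/2) exactly for t between 0 and b. Division by 4
    brings a difference of cosines into [-1/2, 1/2], hence the values into [0, 1]. *)
Definition bump (b t : R) := 2^-1 + (cos (t - b / 2) - cos (b / 2)) / 4.

(** The product form shows the position with respect to 1/2: on ]0, 2pi[ the factor sin (t/2) is
    positive, and sin ((t - b)/2) has the sign of t - b. *)
Lemma bumpE b t : bump b t = 2^-1 - sin (t / 2) * sin ((t - b) / 2) / 2.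
Proof.
rewrite /bump.
have -> : t - b / 2 = t / 2 + (t - b) / 2 by lra.
have -> : b / 2 = t / 2 - (t - b) / 2 by lra.
by rewrite cosD cosB; field.
Qed.

Lemma bump01 b t : 0 <= bump b t <= 1.
Proof.
rewrite /bump; have := cos_le1 (t - b / 2); have := cos_geN1 (t - b / 2).
have := cos_le1 (b / 2); have := cos_geN1 (b / 2); move=> h1 h2 h3 h4.
by apply/andP; split; lra.
Qed.

Lemma bump_lt b t : 0 < b < pi *+ 2 -> 0 < t < pi *+ 2 -> t != b ->
  bump b t != 2^-1 /\ (bump b t < 2^-1) = (b < t).
Proof.
move=> /andP[b0 b1] /andP[t0 t1]; rewrite bumpE => tb.
have s0 : 0 < sin (t / 2) by apply: sin_gt0_pi; apply/andP; split; lra.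
move: tb; rewrite neq_lt => /orP[tb|tb].
  have s1 : 0 < sin ((b - t) / 2) by apply: sin_gt0_pi; apply/andP; split; lra.
  have e : sin ((t - b) / 2) = - sin ((b - t) / 2) by rewrite -sinN; congr sin; lra.
  have := mulr_gt0 s0 s1; rewrite e => h.
  have h2 : 2^-1 < 2^-1 - sin (t / 2) * - sin ((b - t) / 2) / 2 by lra.
  by rewrite gt_eqF// !ltNge (ltW h2) (ltW tb).
have s1 : 0 < sin ((t - b) / 2) by apply: sin_gt0_pi; apply/andP; split; lra.
have h := mulr_gt0 s0 s1.
have h2 : 2^-1 - sin (t / 2) * sin ((t - b) / 2) / 2 < 2^-1 by lra.
by rewrite lt_eqF// h2 tb.
Qed.

Lemma trigpolyM_bump b f : trigpoly f -> trigpoly (fun t => f t * bump b t).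
Proof.
move=> tf; apply: trigpoly_ext
  (trigpoly_comb (2^-1 - cos (b / 2) / 4) tf
    (trigpoly_comb (cos (b / 2) / 4) (trigpolyM_cos tf)
       (trigpolyZ (sin (b / 2) / 4) (trigpolyM_sin tf)))) _ => t.
by rewrite /bump cosB; field.
Qed.

Lemma trigpoly_step b n : trigpoly (fun t => (1 - bump b t ^+ n) ^+ (2 ^ n)).
Proof.
have hX m f : trigpoly f -> trigpoly (fun t => f t * bump b t ^+ m).
  elim: m f => [|m IH] f tf; first by apply: trigpoly_ext tf _ => t; rewrite mulr1.
  by apply: trigpoly_ext (IH _ (trigpolyM_bump b tf)) _ => t; rewrite exprS mulrA.
elim: (2 ^ n)%N => [|m IH]; first exact: trigpoly1.
apply: trigpoly_ext (trigpolyB IH (hX n _ IH)) _ => t.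
by rewrite exprSr mulrBr mulr1.
Qed.

Lemma mray (b : R) : measurable_fun setT (fun t : R => (b < t)%R%:R : R).
Proof.
rewrite (_ : (fun t => _) = \1_(`]b, +oo[)) //.
by apply/funext => t; rewrite indicE mem_setE in_itv/= andbT.
Qed.

Lemma orth_ray (x : H R) (b : R) : (forall k, dot x (e_ R k) = 0) -> 0 < b < pi *+ 2 ->
  \int[mu]_t (x t * (b < t)%R%:R) = 0.
Proof.
move=> x0 b0; pose f n (t : R) := (x : R -> R) t * (1 - bump b t ^+ n) ^+ (2 ^ n).
have mx := measurable_H x.
have ms n : measurable_fun setT (fun t => (1 - bump b t ^+ n) ^+ (2 ^ n)).
  by apply: continuous_measurable_fun; apply: continuous_trigpoly; exact: trigpoly_step.
have mf n : measurable_fun setT (f n) by exact: measurable_funM.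
have mb := mray b.
(* The approximants take values in [0, 1], so |x| dominates. Convergence is established off the null
   set formed by the complement of ]0, 2pi[ and the point b, where [bump b] equals 1/2. *)
have := @dominated_convergence _ _ _ mu setT measurableT (fun n t => (f n t)%:E)
  (fun t => (x t * (b < t)%R%:R)%:E) (fun t => `|x t|%:E).
case.
- by move=> n; apply/measurable_EFinP; exact: mf.
- by apply/measurable_EFinP; exact: measurable_funM.
- have : {ae mu, forall t, 0 < t < pi *+ 2 /\ t != b}.
    exists (~` `]0, (pi *+ 2 : R)[ `|` [set b]); split.
    + by apply: measurableU => //; exact: measurableC.
    + rewrite [LHS]/= /mrestr setIUl setICl set0U; apply: (@subset_measure0 _ _ _ lebesgue_measure _ [set b]) => //.
      * exact: measurableI.
      * exact: lebesgue_measure_set1.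
    + move=> t /= h; have [tb|tb] := eqVneq t b; [by right|left => h2; apply: h].
      by move: h2; rewrite in_itv/=.
  apply: ae_mp => t [t0 tb] _; apply: cvg_EFin; first exact: nearW.
  have [h1 h2] := bump_lt b0 t0 tb; apply: cvgMr; rewrite -h2.
  by apply: step_approx_cvg => //; exact: bump01.
- have xi : mu.-integrable setT (EFin \o (x : R -> R)).
    by apply/Lfun1_integrable; apply: Lfun_subset12; [rewrite circle_measure_setT|exact: H_Lfun].
  exact: (integrable_abse xi).
- apply: aeW => t n _; rewrite lee_fin normrM ler_piMr//.
  by have /andP[h1 h2] := step_approx_bound n (bump01 b t); rewrite ger0_norm.
- move=> _ _ h.
  have : (\int[mu]_t (f n t)%:E)%E @[n --> \oo] --> (\int[mu]_t (x t * (b < t)%R%:R)%:E)%E := h.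
  have fi n : mu.-integrable setT (EFin \o f n).
    apply: (@integrable_Mbounded _ _ _ 1) => // t.
    by have /andP[h1 h2] := step_approx_bound n (bump01 b t); rewrite ger0_norm.
  rewrite (_ : (fun n => _) = cst 0%E); last first.
    apply/funext => n; have := trigpoly_orth x0 (trigpoly_step b n); rewrite /Rintegral => h0.
    by rewrite -[LHS]fineK ?h0//; exact: integrable_fin_num (fi n).
  move/(cvg_unique (@ereal_hausdorff R)) => /(_ _ (cvg_cst _)).
  by rewrite /Rintegral => ->.
Qed.

(** Integrals over all rays vanish, so the primitive of [x] restricted to ]0, 2pi[ is identically
    zero; by Lebesgue differentiation it has derivative [x] almost everywhere there. *)
Lemma H_total (x : H R) : (forall k, dot x (e_ R k) = 0) -> x = 0.
Proof.
move=> x0; have mx := measurable_H x.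
have xi : mu.-integrable setT (EFin \o (x : R -> R)).
  by apply/Lfun1_integrable; apply: Lfun_subset12; [rewrite circle_measure_setT|exact: H_Lfun].
have x1 : \int[mu]_t (x t) = 0.
  rewrite -(trigpoly_orth x0 (trigpoly_cos R 0)).
  by apply: circle_eq => t; rewrite mul0r cos0 mulr1.
pose D : set R := `]0, (pi *+ 2 : R)[%classic.
have xiD : lebesgue_measure.-integrable D (EFin \o (x : R -> R)).
  move/integrableP : xi => [mx' xfin]; apply/integrableP; split; first exact: measurable_funTS.
  by move: xfin; rewrite circle_integral//; exact: measurableT_comp.
pose f := (x : R -> R) \_ D.
have mD : measurable (D : set (measurableTypeR R)) by exact: measurable_itv.
have fi : lebesgue_measure.-integrable setT (EFin \o f).
  by rewrite -restrict_EFin; apply/(integrable_mkcond _ mD); exact: xiD.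
(* [orth_ray] covers 0 < c < 2 pi. Below 0 the integral is that of [x], zero by orthogonality to the
   constants; above 2 pi the integrand vanishes. *)
have Fray c : \int[mu]_t (x t * (c < t)%R%:R) = 0.
  have [c0|c0] := leP c 0.
    rewrite circle_Rintegral; last by apply: measurable_funM => //; exact: mray.
    transitivity (\int[lebesgue_measure]_(t in D) x t); last by rewrite -circle_Rintegral.
    apply: eq_Rintegral => t /[!inE]/=; rewrite in_itv/= => /andP[t0 _].
    by rewrite (le_lt_trans c0 t0) mulr1.
  have [c1|c1] := leP (pi *+ 2) c.
    rewrite circle_Rintegral; last by apply: measurable_funM => //; exact: mray.
    transitivity (\int[lebesgue_measure]_(t in D) (0 : R)); last by rewrite (Rintegral_cst _ mD) mul0r.
    apply: eq_Rintegral => t /[!inE]/=; rewrite in_itv/= => /andP[_ t1].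
    by rewrite ltNge (ltW (lt_le_trans t1 c1))/= mulr0.
  by apply: orth_ray => //; rewrite c0 c1.
have F0 c : \int[lebesgue_measure]_(t in `]-oo, c]) f t = 0.
  rewrite /f -Rintegral_mkcondr setIC Rintegral_mkcondr -circle_Rintegral; last first.
    by apply/(measurable_restrictT _ _).1 => //; exact: measurable_funTS.
  rewrite (@circle_eq _ _ (fun t => x t - x t * (c < t)%R%:R)); last first.
    move=> t; rewrite patchE mem_setE in_itv/= leNgt.
    by case: ifPn => [/negbTE ->|]; [rewrite mulr0 subr0|rewrite negbK => ->; rewrite mulr1 subrr].
  rewrite RintegralB ?x1 ?Fray ?subr0//.
  apply: (@integrable_Mbounded _ _ _ 1); first exact: mray.
  by move=> t; case: (c < t); rewrite ?normr1 ?normr0.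
have fc c : lebesgue_measure.-integrable `]-oo, c] (EFin \o f).
  by apply: integrableS fi.
have [N [mN N0 hN]] := @FTC1Ny R f fc (open_integrable_locally openT fi).
apply: LspaceP; apply: ae_mp2 (H_zero_ae R) _ => [t h0 h1 _|]; first by rewrite h0//; exact: h1.
exists (N `|` ~` D); split.
- by apply: measurableU => //; exact: measurableC.
- rewrite [LHS]/= /mrestr setIUl setICl setU0; apply: (@subset_measure0 _ _ _ lebesgue_measure _ N) => //.
  exact: measurableI.
- move=> t /= xt; apply: contrapT => /not_orP[tN tD]; apply: xt.
  have {}tD : D t by apply: contrapT.
  pose F (c : R) : R := \int[lebesgue_measure]_(s in `]-oo, c]) f s.
  have [_] : derivable F t 1 /\ F^`()%classic t = f t.
    by apply: contrapT => h; apply: tN; exact: hN.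
  rewrite (_ : F = cst 0) ?derive1_cst; last by apply/funext => c; exact: F0.
  by rewrite /f patchE mem_set// => <-.
Qed.

End totality.

(** * Fourier series and weak derivatives *)

Section fourier_series.
Context (R : realType).
Local Notation e := (e_ R).
Implicit Types (a b : int -> R) (x y u v : H R) (n m : nat) (k : int).

Lemma ord_double n (i : 'I_n.*2.+1) : (i < (n * 2).+1)%N.
Proof. by rewrite muln2. Qed.

Definition sumZ n (f : int -> R) : R := \sum_(i < n.*2.+1) f (i%:Z - n%:Z).

Definition fsum n a : H R := \sum_(i < n.*2.+1) a (i%:Z - n%:Z) *: e (i%:Z - n%:Z).

Definition fproj n x : H R := fsum n (fun k => dot x (e k)).

Lemma dot_fsum_e n a k : dot (fsum n a) (e k) = if (`|k|%N <= n)%N then a k else 0.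
Proof.
rewrite /fsum dot_suml; case: leqP => kn.
  have hk : (absz (k + n%:Z)%R < n.*2.+1)%N by rewrite -muln2; lia.
  have ek : (absz (k + n%:Z)%R)%:Z - n%:Z = k by lia.
  rewrite (bigD1 (Ordinal hk))//= dotZl dot_e_e !ek eqxx mulr1.
  rewrite big1 ?addr0// => i ik.
  rewrite dotZl dot_e_e; case: eqP => [h|]; last by rewrite mulr0.
  by move/eqP : ik; case; apply: val_inj => /=; lia.
rewrite big1// => i _; rewrite dotZl dot_e_e; case: eqP => [h|]; last by rewrite mulr0.
by have := ord_double i; lia.
Qed.

Lemma dot_fproj_e n x k : dot (fproj n x) (e k) = if (`|k|%N <= n)%N then dot x (e k) else 0.
Proof. exact: dot_fsum_e. Qed.

Lemma absz_sumZ n (i : 'I_n.*2.+1) : (`|(i%:Z - n%:Z)%R|%N <= n)%N.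
Proof. by have := ord_double i; lia. Qed.

Lemma dot_fsumr n a x : dot x (fsum n a) = sumZ n (fun k => a k * dot x (e k)).
Proof. by rewrite dotC /fsum dot_suml; apply: eq_bigr => i _; rewrite dotZl dotC. Qed.

Lemma dot_fsum_fsum n m a b : (n <= m)%N -> dot (fsum m a) (fsum n b) = sumZ n (fun k => b k * a k).
Proof.
move=> nm; rewrite dot_fsumr; apply: eq_bigr => i _; rewrite dot_fsum_e.
by rewrite (leq_trans (absz_sumZ i) nm).
Qed.

Lemma norm_fsum n a : `|fsum n a| ^+ 2 = sumZ n (fun k => a k ^+ 2).
Proof. by rewrite -dotxx dot_fsum_fsum//. Qed.

Lemma sumZ_opp n f : sumZ n (fun k => f (- k)) = sumZ n f.
Proof.
rewrite /sumZ (reindex_inj rev_ord_inj)/=; apply: eq_bigr => i _.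
congr f; have := ord_double i; have := muln2 n; rewrite subSS; lia.
Qed.

Lemma ler_sumZ n (f g : int -> R) : (forall k, f k <= g k) -> sumZ n f <= sumZ n g.
Proof. by move=> fg; apply: ler_sum. Qed.

Lemma sumZ_scale n (f : int -> R) (c : R) : sumZ n (fun k => c * f k) = c * sumZ n f.
Proof. by rewrite /sumZ mulr_sumr. Qed.

(** For n <= m, |f_n|^2 = <f_m, f_n> <= |f_m| |f_n|, because f_n is the projection of f_m. *)
Lemma norm_fsum_nondecreasing a : nondecreasing_seq (fun n => `|fsum n a| ^+ 2).
Proof.
move=> n m nm; have := dot_fsum_fsum a a nm; rewrite -(@dot_fsum_fsum n n a a)// dotxx => h.
have := CS_dot (fsum m a) (fsum n a); rewrite h ger0_norm ?sqr_ge0// expr2.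
have [-> _|h0] := eqVneq `|fsum n a| 0; first by rewrite mul0r sqr_ge0.
by rewrite ler_pM2r ?lt0r ?h0//= => h1; rewrite -expr2 ler_sqr ?nnegrE.
Qed.

(** Pythagoras gives |f_m - f_n|^2 = |f_m|^2 - |f_n|^2, so bounded monotone squared norms make the
    partial sums Cauchy. This is how vectors with prescribed coefficients are produced. *)
Lemma riesz_fischer a (C : R) : (forall n, sumZ n (fun k => a k ^+ 2) <= C) ->
  exists2 y : H R, (fsum^~ a) @ \oo --> y & forall k, dot y (e k) = a k.
Proof.
move=> aC; have cs : cvgn (fun n => `|fsum n a| ^+ 2).
  apply: nondecreasing_is_cvgn; first exact: norm_fsum_nondecreasing.
  by exists C => _ [n _ <-]; rewrite norm_fsum.
have dE m n : (n <= m)%N -> `|fsum m a - fsum n a| ^+ 2 = `|fsum m a| ^+ 2 - `|fsum n a| ^+ 2.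
  move=> nm; rewrite -[LHS]dotxx dotBl !dotBr (dotC (fsum n a) (fsum m a)) dotxx.
  by rewrite !(dot_fsum_fsum _ _ nm) (@dot_fsum_fsum n n)// -norm_fsum subrr subr0.
have [y fy] : exists y : H R, (fsum^~ a) @ \oo --> y.
  apply: H_complete => eps eps0.
  have e20 : 0 < eps ^+ 2 / 2 by rewrite divr_gt0// exprn_gt0.
  have [N _ hN] := (@cvgrPdist_le _ _ _ _ _ _ _).1 cs _ e20.
  have key m n : (N <= n)%N -> (n <= m)%N -> `|fsum m a - fsum n a| <= eps.
    move=> Nn nm; rewrite -ler_sqr ?nnegrE ?(ltW eps0)// dE//.
    have := hN n Nn; have := hN m (leq_trans Nn nm); rewrite /=.
    rewrite !ler_norml => /andP[h1 h2] /andP[h3 h4]; lra.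
  exists N => m n Nm Nn; case: (leqP n m) => nm; first exact: key.
  by rewrite distrC; apply: key => //; exact: ltnW.
exists y => // k; have h := dot_cvgl (y := e k) fy.
apply: (cvg_unique (@Rhausdorff R) (h _)).
apply: (@cvg_trans _ (cst (a k) n @[n --> \oo])); last exact: cvg_cst.
apply: near_eq_cvg; exists `|k|%N => // n /= kn.
by rewrite dot_fsum_e kn.
Qed.

Lemma fproj_le n x : `|fproj n x| <= `|x|.
Proof.
have h : `|fproj n x| ^+ 2 = dot x (fproj n x) by rewrite dot_fsumr norm_fsum; apply: eq_bigr => i _; rewrite expr2.
have := CS_dot x (fproj n x); rewrite -h ger0_norm ?sqr_ge0// expr2.
have [-> //|h0] := eqVneq `|fproj n x| 0.
by rewrite ler_pM2r ?lt0r ?h0/=.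
Qed.

Lemma H_ext x y : (forall k, dot x (e k) = dot y (e k)) -> x = y.
Proof.
move=> h; apply/eqP; rewrite -subr_eq0; apply/eqP; apply: H_total => k.
by rewrite dotBl h subrr.
Qed.

(** Riesz-Fischer provides a limit with the coefficients of [x]; totality identifies it with [x]. *)
Lemma cvg_fproj x : fproj^~ x @ \oo --> x.
Proof.
have [|y hy yk] := @riesz_fischer (fun k => dot x (e k)) (`|x| ^+ 2).
  by move=> n; rewrite -norm_fsum ler_sqr ?nnegrE// fproj_le.
by rewrite [X in _ --> X](_ : x = y)//; apply: H_ext => k; rewrite yk.
Qed.

Lemma norm_fproj n x : `|fproj n x| ^+ 2 = sumZ n (fun k => dot x (e k) ^+ 2).
Proof. exact: norm_fsum. Qed.

Lemma cvg_norm_fproj x : `|fproj n x| @[n --> \oo] --> `|x|.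
Proof. by apply: cvg_norm; exact: cvg_fproj. Qed.

(** Turns bounds on Fourier multipliers into operator norms. The index -k is there because [D_xi]
    exchanges [e_ k] and [e_ (- k)]; symmetric sums do not see the change of sign. *)
Lemma norm_le_coefN x y (C : R) : 0 <= C ->
  (forall k, `|dot y (e k)| <= C * `|dot x (e (- k))|) -> `|y| <= C * `|x|.
Proof.
move=> C0 h; apply: (@ler_cvg_to nat \oo _ _ (fun n => `|fproj n y|) (fun=> C * `|x|)).
- exact: cvg_norm_fproj.
- exact: cvg_cst.
- apply: nearW => n; apply: le_trans (ler_wpM2l C0 (fproj_le n x)).
  rewrite -ler_sqr ?nnegrE ?mulr_ge0// exprMn !norm_fproj -[in leRHS]sumZ_opp -sumZ_scale.
  apply: ler_sumZ => k; rewrite -exprMn -[leLHS]real_normK ?num_real//.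
  rewrite -[leRHS]real_normK ?num_real// ler_sqr ?nnegrE// normrM (ger0_norm C0); exact: h.
Qed.

Lemma dist_le_coefN u v x y a b (C : R) :
  (forall k, dot u (e k) = a k) -> (forall k, dot v (e k) = b k) -> 0 <= C ->
  (forall k, `|a k - b k| <= C * `|dot x (e (- k)) - dot y (e (- k))|) ->
  `|u - v| <= C * `|x - y|.
Proof. by move=> ua vb C0 h; apply: norm_le_coefN => // k; rewrite !dotBl ua vb. Qed.

Lemma dist_le_coefN0 u v y a b (C : R) :
  (forall k, dot u (e k) = a k) -> (forall k, dot v (e k) = b k) -> 0 <= C ->
  (forall k, `|a k - b k| <= C * `|dot y (e (- k))|) ->
  `|u - v| <= C * `|y|.
Proof. by move=> ua vb C0 h; apply: norm_le_coefN => // k; rewrite dotBl ua vb. Qed.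

(** The existence side of [norm_le_coefN]: it builds the candidate for a weak derivative from its
    coefficients. *)
Lemma exists_coefN x (a : int -> R) (C : R) : 0 <= C ->
  (forall k, `|a k| <= C * `|dot x (e (- k))|) -> exists y, forall k, dot y (e k) = a k.
Proof.
move=> C0 h; have [|y _ hy] := @riesz_fischer a (C ^+ 2 * `|x| ^+ 2); last by exists y.
move=> n; apply: le_trans (_ : C ^+ 2 * `|fproj n x| ^+ 2 <= _); last first.
  by rewrite ler_wpM2l ?sqr_ge0// ler_sqr ?nnegrE// fproj_le.
rewrite norm_fproj -[in leRHS]sumZ_opp -sumZ_scale; apply: ler_sumZ => k.
rewrite -exprMn -[leLHS]real_normK ?num_real// -[leRHS]real_normK ?num_real//.
by rewrite ler_sqr ?nnegrE// normrM (ger0_norm C0); exact: h.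
Qed.

Lemma P_E n x : P_ n x = fproj n x.
Proof.
apply: xget_unique.
  split; first by exists (fun i => dot x (e (i%:Z - n%:Z))).
  move=> z [c _ <-]; rewrite dotC dot_suml big1// => i _.
  by rewrite dotZl dotC dotBl dot_fproj_e absz_sumZ subrr mulr0.
(* Uniqueness, which [xget] requires: the difference z of two solutions lies in the span and is a
   difference of two vectors orthogonal to the span, so <z, z> = 0. *)
move=> y [[c _ cy] hy].
apply/eqP; rewrite -subr_eq0 -normr_eq0 -sqrf_eq0 -dotxx.
pose z := y - fproj n x.
have zs : span_e n z.
  exists (fun i => c i - dot x (e (i%:Z - n%:Z))) => //.
  rewrite /z -cy /fproj /fsum -sumrB; apply: eq_bigr => i _; exact: scalerBl.
have h1 := hy _ zs.
have h2 : dot (x - fproj n x) z = 0.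
  case: zs => c' _ <-; rewrite dotC dot_suml big1// => i _.
  by rewrite dotZl dotC dotBl dot_fproj_e absz_sumZ subrr mulr0.
rewrite -/z {1}/z (_ : y - fproj n x = (x - fproj n x) - (x - y)); first by rewrite dotBl h1 h2 subrr.
by rewrite opprB [RHS]addrC addrA subrK.
Qed.

End fourier_series.

(** * Weak derivatives in Fourier coefficients *)

Section weak_derivative.
Context (R : realType).
Local Notation mu := (@circle_measure R).
Local Notation e := (e_ R).
Implicit Types (x y : H R) (k : int) (phi : R -> R).

Lemma continuous_L2 phi : continuous phi -> (\int[mu]_t (phi t ^+ 2)%:E < +oo)%E.
Proof.
move=> cphi; have c2 : continuous (fun t => phi t ^+ 2).
  by move=> t; apply: (@continuous_comp _ _ _ phi (fun u => u ^+ 2)); [exact: cphi|exact: exprn_continuous].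
have m2 : measurable_fun setT (fun t => phi t ^+ 2) by exact: continuous_measurable_fun.
rewrite circle_integral//; last 2 first.
- exact/measurable_EFinP.
- by move=> t; rewrite lee_fin sqr_ge0.
have : lebesgue_measure.-integrable `[0, (pi *+ 2 : R)] (EFin \o (fun t => phi t ^+ 2)).
  apply: continuous_compact_integrable; first exact: segment_compact.
  exact: continuous_subspaceT.
move=> /integrableP[_]; apply: le_lt_trans.
apply: (@le_trans _ _ (\int[lebesgue_measure]_(t in `]0%R, (pi *+ 2)%R[) `|(phi t ^+ 2)%:E|)%E).
  by apply: ge0_le_integral_nonmeas => t _; rewrite ?lee_fin ?sqr_ge0// ler_norm.
apply: ge0_subset_integral => //.
- by apply: measurable_funTS; apply: measurableT_comp => //; exact/measurable_EFinP.
- exact: subset_itv_oo_cc.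
Qed.

Lemma continuous_integrable phi : continuous phi -> mu.-integrable setT (EFin \o phi).
Proof.
move=> cphi; apply/Lfun1_integrable; apply: Lfun_subset12; first by rewrite circle_measure_setT.
by apply: L2_Lfun; [exact: continuous_measurable_fun|exact: continuous_L2].
Qed.

Definition continuous_class phi (cphi : continuous phi) : H R :=
  L2_class (continuous_measurable_fun cphi) (continuous_L2 cphi).

Lemma dot_continuous_class phi (cphi : continuous phi) x :
  dot x (continuous_class cphi) = \int[mu]_t (x t * phi t).
Proof.
apply: dot_ae; [exact: measurable_H|exact: continuous_measurable_fun|exact: aeW|exact: L2_classE].
Qed.

Lemma continuous_class_ae phi (cphi : continuous phi) : (continuous_class cphi : R -> R) = phi %[ae mu].
Proof. exact: L2_classE. Qed.

Lemma smooth_continuous phi n : smooth_periodic phi -> continuous (derive1n n phi).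
Proof.
by move=> [_ h] t; apply: differentiable_continuous; apply/derivable1_diffP; exact: h.
Qed.

Lemma smooth_continuous0 phi : smooth_periodic phi -> continuous phi.
Proof. exact: (@smooth_continuous phi 0). Qed.

Lemma smooth_continuous1 phi : smooth_periodic phi -> continuous (derive1 phi).
Proof. exact: (@smooth_continuous phi 1). Qed.

(** With the test functions seen as vectors of H, linearity and closedness of the weak derivative
    reduce to those of [dot]. *)
Lemma weak_derivP x y : weak_deriv x y <->
  forall phi (s : smooth_periodic phi),
    dot x (continuous_class (smooth_continuous1 s)) = - dot y (continuous_class (smooth_continuous0 s)).
Proof.
split=> h phi s; first by rewrite !dot_continuous_class; exact: h.
by have := h phi s; rewrite !dot_continuous_class.
Qed.

Lemma weak_deriv_lincomb a x y x' y' : weak_deriv x y -> weak_deriv x' y' ->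
  weak_deriv (a *: x + x') (a *: y + y').
Proof.
move=> /weak_derivP h /weak_derivP h'; apply/weak_derivP => phi s.
by rewrite !dotDl !dotZl h h' mulrN opprD.
Qed.

Lemma weak_deriv0 : weak_deriv (0 : H R) 0.
Proof. by apply/weak_derivP => phi s; rewrite !dot0l oppr0. Qed.

Lemma weak_deriv_closed (u v : nat -> H R) x y : (forall n, weak_deriv (u n) (v n)) ->
  u @ \oo --> x -> v @ \oo --> y -> weak_deriv x y.
Proof.
move=> uv ux vy; apply/weak_derivP => phi s.
have h1 := dot_cvgl (y := continuous_class (smooth_continuous1 s)) ux.
have h2 := cvgN (dot_cvgl (y := continuous_class (smooth_continuous0 s)) vy).
apply: (cvg_unique (@Rhausdorff R) (h1 _)); apply: cvg_trans (h2 _ _).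
by apply: near_eq_cvg; apply: nearW => n; have /weak_derivP -> := uv n.
Qed.

Lemma trig_coefN k : trig_coef R (- k) = trig_coef R k.
Proof. by rewrite /trig_coef oppr_eq0. Qed.

(** One formula for both signs: if k > 0, then -k sin (k t) = k sin (-k t); if k < 0, then k cos (k
    t) = k cos (-k t). *)
Lemma is_derive_trig k (t : R) : is_derive t 1 (@trig R k) (k%:~R * trig (- k) t).
Proof.
have -> : @trig R k = trig_coef R k \*: (fun t => if 0 <= k then cos (k%:~R * t) else sin (k%:~R * t)).
  by apply/funext => s; rewrite trigE.
have [k0|k0] := leP 0 k.
  apply: is_derive_eq (is_deriveZ _ (is_derive_cosM _ _)) _.
  rewrite trigE trig_coefN.
  have [->|k1] := eqVneq k 0; first by rewrite !mul0r oppr0 scaler0.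
  rewrite (_ : (0 <= - k) = false); last by lia.
  by rewrite rmorphN/= mulNr sinN [LHS]mulrN !mulrN mulrCA.
apply: is_derive_eq (is_deriveZ _ (is_derive_sinM _ _)) _.
rewrite trigE trig_coefN (_ : (0 <= - k)); last by lia.
by rewrite rmorphN/= mulNr cosN [LHS]mulrCA.
Qed.

Lemma derive1_trig k : derive1 (@trig R k) = (fun t => k%:~R * trig (- k) t).
Proof. by apply/funext => t; rewrite derive1E; apply: derive_val; exact: is_derive_trig. Qed.

Lemma derive1n_trig n k : exists c j, derive1n n (@trig R k) = (fun t => c * trig j t).
Proof.
elim: n => [|n [c [j IH]]]; first by exists 1, k; apply/funext => t; rewrite mul1r.
exists (c * j%:~R), (- j); rewrite derive1nS IH; apply/funext => t.
rewrite derive1E; apply: derive_val.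
by apply: is_derive_eq (is_deriveZ c (is_derive_trig j t)) _; rewrite [LHS]mulrA.
Qed.

Lemma trig_periodic k (t : R) : trig k (t + pi *+ 2) = trig k t.
Proof.
rewrite !trigE mulrDr; congr (_ * _); case: ifP => _.
  by rewrite cosD cos_int2pi sin_int2pi mulr1 mulr0 subr0.
by rewrite sinD cos_int2pi sin_int2pi mulr1 mulr0 addr0.
Qed.

Lemma smooth_periodic_trig k : smooth_periodic (@trig R k).
Proof.
split=> [t|n t]; first exact: trig_periodic.
have [c [j ->]] := derive1n_trig n k.
by have [] := is_deriveZ c (is_derive_trig j t).
Qed.

Lemma weak_deriv_e k : weak_deriv (e k) (k%:~R *: e (- k)).
Proof.
apply/weak_derivP => phi s.
set c1 := continuous_class _; set c0 := continuous_class _.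
rewrite dotZl (dotC (e k)) (dotC (e (- k))).
have dphi (t : R) : is_derive t 1 phi (derive1 phi t).
  by rewrite derive1E; apply: DeriveDef => //; exact: (s.2 0%N).
have cphi := smooth_continuous0 s; have c1phi := smooth_continuous1 s.
have -> : dot c1 (e k) = \int[mu]_t (derive1 phi t * trig k t).
  apply: dot_ae; [exact: continuous_measurable_fun|exact: measurable_trig|exact: continuous_class_ae|exact: e_ae].
have -> : dot c0 (e (- k)) = \int[mu]_t (phi t * trig (- k) t).
  apply: dot_ae; [exact: continuous_measurable_fun|exact: measurable_trig|exact: continuous_class_ae|exact: e_ae].
have dF (t : R) : is_derive t 1 (fun t => trig k t * phi t)
   (trig k t * derive1 phi t + k%:~R * (phi t * trig (- k) t)).
  apply: is_derive_eq (is_deriveM (is_derive_trig k t) (dphi t)) _.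
  by rewrite /GRing.scale/= mulrCA.
have cF : continuous (fun t => trig k t * derive1 phi t + k%:~R * (phi t * trig (- k) t)).
  move=> t; apply: cvgD; first by apply: cvgM; [exact: continuous_trig|exact: c1phi].
  by apply: cvgMr; apply: cvgM; [exact: cphi|exact: continuous_trig].
(* Integration by parts; the boundary terms cancel since [trig k] and [phi] are both periodic. *)
have := circle_FTC dF cF.
have -> : trig k (pi *+ 2 : R) = trig k 0 by rewrite -(trig_periodic k 0) add0r.
have -> : phi (pi *+ 2) = phi 0 by rewrite -(s.1 0) add0r.
rewrite subrr RintegralD//; last 2 first.
- apply: continuous_integrable => t; apply: cvgM; [exact: continuous_trig|exact: c1phi].
- apply: continuous_integrable => t; apply: cvgMr.
  by apply: cvgM; [exact: cphi|exact: continuous_trig].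
rewrite RintegralZl//; last first.
  by apply: continuous_integrable => t; apply: cvgM; [exact: cphi|exact: continuous_trig].
move=> /eqP; rewrite addr_eq0 => /eqP <-.
by apply: circle_eq => t; rewrite mulrC.
Qed.

Lemma weak_deriv_coef x y : weak_deriv x y -> forall k, dot y (e k) = - (k%:~R * dot x (e (- k))).
Proof.
move=> h k; have := h _ (smooth_periodic_trig k).
rewrite -dot_eE derive1_trig.
rewrite (@circle_eq _ _ (fun t => k%:~R * (x t * trig (- k) t))); last by move=> t; rewrite mulrCA.
rewrite RintegralZl//; last first.
  by apply/Lfun1_integrable; apply: Lfun2_mul_Lfun1; [exact: H_Lfun|exact: trig_Lfun].
by rewrite -dot_eE => ->; rewrite opprK.
Qed.

(** The relation between the coefficients says that each partial sum of [y] is the derivative of the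
    partial sum of [x], after the reindexing k -> -k; closedness passes to the limit. *)
Lemma coef_weak_deriv x y : (forall k, dot y (e k) = - (k%:~R * dot x (e (- k)))) -> weak_deriv x y.
Proof.
move=> h; apply: (@weak_deriv_closed (fun n => fproj n x) (fun n => fproj n y)) => [n||]; [|exact: cvg_fproj|exact: cvg_fproj].
have -> : fproj n y = \sum_(i < n.*2.+1) dot x (e (i%:Z - n%:Z)) *: ((i%:Z - n%:Z)%:~R *: e (- (i%:Z - n%:Z))).
  rewrite /fproj /fsum [LHS](reindex_inj rev_ord_inj)/=; apply: eq_bigr => i _.
  have -> : ((n.*2.+1 - i.+1)%N%:Z - n%:Z) = - (i%:Z - n%:Z).
    by have := ord_double i; have := muln2 n; rewrite subSS; lia.
  by rewrite h opprK scalerA rmorphN mulNr opprK mulrC.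
rewrite /fproj /fsum; elim/big_rec2: _ => [|i u v _ uv]; first exact: weak_deriv0.
by apply: weak_deriv_lincomb => //; exact: weak_deriv_e.
Qed.

Lemma weak_deriv_unique x y y' : weak_deriv x y -> weak_deriv x y' -> y = y'.
Proof.
by move=> h h'; apply: H_ext => k; rewrite (weak_deriv_coef h) (weak_deriv_coef h').
Qed.

Lemma D_xiE x y : weak_deriv x y -> D_xi x = y.
Proof. by move=> h; apply: xget_unique => // z hz; exact: weak_deriv_unique hz h. Qed.

Lemma H1_perP x : H1_per x -> weak_deriv x (D_xi x).
Proof. by move=> [y hy]; rewrite (D_xiE hy). Qed.

Lemma D_xi_e k : D_xi (e k) = k%:~R *: e (- k).
Proof. exact/D_xiE/weak_deriv_e. Qed.

End weak_derivative.

(** * The heat semigroup *)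

Section rescaled_semigroup.
Context (R : realType) (V : normedModType R) (S : R -> V -> V).
Hypothesis Slin : forall t, 0 <= t -> linear (S t).
Hypothesis S0 : forall x, S 0 x = x.
Hypothesis Sadd : forall t s x, 0 <= t -> 0 <= s -> S (t + s) x = S t (S s x).
Implicit Types (c t h : R) (u v w x y : V).

Lemma cvg_expR_quot c : h^-1 * (expR (c * h) - 1) @[h --> 0^'+] --> c.
Proof.
have d : is_derive (0 : R) 1 (fun h : R => expR (c * h)) c.
  have h : is_derive (0 : R) (1 : R) (fun t : R => c * t) c.
    by have := is_deriveZ c (is_derive_id (0 : R) (1 : R)); rewrite [_ *: _]mulr1.
  apply: (is_derive_eq (is_derive1_comp (is_derive_expR (c * 0)) h)).
  by rewrite mulr0 expR0 mul1r.
have dd : derivable (fun h : R => expR (c * h)) (0 : R) 1 by case: d.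
have dv : 'D_(1 : R) (fun h : R => expR (c * h)) (0 : R) = c by apply: derive_val.
have : h^-1 *: (expR (c * (h *: (1 : R) + 0)) - expR (c * 0)) @[h --> 0^'] --> c.
  by rewrite -[X in _ --> X]dv; exact: dd.
move/cvg_dnbhs_at_right; rewrite mulr0 expR0; apply: cvg_trans; apply: near_eq_cvg; apply: nearW => h.
by rewrite addr0 [h *: 1]mulr1.
Qed.

(** exp(-ct) S(t): its generator vanishes on eigenvectors of eigenvalue c, and the aim is to show
    that it fixes them. *)
Definition rescaled c t x := expR (- c * t) *: S t x.

(** The difference quotient of the rescaled semigroup at [u] splits into one part tending to
    [c *: u] and one tending to [- c *: u]. *)
Lemma rescaled_eigen_small c u (eps : R) : 0 < eps ->
  (h^-1 *: (S h u - u)) @[h --> 0^'+] --> c *: u ->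
  \forall h \near 0^'+, `|rescaled c h u - u| <= eps * h.
Proof.
move=> eps0 gen_u.
have c1 : expR (- c * h) *: (h^-1 *: (S h u - u)) @[h --> 0^'+] --> (1 : R) *: (c *: u).
  apply: cvgZ; last exact: gen_u.
  have : continuous (fun h : R => expR (- c * h)).
    move=> h; apply: (@continuous_comp _ _ _ (fun h => - c * h)); last exact: continuous_expR.
    by apply: cvgMr; exact: cvg_id.
  by move=> /(_ 0); rewrite /continuous_at mulr0 expR0 => /cvg_at_right_filter.
have c2 : (h^-1 * (expR (- c * h) - 1)) *: u @[h --> 0^'+] --> (- c) *: u.
  by apply: cvgZr_tmp; exact: cvg_expR_quot.
have := cvgD c1 c2; rewrite scale1r scaleNr addrN => /(_ _)/cvgr0Pnorm_le/(_ _ eps0) hh.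
near=> h; have h0 : 0 < h by near: h; exact: nbhs_right_gt.
have : `|expR (- c * h) *: (h^-1 *: (S h u - u)) + (h^-1 * (expR (- c * h) - 1)) *: u| <= eps.
  by near: h; exact: hh.
rewrite (_ : _ + _ = h^-1 *: (rescaled c h u - u)); last first.
  rewrite /rescaled scalerA (mulrC (expR _)) -scalerA -scalerA -scalerDr.
  by congr (_ *: _); rewrite scalerBr scalerBl scale1r addrA subrK.
by rewrite normrZ gtr0_norm ?invr_gt0// ler_pdivrMl// mulrC.
Unshelve. all: by end_near. Qed.

Lemma rescaled_comb c t a b x y : 0 <= t ->
  rescaled c t (a *: x + b *: y) = a *: rescaled c t x + b *: rescaled c t y.
Proof.
move=> t0; rewrite /rescaled (Slin t0).
have -> : S t (b *: y) = b *: S t y.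
  have h0 : S t 0 = 0.
    by apply: (addrI (S t 0)); rewrite -[X in X + _]scale1r -(Slin t0) scale1r !addr0.
  by have := Slin t0 b y 0; rewrite h0 !addr0.
by rewrite scalerDr !scalerA (mulrC a) (mulrC b).
Qed.

Lemma rescaled_add c s t v : 0 <= s -> 0 <= t -> rescaled c (s + t) v = rescaled c s (rescaled c t v).
Proof.
move=> s0 t0; have := rescaled_comb c (expR (- c * t)) 0 (S t v) 0 s0.
by rewrite !scale0r !addr0 => ->; rewrite /rescaled Sadd// scalerA -expRD mulrDr addrC.
Qed.

(** Each step displaces T(nh)v by at most d |T(nh)v| <= d (1 + d)^n |v|, and these displacements add
    up. The one-step bound is relative and holds on an invariant set [In], so that it applies again
    at each iterate. *)
Lemma rescaled_iter (In : V -> Prop) c h (d : R) n : 0 <= h -> 0 <= d ->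
  (forall t v, 0 <= t -> In v -> In (rescaled c t v)) ->
  (forall v, In v -> `|rescaled c h v - v| <= d * `|v|) ->
  forall v, In v -> `|rescaled c (n%:R * h) v - v| <= ((1 + d) ^+ n - 1) * `|v|.
Proof.
move=> h0 d0 hIn hd v hv; elim: n => [|n IH].
  by rewrite mul0r expr0 subrr mul0r /rescaled mulr0 expR0 scale1r S0 subrr normr0.
have nh0 : 0 <= n%:R * h by rewrite mulr_ge0.
rewrite -natr1 mulrDl mul1r (addrC _ h) rescaled_add//.
set w := rescaled c (n%:R * h) v.
have hw : In w by exact: hIn.
have wn : `|w| <= (1 + d) ^+ n * `|v|.
  rewrite -(subrK v w); apply: le_trans (ler_normD _ _) _.
  by apply: le_trans (lerD IH (lexx _)) _; rewrite mulrBl mul1r subrK.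
have -> : rescaled c h w - v = (rescaled c h w - w) + (w - v) by rewrite addrA subrK.
apply: le_trans (ler_normD _ _) _.
apply: le_trans (lerD (le_trans (hd _ hw) (ler_wpM2l d0 wn)) IH) _.
by rewrite exprS le_eqVlt; apply/orP; left; apply/eqP; ring.
Qed.

(* T(t) = T(t/n)^n and |T(h) - 1| = o(h) on In, so that |T(t) - 1| <= (1 + o(1/n))^n - 1 -> 0:
   no a priori bound on the semigroup is needed. *)
Lemma rescaled_id (In : V -> Prop) c t v :
  (forall t v, 0 <= t -> In v -> In (rescaled c t v)) ->
  (forall eps : R, 0 < eps -> \forall h \near 0^'+,
     forall v, In v -> `|rescaled c h v - v| <= eps * h * `|v|) ->
  0 <= t -> In v -> rescaled c t v = v.
Proof.
move=> hIn small t0 hv; apply/eqP; rewrite -subr_eq0 -normr_le0.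
move: t0; rewrite le_eqVlt => /predU1P[<-|t0].
  by rewrite /rescaled mulr0 expR0 scale1r S0 subrr normr0.
have v1 : 0 < `|v| + 1 by rewrite ltr_wpDl.
apply/ler_addgt0Pr => eta eta0; rewrite add0r.
(* Chosen so that exp(b) - 1 = eta / (|v| + 1), which bounds (1 + b/n)^n - 1 from above; the added 1
   covers v = 0. *)
pose b := ln (1 + eta / (`|v| + 1)).
have b0 : 0 < b by rewrite ln_gt0// ltrDl divr_gt0.
have [r /= r0 hr] := small (b / t) (divr_gt0 b0 t0).
pose n := (Num.truncn (t / r)).+1.
have n0 : 0 < (n%:R : R) by rewrite ltr0n.
have tn : t / n%:R < r by rewrite ltr_pdivrMr// mulrC -ltr_pdivrMr// truncnS_gt.
have h0 : 0 < t / n%:R by rewrite divr_gt0.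
have hh : forall w, In w -> `|rescaled c (t / n%:R) w - w| <= b / n%:R * `|w|.
  move=> w hw; have := hr (t / n%:R); rewrite /= sub0r normrN gtr0_norm// => /(_ tn h0 w hw).
  by rewrite (_ : b / t * (t / n%:R) = b / n%:R)//; field; rewrite !gt_eqF.
have := @rescaled_iter In c (t / n%:R) (b / n%:R) n (ltW h0) _ hIn hh v hv.
have nt : n%:R * (t / n%:R) = t by rewrite mulrC divfK// gt_eqF.
have bn0 : 0 <= b / n%:R by rewrite divr_ge0// ltW.
rewrite nt => /(_ bn0)/le_trans -> //.
apply: (@le_trans _ _ (eta / (`|v| + 1) * `|v|)); last first.
  by rewrite mulrAC ler_pdivrMr// ler_wpM2l ?lerDl// ltW.
rewrite ler_wpM2r// lerBlDl.
have -> : 1 + eta / (`|v| + 1) = expR (b / n%:R) ^+ n.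
  rewrite -expRM_natl (_ : n%:R * (b / n%:R) = b); last by rewrite mulrC divfK// gt_eqF.
  rewrite /b lnK// posrE.
  by rewrite addr_gt0// divr_gt0.
by rewrite lerXn2r ?nnegrE ?addr_ge0 ?expR_ge0 ?expR_ge1Dx.
Qed.

(** Smallness at [u] and [w] becomes uniform on their span because the coordinates are bounded by
    |v|. A plane is needed: the two eigenvectors share an eigenvalue, and S(t) could a priori mix
    them. *)
Lemma rescaled_plane_id (In : V -> Prop) c t u w v :
  (h^-1 *: (S h u - u)) @[h --> 0^'+] --> c *: u ->
  (h^-1 *: (S h w - w)) @[h --> 0^'+] --> c *: w ->
  (forall v, In v -> exists a b, [/\ v = a *: u + b *: w, `|a| <= `|v| & `|b| <= `|v|]) ->
  (forall t v, 0 <= t -> In v -> In (rescaled c t v)) ->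
  0 <= t -> In v -> rescaled c t v = v.
Proof.
move=> gu gw dec hIn; apply: rescaled_id => // eps eps0.
have e2 : 0 < eps / 2 by rewrite divr_gt0.
have n1 := rescaled_eigen_small e2 gu; have n2 := rescaled_eigen_small e2 gw.
near=> h; have h0 : 0 < h by near: h; exact: nbhs_right_gt.
have h1 : `|rescaled c h u - u| <= eps / 2 * h by near: h.
have h2 : `|rescaled c h w - w| <= eps / 2 * h by near: h.
move=> {}v /dec[a [b [vE av bv]]].
rewrite {1 2}vE (rescaled_comb _ _ _ _ _ (ltW h0)) opprD addrACA -!scalerBr.
apply: le_trans (ler_normD _ _) _; rewrite !normrZ.
have -> : eps * h * `|v| = `|v| * (eps / 2 * h) + `|v| * (eps / 2 * h) by field.
by apply: lerD; apply: ler_pM.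
Unshelve. all: by end_near. Qed.

End rescaled_semigroup.

(** * Spectral form of the heat semigroup and bounds on K and K_n *)

Section semigroup.
Context (R : realType) (S : R -> H R -> H R).
Hypothesis hS : is_semigroup_of (@H2_per R) (@opA R) S.
Local Notation e := (e_ R).
Implicit Types (x y v : H R) (k j : int) (t h : R).

Definition lam k : R := - (k%:~R ^+ 2 + 1).

Lemma lamN k : lam (- k) = lam k.
Proof. by rewrite /lam rmorphN/= sqrrN. Qed.

Lemma weak_derivZ a x y : weak_deriv x y -> weak_deriv (a *: x) (a *: y).
Proof. by move=> h; have := weak_deriv_lincomb a h (@weak_deriv0 R); rewrite !addr0. Qed.

Lemma weak_deriv_De k : weak_deriv (k%:~R *: e (- k)) (k%:~R *: ((- k)%:~R *: e k)).
Proof. by apply: weak_derivZ; have := @weak_deriv_e R (- k); rewrite opprK. Qed.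

Lemma H2_per_e k : H2_per (e k).
Proof.
split; first by exists (k%:~R *: e (- k)); exact: weak_deriv_e.
by rewrite D_xi_e; eexists; exact: weak_deriv_De.
Qed.

Lemma opA_e k : opA (e k) = lam k *: e k.
Proof.
rewrite /opA D_xi_e (D_xiE (weak_deriv_De k)) scalerA -[X in _ - X]scale1r -scalerBl.
by congr (_ *: _); rewrite /lam rmorphN/=; ring.
Qed.

Lemma opA_coef x j : H2_per x -> dot (opA x) (e j) = lam j * dot x (e j).
Proof.
move=> [h1 h2]; rewrite /opA dotBl (weak_deriv_coef (H1_perP h2)) (weak_deriv_coef (H1_perP h1)).
by rewrite opprK /lam rmorphN/=; ring.
Qed.

Let Slin t : 0 <= t -> linear (S t).
Proof. by move=> t0; case: hS => /(_ t t0)[]. Qed.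

Let Scont t : 0 <= t -> continuous (S t).
Proof. by move=> t0; case: hS => /(_ t t0)[]. Qed.

Let S0 t : 0 <= t -> S t 0 = 0.
Proof.
move=> t0; have := Slin t0 1 0 0; rewrite scaler0 addr0 scale1r => h.
by apply: (addrI (S t 0)); rewrite addr0 -h.
Qed.

Let SZ t a x : 0 <= t -> S t (a *: x) = a *: S t x.
Proof. by move=> t0; have := Slin t0 a x 0; rewrite !addr0 S0// addr0. Qed.

Let SD t x y : 0 <= t -> S t (x + y) = S t x + S t y.
Proof. by move=> t0; have := Slin t0 1 x y; rewrite !scale1r. Qed.

Let SB t x y : 0 <= t -> S t (x - y) = S t x - S t y.
Proof. by move=> t0; rewrite SD// -scaleN1r SZ// scaleN1r. Qed.

Let Sadd t s x : 0 <= t -> 0 <= s -> S (t + s) x = S t (S s x).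
Proof. by case: hS => _ _ + _ _; apply. Qed.

Lemma gen_e k : (h^-1 *: (S h (e k) - e k)) @[h --> 0^'+] --> lam k *: e k.
Proof.
by case: hS => _ _ _ _ /(_ (e k) (lam k *: e k))[+ _]; apply; split; [exact: H2_per_e|rewrite opA_e].
Qed.

(** Applying the continuous map S(t) to the difference quotient at [e k] gives the quotient at
    [S t (e k)]; its convergence is the generator's criterion for membership in the domain. *)
Lemma gen_Se t k : 0 <= t -> H2_per (S t (e k)) /\ opA (S t (e k)) = lam k *: S t (e k).
Proof.
move=> t0; have [hd ho] : H2_per (S t (e k)) /\ lam k *: S t (e k) = opA (S t (e k)); last by split.
case: hS => _ _ _ _ /(_ (S t (e k)) (lam k *: S t (e k)))[_]; apply.
have h1 : S t (h^-1 *: (S h (e k) - e k)) @[h --> 0^'+] --> S t (lam k *: e k).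
  by apply: (continuous_cvg _ _ (@gen_e k)); exact: Scont.
rewrite SZ// in h1; apply: cvg_trans h1; apply: near_eq_cvg.
near=> h; have h0 : 0 <= h by apply: ltW; near: h; exact: nbhs_right_gt.
by rewrite SZ// SB// -!Sadd// (addrC h t).
Unshelve. all: by end_near. Qed.

Definition inV k v := forall j, j != k -> j != - k -> dot v (e j) = 0.

(** The eigenvalue equation reads (lam k - lam j) c_j = 0 on coefficients, and [lam j = lam k] only
    for j = k or j = -k. *)
Lemma inV_Se t k : 0 <= t -> inV k (S t (e k)).
Proof.
move=> t0 j jk jNk; have [h1 h2] := gen_Se k t0.
have := opA_coef j h1; rewrite h2 dotZl => /eqP; rewrite -subr_eq0 -mulrBl mulf_eq0 => /orP[|/eqP//].
rewrite (_ : lam k - lam j = (j%:~R - k%:~R) * (j%:~R + k%:~R)); last by rewrite /lam; ring.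
rewrite -rmorphB -rmorphD /= mulf_eq0 !intr_eq0 subr_eq0 addr_eq0.
by rewrite (negbTE jk) (negbTE jNk).
Qed.

Lemma inV_e k : inV k (e k).
Proof. by move=> j jk _; rewrite dot_e_e eq_sym (negbTE jk). Qed.

(** For k = 0 the vectors [e k] and [e (- k)] coincide, so the second coordinate is set to 0 to
    avoid counting it twice. *)
Lemma inV_decomp k v : inV k v ->
  v = dot v (e k) *: e k + (if k == 0 then 0 else dot v (e (- k))) *: e (- k).
Proof.
move=> hv; apply: H_ext => j; rewrite dotDl !dotZl !dot_e_e.
have [->|jk] := eqVneq j k.
  rewrite mulr1; have [->|k0] := eqVneq k 0; first by rewrite mul0r addr0.
  by rewrite (_ : (- k == k) = false) ?mulr0 ?addr0//; lia.
rewrite mulr0 add0r; have [jNk|jNk] := eqVneq j (- k); last by rewrite mulr0; exact: hv.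
rewrite mulr1 jNk; case: eqVneq => // k0.
by move: jk; rewrite jNk k0 oppr0 eqxx.
Qed.

Lemma inVN k v : inV (- k) v -> inV k v.
Proof. by move=> hv j h1 h2; apply: hv; rewrite ?opprK. Qed.

Lemma inV_rescaled k t v : 0 <= t -> inV k v -> inV k (rescaled S (lam k) t v).
Proof.
move=> t0 hv; rewrite (inV_decomp hv) rescaled_comb// => j h1 h2.
rewrite dotDl !dotZl inV_Se// (inVN (inV_Se (k := - k) t0))//.
by rewrite !mulr0 addr0.
Qed.

Lemma S_e k t : 0 <= t -> S t (e k) = expR (lam k * t) *: e k.
Proof.
move=> t0; have gN := @gen_e (- k); rewrite lamN in gN.
have S00 : forall x, S 0 x = x by case: hS.
have decV v : inV k v -> exists a b, [/\ v = a *: e k + b *: e (- k), `|a| <= `|v| & `|b| <= `|v|].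
  move=> hv; eexists; eexists; split; first exact: (inV_decomp hv).
    by apply: le_trans (CS_dot _ _) _; rewrite norm_e mulr1.
  case: (k == 0); first by rewrite normr0.
  by apply: le_trans (CS_dot _ _) _; rewrite norm_e mulr1.
have := rescaled_plane_id Slin S00 Sadd (@gen_e k) gN decV (@inV_rescaled k) t0 (@inV_e k).
rewrite /rescaled => h; rewrite -{2}h scalerA -expRD.
by rewrite (mulNr (lam k)) subrr expR0 scale1r.
Qed.

(** The formula holds on partial Fourier sums by [S_e] and extends by continuity of S(t). *)
Lemma S_coef k t x : 0 <= t -> dot (S t x) (e k) = expR (lam k * t) * dot x (e k).
Proof.
move=> t0; have h1 : S t (fproj n x) @[n --> \oo] --> S t x.
  apply: (@cvg_comp _ _ _ (fun n => fproj n x) (S t) _ (nbhs x)); [exact: cvg_fproj|exact: Scont].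
have h2 := dot_cvgl (y := e k) h1.
apply: (cvg_unique (@Rhausdorff R) (h2 _)).
apply: (@cvg_trans _ (cst (expR (lam k * t) * dot x (e k)) n @[n --> \oo])); last exact: cvg_cst.
apply: near_eq_cvg; exists `|k|%N => // n /= kn.
have -> : S t (fproj n x) = fsum n (fun k => expR (lam k * t) * dot x (e k)).
  rewrite /fproj /fsum; elim/big_rec2: _ => [|i u w _ uw]; first exact: S0.
  by rewrite Slin// S_e// uw scalerA mulrC.
by rewrite dot_fsum_e kn.
Qed.

(* The kernel powers [t^{-1/2}] and [t^{-3/4}] are [(qroot t)^-2] and [(qroot t)^-3]. *)
Definition qroot t : R := Num.sqrt (Num.sqrt t).

Lemma qroot_gt0 t : 0 < t -> 0 < qroot t.
Proof. by move=> t0; rewrite !sqrtr_gt0. Qed.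

Lemma qroot4 t : 0 <= t -> qroot t ^+ 4 = t.
Proof. by move=> t0; rewrite (exprM _ 2 2) sqr_sqrtr ?sqrtr_ge0// sqr_sqrtr. Qed.

(* w^m e^{-w^4} <= w^m / (1 + w^4) <= 1 *)
Lemma pow_expR_le1 (w : R) m : 0 <= w -> (m <= 4)%N -> w ^+ m * expR (- w ^+ 4) <= 1.
Proof.
move=> w0 m4; rewrite expRN ler_pdivrMr ?expR_gt0// mul1r.
apply: le_trans (expR_ge1Dx _); have [w1|w1] := leP w 1.
  by apply: (@le_trans _ _ 1); rewrite ?exprn_ile1// lerDl exprn_ge0.
by apply: (@le_trans _ _ (w ^+ 4)); [rewrite ler_weXn2l// ltW|rewrite lerDr].
Qed.

(** With w = |k|^{1/2} t^{1/4}, one has w^2 = |k| t^{1/2} and w^4 = k^2 t, so this is [pow_expR_le1]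
    with m = 2. *)
Lemma coef_bound2 k t : 0 < t -> `|k%:~R * expR (lam k * t)| <= (qroot t)^-2.
Proof.
move=> t0; have q0 := qroot_gt0 t0; set q := qroot t in q0 *.
rewrite normrM (ger0_norm (expR_ge0 _)).
set r := Num.sqrt `|k%:~R : R|; have r0 : 0 <= r by exact: sqrtr_ge0.
have r2 : r ^+ 2 = `|k%:~R| by rewrite sqr_sqrtr.
have r4 : r ^+ 4 = k%:~R ^+ 2 by rewrite (exprM _ 2 2) r2 real_normK ?num_real.
rewrite -r2 -[leRHS]mul1r ler_pdivlMr ?exprn_gt0// mulrAC -exprMn.
have := @pow_expR_le1 (r * q) 2 (mulr_ge0 r0 (ltW q0)) isT; apply: le_trans.
rewrite ler_wpM2l ?sqr_ge0// ler_expR exprMn r4 /q (qroot4 (ltW t0)) /lam.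
by rewrite mulNr lerN2 ler_wpM2r ?(ltW t0)// lerDl.
Qed.

(** The same w with m = 3: since |k| >= n + 1, |k| (n + 1)^{1/2} <= |k|^{3/2}, and w^3 = |k|^{3/2}
    t^{3/4}. *)
Lemma coef_bound3 k t n : 0 < t -> (n < `|k|)%N ->
  `|k%:~R * expR (lam k * t)| <= (Num.sqrt n.+1%:R)^-1 * (qroot t)^-3.
Proof.
move=> t0 nk; have q0 := qroot_gt0 t0; set q := qroot t in q0 *.
rewrite normrM (ger0_norm (expR_ge0 _)).
set r := Num.sqrt `|k%:~R : R|; have r0 : 0 <= r by exact: sqrtr_ge0.
have r2 : r ^+ 2 = `|k%:~R| by rewrite sqr_sqrtr.
have r4 : r ^+ 4 = k%:~R ^+ 2 by rewrite (exprM _ 2 2) r2 real_normK ?num_real.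
have n0 : 0 < Num.sqrt (n.+1%:R : R) by rewrite sqrtr_gt0 ltr0n.
have nr : Num.sqrt n.+1%:R <= r.
  by rewrite ler_wsqrtr// -intr_norm -pmulrn ler_nat.
rewrite -r2 -invfM -[leRHS]mul1r ler_pdivlMr ?mulr_gt0 ?exprn_gt0//.
have := @pow_expR_le1 (r * q) 3 (mulr_ge0 r0 (ltW q0)) isT; apply: le_trans.
have -> : r ^+ 2 * expR (lam k * t) * (Num.sqrt n.+1%:R * q ^+ 3) =
  (r ^+ 2 * Num.sqrt n.+1%:R * q ^+ 3) * expR (lam k * t) by ring.
apply: ler_pM; rewrite ?mulr_ge0 ?exprn_ge0 ?expR_ge0 ?sqrtr_ge0//.
  by rewrite exprMn ler_wpM2r ?exprn_ge0 ?(ltW q0)// [r ^+ 3]exprSr ler_wpM2l ?sqr_ge0.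
rewrite ler_expR exprMn r4 /q (qroot4 (ltW t0)) /lam.
by rewrite mulNr lerN2 ler_wpM2r ?(ltW t0)// lerDl.
Qed.

(** The case m = 1 with w = b t^{1/4}. The exponential weight trades t^{-1/4} for the small factor
    b^{-1}, which makes the iteration contract. *)
Lemma qroot_expR_le (b t : R) : 0 < b -> 0 < t ->
  (qroot t)^-2 * expR (- (b ^+ 4 * t)) <= b^-1 * (qroot t)^-3.
Proof.
move=> b0 t0; have q0 := qroot_gt0 t0.
rewrite -{2}(qroot4 (ltW t0)) -exprMn; set q := qroot t in q0 *.
have := @pow_expR_le1 (b * q) 1 (mulr_ge0 (ltW b0) (ltW q0)) isT.
rewrite expr1 => h; rewrite -[leRHS]mulr1.
have -> : q ^- 2 * expR (- (b * q) ^+ 4) = b^-1 * q ^- 3 * (b * q * expR (- (b * q) ^+ 4)).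
  by field; rewrite !gt_eqF.
by rewrite ler_wpM2l// mulr_ge0 ?invr_ge0 ?exprn_ge0 ?ltW.
Qed.

(** [D_xi] is 0 outside its domain, so [S t x] must first be shown to have a weak derivative; the
    bound on the multipliers gives one by Riesz-Fischer. *)
Lemma K_weak t x : 0 < t -> weak_deriv (S t x) (K_ S t x).
Proof.
move=> t0; apply: H1_perP.
have [||y hy] := @exists_coefN R x (fun k => - (k%:~R * (expR (lam k * t) * dot x (e (- k))))) ((qroot t)^-2).
- by rewrite invr_ge0 exprn_ge0 ?ltW ?qroot_gt0.
- by move=> k; rewrite normrN mulrA normrM ler_wpM2r// coef_bound2.
by exists y; apply: coef_weak_deriv => k; rewrite hy S_coef ?ltW// lamN.
Qed.

Lemma K_coef k t x : 0 < t ->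
  dot (K_ S t x) (e k) = - (k%:~R * expR (lam k * t) * dot x (e (- k))).
Proof.
by move=> t0; rewrite (weak_deriv_coef (K_weak x t0)) S_coef ?ltW// lamN mulrA.
Qed.

Lemma Kn_coef n k t x : 0 < t -> dot (K_n S n t x) (e k) =
  if (`|k| <= n)%N then - (k%:~R * expR (lam k * t) * dot x (e (- k))) else 0.
Proof.
move=> t0; rewrite /K_n /D_xi_n P_E.
pose a k := if (`|k| <= n)%N then - (k%:~R * expR (lam k * t) * dot x (e (- k))) else 0 : R.
have [||y hy] := @exists_coefN R x a ((qroot t)^-2).
- by rewrite invr_ge0 exprn_ge0 ?ltW ?qroot_gt0.
- move=> j; rewrite /a; case: ifP => _.
    by rewrite normrN normrM ler_wpM2r// coef_bound2.
  by rewrite normr0 mulr_ge0// invr_ge0 exprn_ge0 ?ltW ?qroot_gt0.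
rewrite (@D_xiE _ _ y) ?hy//; apply: coef_weak_deriv => j.
rewrite hy /a dot_fproj_e abszN; case: ifP => _; last by rewrite mulr0 oppr0.
by rewrite S_coef ?ltW// lamN mulrA.
Qed.

Lemma Kn_K_bound n t x y : 0 < t ->
  `|K_n S n t x - K_ S t y| <=
    (qroot t)^-2 * `|x - y| + (Num.sqrt n.+1%:R)^-1 * (qroot t)^-3 * `|y|.
Proof.
move=> t0; have q0 := qroot_gt0 t0.
(* Through K_n(t) y: the first difference involves x - y only, the second only the frequencies |k| >
   n. *)
apply: le_trans (ler_distD (K_n S n t y) _ _) _; apply: lerD.
  apply: (dist_le_coefN (fun k => Kn_coef n k x t0) (fun k => Kn_coef n k y t0)) => [|k].
    by rewrite invr_ge0 exprn_ge0 ?ltW.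
  case: (_ <= _)%N; first by rewrite -opprD normrN -mulrBr normrM ler_wpM2r// coef_bound2.
  by rewrite subrr normr0 mulr_ge0// invr_ge0 exprn_ge0 ?ltW.
apply: (dist_le_coefN0 (fun k => Kn_coef n k y t0) (fun k => K_coef k y t0)) => [|k].
  by rewrite mulr_ge0 ?invr_ge0 ?exprn_ge0 ?sqrtr_ge0 ?ltW.
case: ltnP => kn; last first.
  by rewrite subrr normr0 mulr_ge0// mulr_ge0 ?invr_ge0 ?exprn_ge0 ?sqrtr_ge0 ?ltW.
by rewrite sub0r opprK normrM ler_wpM2r// coef_bound3.
Qed.

End semigroup.

(** * Bochner integrals of L^2-valued functions *)

Section L2_random.
Context (R : realType) d (Omega : measurableType d) (P : probability Omega R).
Local Notation e := (e_ R).
Implicit Types (Y Z : Omega -> H R) (k : int).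

(* Measurability of the coordinates: unlike Borel measurability, it is stable under sums
   without appealing to separability of H. *)
Definition coef_measurable Y := forall k, measurable_fun setT (fun w => dot (Y w) (e k)).

Lemma measurable_bigsum (I : Type) (s : seq I) (f : I -> Omega -> R) :
  (forall i, measurable_fun setT (f i)) -> measurable_fun setT (fun w => \sum_(i <- s) f i w).
Proof.
move=> mf; elim: s => [|i s IH].
  by under eq_fun do rewrite big_nil; exact: measurable_cst.
by under eq_fun do rewrite big_cons; exact: measurable_funD.
Qed.

Lemma borel_coef_measurable Y : (forall U, open U -> measurable (Y @^-1` U)) -> coef_measurable Y.
Proof.
move=> mY k; apply: (measurability _ (RGenOInfty.measurableE R)) => _ [_ [a ->] <-].
rewrite setTI (_ : _ @^-1` _ = Y @^-1` ((fun x => dot x (e k)) @^-1` `]a, +oo[)) //.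
apply: mY; apply: open_comp; first by move=> x _; exact: dot_continuous.
exact: interval_open.
Qed.

Lemma coef_measurableB Y Z : coef_measurable Y -> coef_measurable Z ->
  coef_measurable (fun w => Y w - Z w).
Proof. by move=> mY mZ k; under eq_fun do rewrite dotBl; exact: measurable_funB. Qed.

Lemma coef_measurableZ (a : R) Y : coef_measurable Y -> coef_measurable (fun w => a *: Y w).
Proof. by move=> mY k; under eq_fun do rewrite dotZl; exact: measurable_funM. Qed.

Lemma coef_measurable_sum (I : Type) (s : seq I) (p : pred I) (Y : I -> Omega -> H R) :
  (forall i, coef_measurable (Y i)) -> coef_measurable (fun w => \sum_(i <- s | p i) Y i w).
Proof.
move=> mY k; under eq_fun do rewrite dot_suml big_mkcond.
by apply: measurable_bigsum => i; case: (p i) => //; exact: mY.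
Qed.

(** The norm is the limit of the norms of partial Fourier sums, each a function of finitely many
    coordinates. *)
Lemma measurable_norm Y : coef_measurable Y -> measurable_fun setT (fun w => `|Y w|).
Proof.
move=> mY; apply: (@measurable_fun_cvg _ _ _ setT (fun n w => `|fproj n (Y w)|)); last first.
  by move=> w _; exact: cvg_norm_fproj.
move=> n; rewrite (_ : (fun w => _) = (fun w => Num.sqrt (sumZ n (fun k => dot (Y w) (e k) ^+ 2)))); last first.
  by apply/funext => w; rewrite -norm_fproj sqrtr_sqr normr_id.
apply: (@measurableT_comp _ _ _ _ _ _ (@Num.sqrt R)).
  by apply: continuous_measurable_fun; exact: sqrt_continuous.
by apply: measurable_bigsum => i; apply: measurable_funX; exact: mY.
Qed.

Lemma L2n_ge0 Y : (0 <= L2n P Y)%E.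
Proof. exact: Lnorm_ge0. Qed.

Lemma L2n_sqr Y : (\int[P]_w (`|Y w| ^+ 2)%:E = L2n P Y `^ 2)%E.
Proof.
rewrite /L2n powR_Lnorm//; apply: eq_integral => w _.
by rewrite /= normr_id powR_mulrn.
Qed.

Lemma le_L2n_Lnorm Y (f : Omega -> R) : (forall w, `|Y w| <= f w) ->
  (L2n P Y <= 'N[P]_2%:E[EFin \o f])%E.
Proof.
move=> Yf; rewrite /L2n unlock gt0_ler_poweR//.
- by rewrite in_itv/= leey integral_ge0// => w _; exact: poweR_ge0.
- by rewrite in_itv/= leey integral_ge0// => w _; exact: poweR_ge0.
apply: ge0_le_integral_nonmeas => w _; first exact: poweR_ge0.
rewrite gt0_ler_poweR ?in_itv/= ?leey ?andbT ?lee_fin//.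
by rewrite normr_id (le_trans (Yf w))// ler_norm.
Qed.

(** Minkowski for the real functions |Z| and |Z'|. A pointwise bound is assumed rather than Y = Z +
    Z', because [Kn_K_bound] controls norms without giving a decomposition. *)
Lemma L2n_le_add Y Z Z' : coef_measurable Z -> coef_measurable Z' ->
  (forall w, `|Y w| <= `|Z w| + `|Z' w|) -> (L2n P Y <= L2n P Z + L2n P Z')%E.
Proof.
move=> mZ mZ' h; apply: le_trans (le_L2n_Lnorm h) _.
by apply: minkowski_EFin; rewrite ?ler1n//; exact: measurable_norm.
Qed.

Lemma L2nD Y Z : coef_measurable Y -> coef_measurable Z ->
  (L2n P (fun w => (Y w + Z w)%R) <= L2n P Y + L2n P Z)%E.
Proof. by move=> mY mZ; apply: L2n_le_add => // w; exact: ler_normD. Qed.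

Lemma L2n_dist Y Z Z' : coef_measurable Y -> coef_measurable Z -> coef_measurable Z' ->
  (L2n P (fun w => (Y w - Z' w)%R) <= L2n P (fun w => (Y w - Z w)%R) + L2n P (fun w => (Z w - Z' w)%R))%E.
Proof.
by move=> mY mZ mZ'; apply: L2n_le_add => [||w]; [exact: coef_measurableB|exact: coef_measurableB|exact: ler_distD].
Qed.

Lemma L2n_distC Y Z : L2n P (fun w => Y w - Z w) = L2n P (fun w => Z w - Y w).
Proof. by rewrite /L2n; congr Lnorm; apply/funext => w /=; rewrite distrC. Qed.

Lemma L2n0 : L2n P (fun=> 0) = 0%E.
Proof.
rewrite /L2n (_ : _ \o _ = cst 0%E) ?Lnorm0//.
by apply/funext => w /=; rewrite normr0.
Qed.

Lemma L2n_ae_eq Y Z : coef_measurable Y -> coef_measurable Z -> {ae P, forall w, Y w = Z w} ->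
  L2n P Y = L2n P Z.
Proof.
move=> mY mZ YZ; apply: (Lnorm_ae_eq (lee1n 2)); [exact: measurable_norm|exact: measurable_norm|].
by apply: filterS YZ => w -> _.
Qed.

Lemma L2nZ (a : R) Y : coef_measurable Y -> L2n P (fun w => a *: Y w) = (`|a|%:E * L2n P Y)%E.
Proof.
move=> mY; rewrite /L2n unlock.
have -> : (\int[P]_w `|(EFin \o (fun w => `|a *: Y w|)%R) w| `^ 2)%E =
          ((`|a| ^+ 2)%:E * \int[P]_w (`|(EFin \o (fun w => `|Y w|)%R) w| `^ 2))%E.
  rewrite -ge0_integralZl//.
  - apply: eq_integral => w _; rewrite /= normr_id normrZ -EFinM; congr (_%:E).
    by rewrite normr_id !powR_mulrn// exprMn.
  - apply: (measurableT_comp (measurable_poweR 2)).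
    by apply: measurableT_comp => //; apply/measurable_EFinP; exact: measurable_norm.
  - by move=> w _; exact: poweR_ge0.
rewrite poweRM ?lee_fin ?sqr_ge0//; last by apply: integral_ge0 => w _; exact: poweR_ge0.
by rewrite poweR_EFin -powR_mulrn// -powRrM divff// powRr1.
Qed.

Lemma L2n_sum (I : Type) (s : seq I) (Y : I -> Omega -> H R) : (forall i, coef_measurable (Y i)) ->
  (L2n P (fun w => \sum_(i <- s) Y i w)%R <= \sum_(i <- s) L2n P (Y i))%E.
Proof.
move=> mY; elim: s => [|i s IH].
  by rewrite big_nil; under eq_fun do rewrite big_nil; rewrite L2n0.
rewrite big_cons; under eq_fun do rewrite big_cons.
apply: le_trans (L2nD _ _) _ => //; first exact: coef_measurable_sum.
exact: leeD2l.
Qed.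

Lemma L2rv_coef_measurable Y : L2rv P Y -> coef_measurable Y.
Proof. by move=> [mY _]; exact: borel_coef_measurable. Qed.

End L2_random.

Section finite_patterns.
Context d (T : measurableType d) (R : realType) (m : {measure set T -> \bar R}).
Context (I : finType) (A : I -> set T).
Hypothesis mA : forall i, measurable (A i).

(* Simple functions over the family [A] depend on [s] only through [pattern s], hence have
   integrals which are finite sums over the disjoint [atom]s. *)
Definition pattern (s : T) : {set I} := [set i | s \in A i].

Definition atom (J : {set I}) : set T := [set s | pattern s = J].

Lemma measurable_atom J : measurable (atom J).
Proof.
have -> : atom J = \big[setI/setT]_(i : I) (if i \in J then A i else ~` A i).
  rewrite -bigcap_seq; apply/seteqP; split=> [s <- i _ /=|s h].
    rewrite inE; case: ifPn => [/set_mem//|]; by rewrite notin_setE.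
  apply/setP => i; have := h i; rewrite /= mem_index_enum inE => /(_ isT).
  by case: ifPn => _ si; [rewrite mem_set|apply/negbTE; rewrite notin_setE].
by apply: bigsetI_measurable => i _; case: ifP => _ //; exact: measurableC.
Qed.

Lemma pattern_sum (f : {set I} -> R) s : f (pattern s) = \sum_(J : {set I}) f J * \1_(atom J) s.
Proof.
rewrite (bigD1 (pattern s))//= indicE mem_set// mulr1 big1 ?addr0// => J Js.
rewrite indicE memNset ?mulr0//= => h; by rewrite -h eqxx in Js.
Qed.

Lemma measurable_pattern (f : {set I} -> R) : measurable_fun setT (fun s => f (pattern s)).
Proof.
under eq_fun do rewrite pattern_sum.
have h (l : seq {set I}) : measurable_fun setT (fun s => \sum_(J <- l) f J * \1_(atom J) s).
  elim: l => [|J l IH]; first by under eq_fun do rewrite big_nil; exact: measurable_cst.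
  under eq_fun do rewrite big_cons; apply: measurable_funD => //.
  by apply: measurable_funM => //; apply: measurable_indic; exact: measurable_atom.
exact: h.
Qed.

Lemma integral_pattern (D : set T) (f : {set I} -> R) : measurable D ->
  (forall J, 0 <= f J) ->
  (\int[m]_(s in D) (f (pattern s))%:E = \sum_(J : {set I}) (f J)%:E * m (D `&` atom J))%E.
Proof.
move=> mD f0; under eq_integral do rewrite pattern_sum -sumEFin.
have mi J : measurable_fun D (fun s => (\1_(atom J) s : R)%:E).
  by apply/measurable_EFinP; apply: measurable_indic; exact: measurable_atom.
rewrite ge0_integral_sum//; last 2 first.
- move=> J; under eq_fun do rewrite EFinM; exact: measurable_funeM.
- by move=> J s _; rewrite lee_fin mulr_ge0.
apply: eq_bigr => J _; under eq_integral do rewrite EFinM.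
rewrite (ge0_integralZl m mD (mi J)) ?lee_fin//.
by rewrite (integral_indic m mD (measurable_atom J)) (setIC (atom J)).
Qed.

End finite_patterns.

(** * Minkowski's inequality for Bochner integrals *)

Section bochner_inequality.
Context (R : realType) d (Omega : measurableType d) (P : probability Omega R).
Local Notation e := (e_ R).
Local Notation leb := (@lebesgue_measure R).

Section simple.
Context (I : finType) (A : I -> set R) (Z : I -> Omega -> H R).
Hypothesis mA : forall i, measurable (A i).
Hypothesis mZ : forall i, coef_measurable (Z i).
Hypothesis Zfin : forall i, (L2n P (Z i) < +oo)%E.

(** The value of the step process on [atom A J]. *)
Let V (J : {set I}) w : H R := \sum_(i in J) Z i w.

Let mV J : coef_measurable (V J).
Proof. exact: coef_measurable_sum. Qed.

Let Vfin J : L2n P (V J) \is a fin_num.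
Proof.
rewrite ge0_fin_numE ?L2n_ge0//.
have -> : V J = (fun w => \sum_(i : I) (if i \in J then Z i w else 0)).
  by apply/funext => w; rewrite /V big_mkcond.
pose Z' i := if i \in J then Z i else (fun=> 0).
apply: (@le_lt_trans _ _ (\sum_(i : I) L2n P (Z' i))%E).
  rewrite (_ : (fun w => _) = (fun w => \sum_i Z' i w)); last first.
    by apply/funext => w; apply: eq_bigr => i _; rewrite /Z'; case: ifP.
  apply: L2n_sum => i; rewrite /Z'; case: ifP => _; first exact: mZ.
  by move=> k; under eq_fun do rewrite dot0l; exact: measurable_cst.
apply: lte_sum_pinfty => i _; rewrite /Z'; case: ifP => _ //.
by rewrite L2n0 ltry.
Qed.

Let step_pattern s w : \sum_i \1_(A i) s *: Z i w = V (pattern A s) w.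
Proof.
rewrite /V [RHS]big_mkcond/=; apply: eq_bigr => i _.
by rewrite indicE inE; case: (s \in A i); rewrite ?scale1r ?scale0r.
Qed.

Let L2n_step s : L2n P (fun w => \sum_i \1_(A i) s *: Z i w) = (fine (L2n P (V (pattern A s))))%:E.
Proof.
rewrite fineK ?Vfin//; congr (L2n P _); apply/funext => w; exact: step_pattern.
Qed.

Lemma measurable_L2n_step :
  measurable_fun setT (fun s => L2n P (fun w => \sum_i \1_(A i) s *: Z i w)).
Proof.
rewrite (_ : (fun s => _) = (fun s => (fine (L2n P (V (pattern A s))))%:E)); last first.
  by apply/funext => s; exact: L2n_step.
apply/measurable_EFinP; exact: (measurable_pattern mA (fun J => fine (L2n P (V J)))).
Qed.

(** The sets [A i] may overlap, so the triangle inequality on the given sum would lose too much.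
    Regrouped over the disjoint atoms, on which the step process does not depend on s, it yields
    exactly the integral of the norm. *)
Lemma L2n_int_step_le (D : set R) : measurable D -> (leb D < +oo)%E ->
  (L2n P (fun w => \sum_i fine (leb (D `&` A i)) *: Z i w)%R <=
   \int[leb]_(s in D) L2n P (fun w => \sum_i \1_(A i) s *: Z i w)%R)%E.
Proof.
move=> mD Dfin.
have bfin J : leb (D `&` atom A J) \is a fin_num.
  rewrite ge0_fin_numE// (le_lt_trans _ Dfin)// le_measure// ?inE//.
  by apply: measurableI => //; exact: measurable_atom.
pose b J := fine (leb (D `&` atom A J)).
have b0 J : 0 <= b J by rewrite fine_ge0.
(* [A i] is the disjoint union of the atoms J containing i. *)
have aE i : fine (leb (D `&` A i)) = \sum_(J : {set I}) (i \in J)%:R * b J.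
  have := integral_pattern leb mA mD (f := fun J => (i \in J)%:R) (fun J => ler0n _ _).
  rewrite (_ : (\int[leb]_(s in D) _)%E = leb (D `&` A i)); last first.
    transitivity (\int[leb]_(s in D) (\1_(A i) s : R)%:E)%E; last by rewrite (integral_indic leb mD (mA i)) (setIC (A i)).
    by apply: eq_integral => s _; rewrite inE indicE.
  move=> ->; rewrite (eq_bigr (fun J : {set I} => ((i \in J)%:R * b J)%:E)) ?sumEFin//.
  by move=> J _; rewrite EFinM fineK.
have -> : (fun w => \sum_i fine (leb (D `&` A i)) *: Z i w) =
          (fun w => \sum_(J : {set I}) b J *: V J w).
  apply/funext => w; under eq_bigr do rewrite aE scaler_suml.
  rewrite exchange_big/=; apply: eq_bigr => J _; rewrite /V scaler_sumr [RHS]big_mkcond/=.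
  by apply: eq_bigr => i _; case: (i \in J); rewrite ?mul1r// mul0r scale0r.
apply: le_trans (@L2n_sum _ _ _ P _ (index_enum _) (fun J w => b J *: V J w) _) _.
  by move=> J; exact: coef_measurableZ.
under [leRHS]eq_integral do rewrite L2n_step.
rewrite (integral_pattern leb mA mD (f := fun J => fine (L2n P (V J)))); last first.
  by move=> J; rewrite fine_ge0// L2n_ge0.
apply: lee_sum => J _; rewrite (L2nZ P (b J) (mV J)) ger0_norm// fineK// /b fineK// muleC.
exact: lexx.
Qed.

End simple.

Section two_steps.
Context (I J : finType) (A : I -> set R) (B : J -> set R) (Z : I -> Omega -> H R) (V : J -> Omega -> H R).
Hypothesis mA : forall i, measurable (A i).
Hypothesis mB : forall i, measurable (B i).
Hypothesis mZ : forall i, L2rv P (Z i).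
Hypothesis mV : forall i, L2rv P (V i).

(** A difference of two step processes is again one, over the disjoint sum of the index types; the
    sign goes into the values. *)
Let AB (i : I + J) := match i with inl i => A i | inr j => B j end.
Let ZV (i : I + J) := match i with inl i => Z i | inr j => (fun w => - 1 *: V j w) end.

Let mAB i : measurable (AB i).
Proof. by case: i. Qed.

Let mZV i : coef_measurable (ZV i).
Proof.
case: i => i; first exact: L2rv_coef_measurable (mZ i).
by apply: coef_measurableZ; exact: L2rv_coef_measurable (mV i).
Qed.

Let ZVfin i : (L2n P (ZV i) < +oo)%E.
Proof.
case: i => i; first exact: (mZ i).2.
rewrite /ZV L2nZ; last exact: L2rv_coef_measurable (mV i).
by rewrite normrN1 mul1e; exact: (mV i).2.
Qed.

Let sumZV (a : I + J -> R) w : \sum_i a i *: ZV i w =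
  \sum_(i : I) a (inl i) *: Z i w - \sum_(j : J) a (inr j) *: V j w.
Proof.
rewrite big_sumType/=; congr (_ + _); rewrite -sumrN; apply: eq_bigr => j _.
by rewrite scaleN1r scalerN.
Qed.

Lemma measurable_L2n_step2 : measurable_fun setT (fun s =>
  L2n P (fun w => \sum_i \1_(A i) s *: Z i w - \sum_j \1_(B j) s *: V j w)).
Proof.
have := measurable_L2n_step mAB mZV ZVfin; congr (measurable_fun _ _).
by apply/funext => s; congr (L2n P _); apply/funext => w; exact: sumZV.
Qed.

Lemma L2n_int_step2_le (D : set R) : measurable D -> (leb D < +oo)%E ->
  (L2n P (fun w => \sum_i fine (leb (D `&` A i)) *: Z i w - \sum_j fine (leb (D `&` B j)) *: V j w)%R <=
   \int[leb]_(s in D) L2n P (fun w => \sum_i \1_(A i) s *: Z i w - \sum_j \1_(B j) s *: V j w)%R)%E.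
Proof.
move=> mD Dfin; have := L2n_int_step_le mAB mZV ZVfin mD Dfin.
under [X in L2n _ X]eq_fun do rewrite (sumZV (fun i => fine (leb (D `&` AB i)))).
move=> /le_trans; apply; rewrite le_eqVlt; apply/orP; left; apply/eqP.
by apply: eq_integral => s _; congr (L2n P _); apply/funext => w; exact: sumZV.
Qed.

End two_steps.

Lemma ereal_cvg0_near (u : (\bar R)^nat) (eps : R) : 0 < eps -> u @ \oo --> 0%E ->
  \forall n \near \oo, (u n <= eps%:E)%E.
Proof.
move=> eps0 u0; have : \forall n \near \oo, (u n < eps%:E)%E.
  exact: (u0 _ (@nbhs_open_ereal_lt R 0 (fun=> eps) eps0)).
by apply: filterS => n /= /ltW.
Qed.

Lemma limn_esup_le (u : (\bar R)^nat) (c : \bar R) :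
  (\forall n \near \oo, (u n <= c)%E) -> (limn_esup u <= c)%E.
Proof.
move=> [N _ uc]; rewrite limn_esup_lim; apply: lime_le; first exact: is_cvg_esups.
by exists N => // n /= Nn; apply: ub_ereal_sup => _ [k /= nk <-]; apply: uc; exact: leq_trans nk.
Qed.

Lemma limn_esup_ge (u : (\bar R)^nat) (c : \bar R) :
  (\forall n \near \oo, (c <= u n)%E) -> (c <= limn_esup u)%E.
Proof.
move=> [N _ uc]; rewrite limn_esup_lim; apply: lime_ge; first exact: is_cvg_esups.
apply: nearW => n; apply: (@le_trans _ _ (u (maxn n N))); first by apply: uc; exact: leq_maxr.
by apply: ereal_sup_ubound; exists (maxn n N) => //=; exact: leq_maxl.
Qed.

(** The null set is removed from the integral of the measurable [f]; what remains is a pointwise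
    comparison, for which [g] may be arbitrary. *)
Lemma ae_le_integral_nonmeas (D : set R) (f g : R -> \bar R) : measurable D ->
  measurable_fun D f -> (forall s, D s -> 0 <= f s)%E -> (forall s, D s -> 0 <= g s)%E ->
  {ae leb, forall s, D s -> (f s <= g s)%E} ->
  (\int[leb]_(s in D) f s <= \int[leb]_(s in D) g s)%E.
Proof.
move=> mD mf f0 g0 [N [mN N0 hN]].
rewrite (ge0_negligible_integral mN mD mf f0 N0) integral_mkcond [leRHS]integral_mkcond.
apply: ge0_le_integral_nonmeas => s _; first by apply: erestrict_ge0 => t [Dt _]; exact: f0.
rewrite !patchE; case: ifPn => [|_].
  rewrite inE => -[Ds Ns]; rewrite mem_set//; apply: contrapT => h; apply: Ns; apply: hN => /= h2.
  by apply: h; exact: h2.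
by case: ifPn => // /set_mem; exact: g0.
Qed.

Section approx.
Variables (D : set R) (f : R -> Omega -> H R) (m : nat -> nat)
  (A : nat -> nat -> set R) (Z : nat -> nat -> Omega -> H R).
Hypothesis mf : forall s, D s -> coef_measurable (f s).
Hypothesis mAZ : forall n i, measurable (A n i) /\ L2rv P (Z n i).
Let step n s w : H R := \sum_(i < m n) \1_(A n i) s *: Z n i w.
Hypothesis step_ae : {ae leb, forall s, D s ->
        L2n P (fun w => f s w - step n s w) @[n --> \oo] --> 0%E}.

Lemma step_coef_measurable n s : coef_measurable (step n s).
Proof.
by apply: coef_measurable_sum => i; apply: coef_measurableZ; exact: L2rv_coef_measurable (mAZ n i).2.
Qed.

(* The error is the a.e. limit of measurable functions: the Lebesgue measure on Borel sets is
   not complete, and the integral of a non measurable function is not additive. *)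
Lemma step_error_measurable n : exists h : R -> \bar R,
  [/\ measurable_fun setT h, (forall s, 0 <= h s)%E &
     {ae leb, forall s, D s -> h s = L2n P (fun w => f s w - step n s w)}].
Proof.
pose u l s := L2n P (fun w => step l s w - step n s w).
have mu_ l : measurable_fun setT (u l).
  by apply: measurable_L2n_step2 => i; [exact: (mAZ _ _).1|exact: (mAZ _ _).1|exact: (mAZ _ _).2|exact: (mAZ _ _).2].
exists (fun s => limn_esup (u ^~ s)); split.
- exact: measurable_fun_limn_esup.
- by move=> s; apply: limn_esup_ge; apply: nearW => l; exact: L2n_ge0.
- apply: ae_mp step_ae => s hs Ds; have {}hs := hs Ds.
  have ms := mf Ds; have mst l := step_coef_measurable l s.
  apply/eqP; rewrite eq_le; apply/andP; split.
    apply/lee_addgt0Pr => eps eps0; apply: limn_esup_le.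
    apply: filterS (ereal_cvg0_near eps0 hs) => l hl.
    apply: le_trans (L2n_dist P (mst l) ms (mst n)) _.
    by rewrite addeC leeD2l// L2n_distC.
  apply/lee_addgt0Pr => eps eps0; rewrite -leeBlDr//; apply: limn_esup_ge.
  apply: filterS (ereal_cvg0_near eps0 hs) => l hl.
  rewrite leeBlDr//; apply: le_trans (L2n_dist P ms (mst l) (mst n)) _.
  by rewrite addeC leeD2l.
Qed.

End approx.

(** The inequality holds for the approximating steps up to the errors of approximation, which vanish
    in the limit. A measurable majorant [c] stands for the norm of f1 - f2, whose own measurability
    in s is not at hand. *)
Lemma bochner_integral_le (D : set R) (f1 f2 : R -> Omega -> H R) Y1 Y2 (c : R -> \bar R) :
  measurable D -> (leb D < +oo)%E ->
  (forall s, D s -> coef_measurable (f1 s)) -> (forall s, D s -> coef_measurable (f2 s)) ->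
  is_bochner_integral P D f1 Y1 -> is_bochner_integral P D f2 Y2 ->
  measurable_fun D c -> (forall s, D s -> 0 <= c s)%E ->
  (forall s, D s -> L2n P (fun w => f1 s w - f2 s w)%R <= c s)%E ->
  (L2n P (fun w => Y1 w - Y2 w)%R <= \int[leb]_(s in D) c s)%E.
Proof.
move=> mD Dfin mf1 mf2 [Y1L2 [m1 [A1 [Z1 /= [mAZ1 ae1 int1 Y1c]]]]]
  [Y2L2 [m2 [A2 [Z2 /= [mAZ2 ae2 int2 Y2c]]]]] mc c0 fc.
pose st1 n s w : H R := \sum_(i < m1 n) \1_(A1 n i) s *: Z1 n i w.
pose st2 n s w : H R := \sum_(i < m2 n) \1_(A2 n i) s *: Z2 n i w.
pose I1 n w : H R := \sum_(i < m1 n) fine (leb (D `&` A1 n i)) *: Z1 n i w.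
pose I2 n w : H R := \sum_(i < m2 n) fine (leb (D `&` A2 n i)) *: Z2 n i w.
pose g1 n s := L2n P (fun w => f1 s w - st1 n s w).
pose g2 n s := L2n P (fun w => f2 s w - st2 n s w).
have mI1 n : coef_measurable (I1 n).
  by apply: coef_measurable_sum => i; apply: coef_measurableZ; exact: L2rv_coef_measurable (mAZ1 _ _).2.
have mI2 n : coef_measurable (I2 n).
  by apply: coef_measurable_sum => i; apply: coef_measurableZ; exact: L2rv_coef_measurable (mAZ2 _ _).2.
have mst1 n s : coef_measurable (st1 n s) by exact: step_coef_measurable.
have mst2 n s : coef_measurable (st2 n s) by exact: step_coef_measurable.
have g10 n s : D s -> (0 <= g1 n s)%E by move=> _; exact: L2n_ge0.
have g20 n s : D s -> (0 <= g2 n s)%E by move=> _; exact: L2n_ge0.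
have key n : (L2n P (fun w => I1 n w - I2 n w)%R <=
   \int[leb]_(s in D) g1 n s + \int[leb]_(s in D) g2 n s + \int[leb]_(s in D) c s)%E.
  have [h1 [mh1 h10 h1g]] := step_error_measurable mf1 mAZ1 ae1 n.
  have [h2 [mh2 h20 h2g]] := step_error_measurable mf2 mAZ2 ae2 n.
  apply: le_trans (L2n_int_step2_le _ _ _ _ mD Dfin) _.
  - by move=> i; exact: (mAZ1 _ _).1.
  - by move=> i; exact: (mAZ2 _ _).1.
  - by move=> i; exact: (mAZ1 _ _).2.
  - by move=> i; exact: (mAZ2 _ _).2.
  have mh1D := @measurable_funTS _ _ _ _ D _ mh1; have mh2D := @measurable_funTS _ _ _ _ D _ mh2.
  (* [h1] and [h2] are measurable versions of the errors [g1] and [g2]; with them the integral of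
     the sum splits. *)
  apply: (@le_trans _ _ (\int[leb]_(s in D) (h1 s + h2 s + c s))%E).
    apply: ae_ge0_le_integral => //.
    + by move=> s _; exact: L2n_ge0.
    + apply: measurable_funTS; apply: measurable_L2n_step2 => i; [exact: (mAZ1 _ _).1|exact: (mAZ2 _ _).1|exact: (mAZ1 _ _).2|exact: (mAZ2 _ _).2].
    + by move=> s Ds; rewrite !adde_ge0// c0.
    + by apply: emeasurable_funD => //; exact: emeasurable_funD.
    + apply: ae_mp2 h1g h2g => s h1s h2s Ds; rewrite h1s// h2s//.
      apply: le_trans (L2n_dist P (mst1 n s) (mf1 s Ds) (mst2 n s)) _.
      rewrite -addeA leeD ?(L2n_distC P (st1 n s))//.
      apply: le_trans (L2n_dist P (mf1 s Ds) (mf2 s Ds) (mst2 n s)) _.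
      by rewrite [leLHS]addeC; exact: (leeD (lexx _) (fc s Ds)).
  rewrite ge0_integralD//; last 2 first.
  - by move=> s _; rewrite adde_ge0.
  - exact: emeasurable_funD.
  rewrite ge0_integralD// leeD2r// leeD//.
  - by apply: ae_le_integral_nonmeas => //; [exact: g10|apply: ae_mp h1g => s h /h ->].
  - by apply: ae_le_integral_nonmeas => //; [exact: g20|apply: ae_mp h2g => s h /h ->].
have mY1 := L2rv_coef_measurable Y1L2; have mY2 := L2rv_coef_measurable Y2L2.
(* Four errors: two from the integrals Y1 and Y2, two from the integrands. *)
apply/lee_addgt0Pr => eps eps0; have e4 : 0 < eps / 4 by rewrite divr_gt0.
near \oo => n.
apply: le_trans (L2n_dist P mY1 (mI1 n) mY2) _.
have a1 : (L2n P (fun w => Y1 w - I1 n w)%R <= (eps / 4)%:E)%E by near: n; exact: ereal_cvg0_near.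
have a2 : (L2n P (fun w => I2 n w - Y2 w)%R <= (eps / 4)%:E)%E.
  by rewrite L2n_distC; near: n; exact: ereal_cvg0_near.
have a3 : (\int[leb]_(s in D) g1 n s <= (eps / 4)%:E)%E by near: n; exact: ereal_cvg0_near.
have a4 : (\int[leb]_(s in D) g2 n s <= (eps / 4)%:E)%E by near: n; exact: ereal_cvg0_near.
apply: le_trans (leeD a1 (le_trans (L2n_dist P (mI1 n) (mI2 n) mY2) (leeD (le_trans (key n) (leeD (leeD a3 a4) (lexx _))) a2))) _.
rewrite [X in (_ <= _ + X)%E](_ : eps%:E = ((eps / 4)%:E + (eps / 4)%:E + (eps / 4)%:E + (eps / 4)%:E)%E); last first.
  by rewrite -!EFinD; congr (_%:E); field.
rewrite le_eqVlt; apply/orP; left; apply/eqP.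
by rewrite [LHS](AC (1*4) (4*(((1*2)*3)*5))%AC).
Unshelve. all: by end_near. Qed.

End bochner_inequality.

(** * Convergence of the mild solutions *)

Section kernel_integral.
Context (R : realType).
Local Notation leb := (@lebesgue_measure R).

Lemma continuous_qroot : continuous (@qroot R).
Proof.
move=> u; apply: (@continuous_comp _ _ _ (@Num.sqrt R) (@Num.sqrt R)); exact: sqrt_continuous.
Qed.

Lemma is_derive_qroot (u : R) : 0 < u -> is_derive u 1 (@qroot R) (4^-1 * (qroot u)^-3).
Proof.
move=> u0; have s0 : 0 < Num.sqrt u by rewrite sqrtr_gt0.
have q0 := qroot_gt0 u0.
apply: (is_derive_eq (is_derive1_comp (is_derive1_sqrt s0) (is_derive1_sqrt u0))).
have -> : Num.sqrt u = qroot u ^+ 2 by rewrite /qroot sqr_sqrtr// sqrtr_ge0.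
rewrite -/(qroot u) (_ : Num.sqrt (qroot u ^+ 2) = qroot u); last by rewrite sqrtr_sqr gtr0_norm.
by field; rewrite gt_eqF.
Qed.

Lemma continuous_qrootV (u : R) : 0 < u -> {for u, continuous (fun u => (qroot u)^-3)}.
Proof.
move=> u0; apply: cvgV; first by rewrite expf_neq0// gt_eqF// qroot_gt0.
rewrite /= (_ : (fun u => qroot u ^+ 3) = (fun u => qroot u * (qroot u * qroot u)))//.
by apply: cvgM; [exact: continuous_qroot|apply: cvgM; exact: continuous_qroot].
Qed.

Lemma continuous_qrootV_sub (a s : R) : s < a -> {for s, continuous (fun s => (qroot (a - s))^-3)}.
Proof.
move=> sa; apply: (@continuous_comp _ _ _ (fun s => a - s) (fun u => (qroot u)^-3)).
  by apply: cvgB; [exact: cvg_cst|exact: cvg_id].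
by apply: continuous_qrootV; rewrite subr_gt0.
Qed.

Lemma is_derive_qroot_sub (a s : R) : s < a ->
  is_derive s 1 (fun s => - 4 * qroot (a - s)) ((qroot (a - s))^-3).
Proof.
move=> sa; have as0 : 0 < a - s by rewrite subr_gt0.
have h1 : is_derive s (1 : R) (fun s => a - s) (-1).
  by apply: (is_derive_eq (is_deriveB (is_derive_cst a s 1) (is_derive_id s (1 : R)))); rewrite sub0r.
have h2 := @is_derive1_comp _ (@qroot R) (fun s => a - s) s _ _ (is_derive_qroot as0) h1.
apply: (is_derive_eq (is_deriveZ (- 4) h2)).
by rewrite [LHS]/GRing.scale /= mulrN1 mulrNN mulrA divff ?mul1r.
Qed.

Lemma measurable_qrootV (a t : R) : t <= a ->
  measurable_fun `]0, t[ (fun s : R => ((qroot (a - s))^-3)%:E).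
Proof.
move=> ta; apply/measurable_EFinP; apply: open_continuous_measurable_fun; first exact: interval_open.
by move=> s; rewrite inE/= in_itv/= => /andP[_ st]; apply: continuous_qrootV_sub; exact: lt_le_trans ta.
Qed.

(** The kernel is singular at s = t. Moving the singularity to a_m = t + 1/(m+1) allows the
    primitive -4 (a_m - s)^{1/4}, and Fatou returns to t. The bound involves t + 1 because a_m <= t
    + 1 for all m. *)
Lemma integral_qrootV (t : R) : 0 <= t ->
  (\int[leb]_(s in `]0%R, t[) ((qroot (t - s))^-3)%:E <= (4 * qroot (t + 1))%:E)%E.
Proof.
move=> t0; have [->|tn0] := eqVneq t 0.
  by rewrite set_itv_ge ?bnd_simp ?ltxx// integral_set0 lee_fin mulr_ge0// sqrtr_ge0.
have {tn0}t0 : 0 < t by rewrite lt_neqAle eq_sym tn0.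
pose a m : R := t + m.+1%:R^-1.
have at_ m : t < a m by rewrite ltrDl invr_gt0.
have ma m : measurable_fun `]0, t[ (fun s : R => ((qroot (a m - s))^-3)%:E).
  exact: measurable_qrootV (ltW (at_ m)).
apply: (@integral_lim_le _ _ _ leb _ (fun m s => ((qroot (a m - s))^-3)%:E) _ _ 0) => //.
- by move=> m s _; rewrite lee_fin invr_ge0 exprn_ge0// sqrtr_ge0.
- move=> s /=; rewrite in_itv/= => /andP[_ st]; apply: cvg_EFin; first exact: nearW.
  have h : (t - s) + m.+1%:R^-1 @[m --> \oo] --> (t - s : R).
    by rewrite -[X in _ --> X]addr0; apply: cvgD; [exact: cvg_cst|exact: cvg_harmonic].
  have hc : {for t - s, continuous (fun u => (qroot u)^-3)}.
    by apply: continuous_qrootV; rewrite subr_gt0.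
  apply: (@cvg_trans _ ((qroot (t - s + m.+1%:R^-1))^-3 @[m --> \oo])).
    by apply: near_eq_cvg; apply: nearW => m /=; rewrite /a addrAC.
  exact: (continuous_cvg _ hc h).
- move=> m _; rewrite -(@integral_itv_bndoo _ 0 t _ true false); last exact: ma.
  have dF s : s <= t -> is_derive s 1 (fun s => - 4 * qroot (a m - s)) ((qroot (a m - s))^-3).
    by move=> st; apply: is_derive_qroot_sub; exact: le_lt_trans (at_ m).
  have cF : continuous (fun s => - 4 * qroot (a m - s)).
    move=> s; apply: cvgM; first exact: cvg_cst.
    apply: continuous_comp; last exact: continuous_qroot.
    by apply: cvgB; [exact: cvg_cst|exact: cvg_id].
  rewrite (@continuous_FTC2 _ _ (fun s => - 4 * qroot (a m - s)))//.
  + rewrite -EFinB lee_fin subr0 !mulNr opprK addrC -mulrBr ler_wpM2l//.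
    rewrite (@le_trans _ _ (qroot (a m)))//; first by rewrite gerBl sqrtr_ge0.
    by rewrite !ler_wsqrtr// lerD2l invf_le1 ?ler1n.
  + apply: continuous_in_subspaceT => s; rewrite inE/= in_itv/= => /andP[_ st].
    by apply: continuous_qrootV_sub; exact: le_lt_trans (at_ m).
  + split.
    * by move=> s; rewrite in_itv/= => /andP[_ st]; case: (dF s (ltW st)).
    * by apply: cvg_at_right_filter; exact: cF.
    * by apply: cvg_at_left_filter; exact: cF.
  + by move=> s; rewrite in_itv/= => /andP[_ st]; rewrite derive1E; have ? := dF s (ltW st); exact: derive_val.
Qed.

End kernel_integral.

(** * Lipschitz bound for F *)

Section lipschitz.
Context (R : realType) (F : H R -> H R).

Lemma is_derive_dot_line (x h v : H R) (r : R) : differentiable F (x + r *: h) ->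
  is_derive r 1 (fun r => dot (F (x + r *: h)) v) (dot ('d F (x + r *: h) h) v).
Proof.
move=> dF; have c1 : t^-1 *: (F (t *: h + (x + r *: h)) - F (x + r *: h)) @[t --> 0^'] -->
    'd F (x + r *: h) h.
  by rewrite -deriveE//; exact: diff_derivable.
have c2 : t^-1 *: (dot (F (x + (t *: (1 : R) + r) *: h)) v - dot (F (x + r *: h)) v) @[t --> 0^'] -->
    dot ('d F (x + r *: h) h) v.
  apply: cvg_trans (dot_cvgl (y := v) c1); apply: near_eq_cvg; apply: nearW => t.
  rewrite dotZl dotBl; congr (_ * (dot (F _) v - _)).
  by rewrite scalerDl [t *: 1]mulr1 addrCA.
by apply: DeriveDef; [apply/cvg_ex; eexists; exact: c2|exact: cvg_lim c2].
Qed.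

Lemma C1_bounded_diff_lipschitz : C1_bounded_diff F ->
  exists2 L : R, 0 <= L & forall x y, `|F y - F x| <= L * `|y - x|.
Proof.
move=> [dF _ [M hM]]; exists `|M| => // x y.
(* Testing against v = F y - F x reduces to the scalar mean value theorem, whose left side is then
   |v|^2. *)
pose h := y - x; pose v := F y - F x.
have dg (r : R) := @is_derive_dot_line x h v r (dF _).
have cg : continuous (fun r : R => dot (F (x + r *: h)) v).
  by move=> r; apply: differentiable_continuous; apply/derivable1_diffP; case: (dg r).
have [c _] := MVT ltr01 (fun r _ => dg r) (continuous_subspaceT cg).
rewrite scale1r scale0r addr0 subr0 mulr1 -dotBl {1}/h (addrC x) subrK dotxx => e.
have [v0|v0] := eqVneq `|v| 0; first by rewrite -/v v0 mulr_ge0.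
have {}v0 : 0 < `|v| by rewrite lt_neqAle eq_sym v0 normr_ge0.
rewrite -/v -/h -(ler_pM2r v0) -expr2 e; apply: le_trans (ler_norm _) _.
apply: le_trans (CS_dot _ _) _; rewrite ler_wpM2r//; apply: le_trans (hM _ _) _.
by rewrite ler_wpM2r// ler_norm.
Qed.

End lipschitz.

Section processes.
Context (R : realType) d (Omega : measurableType d) (P : probability Omega R).
Implicit Types (X Y Z : R -> Omega -> H R) (W : R -> H R -> Omega -> R).

Lemma L2n_cst_fin (v : H R) : (L2n P (fun=> v) < +oo)%E.
Proof.
have : (L2n P (fun=> v) `^ 2 < +oo)%E.
  rewrite -L2n_sqr (integral_cst P measurableT).
  apply: lte_mul_pinfty; rewrite ?lee_fin ?exprn_ge0//.
  exact: le_lt_trans (probability_le1 P measurableT) (ltry 1).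
case: (L2n P (fun=> v)) => [r _|/=|//]; first exact: ltry.
by rewrite (negbTE (lt0r_neq0 _)).
Qed.

(** The L^2 norm is continuous on a compact interval, hence attains its maximum. This supplies the a
    priori bound from which the iteration starts. *)
Lemma C_W_bounded W (T : R) X : 0 <= T -> C_W P W T X ->
  exists2 B : R, 0 <= B & forall t, 0 <= t <= T -> (L2n P (X t) <= B%:E)%E.
Proof.
move=> T0 [XL2 Xc]; pose phi t := fine (L2n P (X t)).
have phiE t : 0 <= t <= T -> (phi t)%:E = L2n P (X t).
  by move=> tT; rewrite fineK// ge0_fin_numE ?L2n_ge0//; case: (XL2 t tT) => -[].
have mX t : 0 <= t <= T -> coef_measurable (X t).
  by move=> tT; apply: (@L2rv_coef_measurable _ _ _ P); case: (XL2 t tT).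
have cphi : {within `[0, T], continuous phi}.
  apply/subspace_continuousP => t /=; rewrite in_itv/= => tT; apply/cvgrPdist_le => eps eps0.
  have := Xc t tT _ (@nbhs_open_ereal_lt R 0 (fun=> eps) eps0).
  move=> h; refine (@filterS _ (nbhs t) _ _ _ _ h) => s /=; rewrite in_itv/= => hs sT.
  have {}hs := hs sT.
  have d1 U V : coef_measurable U -> coef_measurable V ->
      (L2n P U <= L2n P (fun w => U w - V w)%R + L2n P V)%E.
    move=> mU mV; apply: L2n_le_add => [|//|w]; [exact: coef_measurableB|rewrite -{1}(subrK (V w) (U w)); exact: ler_normD].
  rewrite ler_distl lerBlDr -!lee_fin !EFinD !phiE//; apply/andP; split.
    apply: le_trans (d1 _ _ (mX s sT) (mX t tT)) _; rewrite [leLHS]addeC.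
    exact: (leeD (lexx _) (ltW hs)).
  rewrite L2n_distC in hs; apply: le_trans (d1 _ _ (mX t tT) (mX s sT)) _; rewrite [leLHS]addeC.
  exact: (leeD (lexx _) (ltW hs)).
have [c _ hc] := EVT_max T0 cphi.
exists `|phi c| => // t tT; rewrite -phiE// lee_fin.
by apply: le_trans (ler_norm _); apply: hc; rewrite in_itv.
Qed.

End processes.

Section contraction.
Context (R : realType).

(** The bound rho improves to rho/2 + eta, a map with fixed point 2 eta. After k iterations B/2^k +
    2 eta is an admissible bound, and k tends to infinity. *)
Lemma weighted_contraction (T beta eta B : R) (phi : R -> \bar R) : 0 <= beta -> 0 <= eta -> 0 <= B ->
  (forall t, 0 <= t <= T -> (phi t <= B%:E)%E) ->
  (forall rho, 0 <= rho -> (forall t, 0 <= t <= T -> (phi t <= (rho * expR (beta * t))%:E)%E) ->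
     forall t, 0 <= t <= T -> (phi t <= ((rho / 2 + eta) * expR (beta * t))%:E)%E) ->
  forall t, 0 <= t <= T -> (phi t <= (2 * eta * expR (beta * t))%:E)%E.
Proof.
move=> b0 eta0 B0 phiB step t tT.
have iter k : forall t, 0 <= t <= T -> (phi t <= ((B / 2 ^+ k + 2 * eta) * expR (beta * t))%:E)%E.
  elim: k => [|k IH] {t tT}t tT.
    apply: le_trans (phiB t tT) _; rewrite lee_fin expr0 divr1 mulrDl -[leLHS]mulr1.
    case/andP: tT => t0 _; rewrite (@le_trans _ _ (B * expR (beta * t)))//.
      by rewrite ler_wpM2l// -[leLHS]expR0 ler_expR mulr_ge0.
    by rewrite lerDl !mulr_ge0// expR_ge0.
  have rho0 : 0 <= B / 2 ^+ k + 2 * eta by rewrite addr_ge0 ?mulr_ge0 ?divr_ge0 ?exprn_ge0.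
  have := step _ rho0 IH t tT; congr (_ <= (_ * _)%:E)%E.
  by rewrite exprS; field; rewrite expf_neq0.
have c : ((B / 2 ^+ k + 2 * eta) * expR (beta * t))%:E @[k --> \oo] --> (2 * eta * expR (beta * t))%:E.
  apply: cvg_EFin; first exact: nearW.
  apply: cvgM; last exact: cvg_cst.
  rewrite -[X in _ --> X]add0r -[X in _ --> X + _](mulr0 B).
  apply: cvgD; last exact: cvg_cst.
  apply: cvgM; first exact: cvg_cst.
  under eq_fun do rewrite -exprVn.
  by apply: cvg_expr; rewrite ger0_norm// invf_lt1// ltr1n.
rewrite -(cvg_lim _ c)//; apply: lime_ge; first exact: cvgP c.
by apply: nearW => k; exact: iter.
Qed.

End contraction.

Section normed_modules.
Context (R : realType) (V W : normedModType R).

Lemma lipschitz_continuous (F : V -> W) (L : R) : 0 <= L ->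
  (forall x y, `|F y - F x| <= L * `|y - x|) -> continuous F.
Proof.
move=> L0 lipF x; apply/cvgrPdist_le => eps eps0; near=> y.
apply: le_trans (lipF _ _) _; rewrite (@le_trans _ _ ((L + 1) * `|x - y|))//.
  by rewrite ler_wpM2r// lerDl.
rewrite mulrC -ler_pdivlMr ?ltr_wpDl//; near: y; apply: cvgr_dist_le; first exact: cvg_id.
by rewrite divr_gt0// ltr_wpDl.
Unshelve. all: by end_near. Qed.

Lemma norm_ge0Z (a : R) (v : V) : 0 <= a -> `|a *: v| = a * `|v|.
Proof. by move=> a0; rewrite normrZ ger0_norm. Qed.

End normed_modules.

(** * Comparison of X_n and X *)

Section mild_solutions.
Context (R : realType) d (Omega : measurableType d) (P : probability Omega R).
Context (S : R -> H R -> H R) (F : H R -> H R) (L : R).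
Hypothesis hS : is_semigroup_of (@H2_per R) (@opA R) S.
Hypothesis L0 : 0 <= L.
Hypothesis lipF : forall x y, `|F y - F x| <= L * `|y - x|.
Implicit Types (X Y : Omega -> H R).
Local Notation leb := (@lebesgue_measure R).

Lemma L2rv_comp_measurable X : L2rv P X -> coef_measurable (fun w => F (X w)).
Proof.
move=> [mX _]; apply: borel_coef_measurable => U oU.
by apply: (mX (F @^-1` U)); move/continuousP: (lipschitz_continuous L0 lipF); apply.
Qed.

Lemma L2n_comp_le X (B : R) : L2rv P X -> (L2n P X <= B%:E)%E ->
  (L2n P (fun w => F (X w)) <= (fine (L2n P (fun=> F 0)) + L * B)%:E)%E.
Proof.
move=> hX XB; have mX := L2rv_coef_measurable hX.
apply: (@le_trans _ _ (L2n P (fun=> F 0%R) + L2n P (fun w => L *: X w)%R)%E).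
  apply: L2n_le_add => [k||w]; [exact: measurable_cst|exact: coef_measurableZ|].
  rewrite -{1}(subrK (F 0) (F (X w))) addrC; apply: le_trans (ler_normD _ _) _.
  by rewrite lerD2l normrZ ger0_norm//; have := lipF 0 (X w); rewrite subr0.
rewrite EFinD fineK ?ge0_fin_numE ?L2n_ge0 ?L2n_cst_fin//.
by apply: leeD => //; rewrite L2nZ// ger0_norm// EFinM lee_wpmul2l ?lee_fin.
Qed.

Lemma K_coef_measurable t X : 0 < t -> coef_measurable X -> coef_measurable (fun w => K_ S t (X w)).
Proof.
move=> t0 mX k; rewrite (_ : (fun w => _) = (fun w => - (k%:~R * expR (lam R k * t)) * dot (X w) (e_ R (- k)))).
  by apply: measurable_funM; [exact: measurable_cst|exact: mX].
by apply/funext => w; rewrite (K_coef hS)// mulNr.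
Qed.

Lemma Kn_coef_measurable n t X : 0 < t -> coef_measurable X -> coef_measurable (fun w => K_n S n t (X w)).
Proof.
move=> t0 mX k; have [kn|kn] := boolP (`|k| <= n)%N; last first.
  rewrite (_ : (fun w => _) = cst 0); first exact: measurable_cst.
  by apply/funext => w; rewrite (Kn_coef hS)// (negbTE kn).
rewrite (_ : (fun w => _) = (fun w => - (k%:~R * expR (lam R k * t)) * dot (X w) (e_ R (- k)))).
  by apply: measurable_funM; [exact: measurable_cst|exact: mX].
by apply/funext => w; rewrite (Kn_coef hS)// kn mulNr.
Qed.

Lemma L2n_Kn_K n t X Y : 0 < t -> coef_measurable X -> coef_measurable Y ->
  coef_measurable (fun w => F (Y w)) ->
  (L2n P (fun w => K_n S n t (F (X w)) - K_ S t (F (Y w)))%R <=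
   ((qroot t)^-2 * L)%:E * L2n P (fun w => X w - Y w)%R +
   ((Num.sqrt n.+1%:R)^-1 * (qroot t)^-3)%:E * L2n P (fun w => F (Y w)))%E.
Proof.
move=> t0 mX mY mF; have q0 := qroot_gt0 t0.
have a0 : 0 <= (qroot t)^-2 * L by rewrite mulr_ge0// invr_ge0 exprn_ge0// ltW.
have b0 : 0 <= (Num.sqrt n.+1%:R)^-1 * (qroot t)^-3.
  by rewrite mulr_ge0// invr_ge0 ?sqrtr_ge0// exprn_ge0// ltW.
rewrite -{1}(ger0_norm a0) -{1}(ger0_norm b0) -!L2nZ//; last exact: coef_measurableB.
apply: L2n_le_add => [||w]; [apply: coef_measurableZ; exact: coef_measurableB|exact: coef_measurableZ|].
apply: le_trans (Kn_K_bound hS _ _ _ t0) _; apply: lerD; rewrite [leRHS]norm_ge0Z//.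
rewrite -mulrA ler_wpM2l ?invr_ge0 ?exprn_ge0 ?(ltW q0)//; exact: lipF.
Qed.

Section two_solutions.
Context (W : R -> H R -> Omega -> R) (WA : R -> Omega -> H R) (T : R) (x : H R).
Context (X Xn : R -> Omega -> H R) (n : nat).
Hypothesis hX : is_mild_solution P W S WA F T (K_ S) x X.
Hypothesis hXn : is_mild_solution P W S WA F T (K_n S n) x Xn.
Let eps : R := (Num.sqrt n.+1%:R)^-1.

Let XL2 s : 0 <= s <= T -> L2rv P (X s).
Proof. by move=> sT; case: hX => -[/(_ s sT)[]]. Qed.

Let XnL2 s : 0 <= s <= T -> L2rv P (Xn s).
Proof. by move=> sT; case: hXn => -[/(_ s sT)[]]. Qed.

(** One pass through the integral equation, from the majorant rho exp(b^4 s). Both the Lipschitz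
    part and the truncation part end up under the same kernel (t - s)^{-3/4}, with total coefficient
    [C]. *)
Lemma mild_dist_le (b rho B t : R) : 0 < b -> 0 <= rho -> 0 <= B -> 0 <= t <= T ->
  (forall s, 0 <= s <= T -> (L2n P (fun w => F (X s w)) <= B%:E)%E) ->
  (forall s, 0 <= s <= T ->
     (L2n P (fun w => Xn s w - X s w)%R <= (rho * expR (b ^+ 4 * s))%:E)%E) ->
  (L2n P (fun w => Xn t w - X t w)%R <=
   ((L * rho * b^-1 * expR (b ^+ 4 * t) + eps * B) * (4 * qroot (t + 1)))%:E)%E.
Proof.
move=> b0 rho0 B0 tT FB Xrho; have /andP[t0 tT'] := tT.
have [_ /(_ t tT)[Y hY XY]] := hX; have [_ /(_ t tT)[Yn hYn XYn]] := hXn.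
have inT s : `]0, t[%classic s -> 0 < t - s /\ 0 <= s <= T.
  rewrite /= in_itv/= => /andP[s0 st]; split; first by rewrite subr_gt0.
  by rewrite (ltW s0) (le_trans (ltW st) tT').
have mX s : 0 <= s <= T -> coef_measurable (X s).
  by move=> sT; exact: L2rv_coef_measurable (XL2 sT).
have mXn s : 0 <= s <= T -> coef_measurable (Xn s).
  by move=> sT; exact: L2rv_coef_measurable (XnL2 sT).
have mY := L2rv_coef_measurable hY.1; have mYn := L2rv_coef_measurable hYn.1.
(* S(t)x and W_A(t) occur in both equations and cancel almost surely. *)
rewrite (_ : L2n P _ = L2n P (fun w => Yn w - Y w)); last first.
  apply: L2n_ae_eq; [by apply: coef_measurableB; [exact: mXn|exact: mX]|exact: coef_measurableB|].
  by apply: filterS2 XYn XY => w -> ->; rewrite opprD addrACA subrr addr0 opprD addrACA subrr add0r.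
have eps0 : 0 <= eps by rewrite invr_ge0 sqrtr_ge0.
set C := L * rho * b^-1 * expR (b ^+ 4 * t) + eps * B.
have C0 : 0 <= C.
  by rewrite addr_ge0 ?mulr_ge0 ?invr_ge0 ?expR_ge0// ltW.
have q3 s : 0 <= (qroot (t - s))^-3 by rewrite invr_ge0 exprn_ge0// sqrtr_ge0.
have mq := @measurable_qrootV R t t (lexx _).
apply: le_trans (@bochner_integral_le _ _ _ P `]0, t[ _ _ Yn Y
    (fun s => C%:E * ((qroot (t - s))^-3)%:E)%E _ _ _ _ hYn hY _ _ _) _.
- exact: measurable_itv.
- by rewrite lebesgue_measure_itv/=; case: ifP => _; rewrite ?ltry// -EFinB ltry.
- move=> s /inT[ts sT]; apply: Kn_coef_measurable => //; apply: L2rv_comp_measurable; exact: XnL2.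
- move=> s /inT[ts sT]; apply: K_coef_measurable => //; apply: L2rv_comp_measurable; exact: XL2.
- exact: measurable_funeM.
- by move=> s _; rewrite -EFinM lee_fin mulr_ge0.
- move=> s /inT[ts sT].
  apply: le_trans (L2n_Kn_K n ts (mXn s sT) (mX s sT) (L2rv_comp_measurable (XL2 sT))) _.
  have q2 : 0 <= (qroot (t - s))^-2 by rewrite invr_ge0 exprn_ge0// sqrtr_ge0.
  apply: (@le_trans _ _ (((qroot (t - s))^-2 * L)%:E * (rho * expR (b ^+ 4 * s))%:E +
      (eps * (qroot (t - s))^-3)%:E * B%:E)%E).
    by apply: leeD; apply: lee_wpmul2l; rewrite ?lee_fin ?mulr_ge0//; [exact: Xrho|exact: FB].
  rewrite -!EFinM -EFinD lee_fin /C [leRHS]mulrDl; apply: lerD; last first.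
    by rewrite mulrAC.
  (* The decaying factor is spent on the kernel through [qroot_expR_le]; the other one is the weight
     at time t. *)
  have e1 : expR (b ^+ 4 * s) = expR (- (b ^+ 4 * (t - s))) * expR (b ^+ 4 * t).
    by rewrite -expRD; congr expR; ring.
  have := qroot_expR_le b0 ts; set q' := (qroot _)^-2; set q'' := (qroot _)^-3 => qe.
  rewrite e1; set E := expR (b ^+ 4 * t); set E' := expR _ in qe *.
  have E0 : 0 <= E by exact: expR_ge0.
  have -> : q' * L * (rho * (E' * E)) = L * rho * E * (q' * E') by ring.
  have -> : L * rho * b^-1 * E * q'' = L * rho * E * (b^-1 * q'') by ring.
  by rewrite ler_wpM2l// !mulr_ge0.
rewrite ge0_integralZl//.
- by rewrite EFinM lee_wpmul2l ?lee_fin//; exact: integral_qrootV.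
- by move=> s _; rewrite lee_fin.
Qed.

Lemma mild_dist_weighted (B : R) : 0 <= T -> 0 <= B ->
  (forall s, 0 <= s <= T -> (L2n P (fun w => F (X s w)) <= B%:E)%E) ->
  let M := 4 * qroot (T + 1) in
  forall t, 0 <= t <= T -> (L2n P (fun w => Xn t w - X t w)%R <=
   (2 * (eps * (B * M)) * expR ((2 * L * M + 1) ^+ 4 * t))%:E)%E.
Proof.
move=> T0 B0 FB M; have M0 : 0 <= M by rewrite mulr_ge0// sqrtr_ge0.
have qM t : t <= T -> 4 * qroot (t + 1) <= M.
  by move=> tT; rewrite ler_wpM2l// !ler_wsqrtr// lerD2r.
(* This b makes L M / b at most 1/2, the contraction factor; the added 1 keeps it positive. *)
clearbody M; set b := 2 * L * M + 1.
have b0 : 0 < b by apply: ltr_wpDl; rewrite ?mulr_ge0.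
have eps0 : 0 <= eps by rewrite invr_ge0 sqrtr_ge0.
have [Bn Bn0 hBn] := C_W_bounded T0 hXn.1; have [BX BX0 hBX] := C_W_bounded T0 hX.1.
apply: (@weighted_contraction R T (b ^+ 4) (eps * (B * M)) (Bn + BX)
  (fun t => L2n P (fun w => Xn t w - X t w)%R)).
- by rewrite exprn_ge0// ltW.
- by rewrite !mulr_ge0.
- exact: addr_ge0.
- move=> t tT; rewrite EFinD; apply: le_trans (leeD (hBn t tT) (hBX t tT)).
  apply: L2n_le_add => [||w]; [exact: L2rv_coef_measurable (XnL2 tT)|exact: L2rv_coef_measurable (XL2 tT)|exact: ler_normB].
move=> rho rho0 hrho t tT; have /andP[t0 tT'] := tT.
apply: le_trans (mild_dist_le b0 rho0 B0 tT FB hrho) _; rewrite lee_fin.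
set E := expR (b ^+ 4 * t).
have E1 : 1 <= E by rewrite -[leLHS]expR0 ler_expR mulr_ge0// exprn_ge0// ltW.
have E0 : 0 <= E by exact: le_trans E1.
apply: (@le_trans _ _ ((L * rho * b^-1 * E + eps * B) * M)).
  rewrite ler_wpM2l ?qM//.
  by rewrite addr_ge0// !mulr_ge0// invr_ge0 ltW.
rewrite mulrDl [leRHS]mulrDl; apply: lerD; last first.
  by rewrite -mulrA -[leLHS]mulr1 ler_wpM2l// !mulr_ge0.
rewrite (_ : L * rho * b^-1 * E * M = rho * (L * M * b^-1) * E); last by ring.
rewrite ler_wpM2r// ler_wpM2l// ler_pdivrMr// /b.
have -> : 2^-1 * (2 * L * M + 1) = L * M + 2^-1 by field.
by rewrite lerDl.
Qed.

End two_solutions.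

End mild_solutions.

Theorem theorem3 (R : realType) (d : measure_display) (Omega : measurableType d)
    (P : probability Omega R) (W : R -> H R -> Omega -> R)
    (hW : cylindrical_wiener P W)
    (S : R -> H R -> H R) (hS : is_semigroup_of (@H2_per R) (@opA R) S)
    (F : H R -> H R) (hF : C1_bounded_diff F)
    (T : R) (hT : 0 < T)
    (WA : R -> Omega -> H R)
    (hWA : forall t, 0 <= t <= T ->
       is_wiener_integral P W t (fun s => S (t - s)) (WA t))
    (x : H R) (X : R -> Omega -> H R) (Xn : nat -> R -> Omega -> H R)
    (hX : is_mild_solution P W S WA F T (K_ S) x X)
    (hXn : forall n,
       is_mild_solution P W S WA F T (K_n S n) x (Xn n)) :
  ereal_sup [set (\int[P]_w (`|Xn n t w - X t w| ^+ 2)%:E)%E | t in `[0, T]]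
    @[n --> \oo] --> 0%E.
Proof.
have [L L0 lipF] := C1_bounded_diff_lipschitz hF; have T0 := ltW hT.
have [BX BX0 hBX] := C_W_bounded T0 hX.1.
pose B := fine (L2n P (fun=> F 0)) + L * BX.
have B0 : 0 <= B by rewrite addr_ge0 ?mulr_ge0// fine_ge0// L2n_ge0.
have FB s : 0 <= s <= T -> (L2n P (fun w => F (X s w)) <= B%:E)%E.
  move=> sT; apply: (L2n_comp_le L0 lipF _ (hBX s sT)).
  by case: hX => -[/(_ s sT)[]].
have key n := mild_dist_weighted hS L0 lipF hX (hXn n) T0 B0 FB.
set M := 4 * qroot (T + 1) in key.
have M0 : 0 <= M by rewrite mulr_ge0// sqrtr_ge0.
clearbody M; set beta := (2 * L * M + 1) ^+ 4 in key.
have beta0 : 0 <= beta by rewrite exprn_even_ge0.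
(* The square of the bound of [mild_dist_weighted], taken at t = T, without its factor (n+1)^{-1/2},
   whose square is [harmonic n]. *)
pose C := (2 * (B * M) * expR (beta * T)) ^+ 2.
apply: (@squeeze_cvge _ _ _ _ (cst 0%E) _ (fun n => (C * harmonic n)%:E)).
- apply: nearW => n; apply/andP; split.
    (* The term t = 0 shows that the supremum is nonnegative; over an empty set it would be -oo. *)
    apply: (@le_trans _ _ (\int[P]_w (`|Xn n 0 w - X 0 w| ^+ 2)%:E)%E).
      by apply: integral_ge0 => w _; rewrite lee_fin exprn_ge0.
    by apply: ereal_sup_ubound; exists 0 => //=; rewrite in_itv/= lexx.
  apply: ub_ereal_sup => _ [t /= tT <-]; rewrite in_itv/= in tT; have /andP[t0 tT'] := tT.
  rewrite L2n_sqr; have := key n t tT; have := L2n_ge0 P (fun w => Xn n t w - X t w).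
  case: (L2n _ _) => [r|//|//]; rewrite !lee_fin => r0 hr.
  rewrite powR_mulrn//.
  set eps := (Num.sqrt n.+1%:R)^-1 in hr.
  have eps0 : 0 <= eps by rewrite invr_ge0 sqrtr_ge0.
  have -> : C * harmonic n = (2 * (eps * (B * M)) * expR (beta * T)) ^+ 2.
    have -> : harmonic n = eps ^+ 2 by rewrite /eps exprVn sqr_sqrtr.
    by rewrite /C; ring.
  have BM0 : 0 <= 2 * (eps * (B * M)) by rewrite !mulr_ge0.
  rewrite lerXn2r ?nnegrE ?mulr_ge0 ?expR_ge0//; apply: le_trans hr _.
  by rewrite ler_wpM2l// ler_expR ler_wpM2l.
- exact: cvg_cst.
- apply: cvg_EFin; first exact: nearW.
  rewrite -(mulr0 C); apply: cvgM; [exact: cvg_cst|exact: cvg_harmonic].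
Qed.
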